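(* Let $\Sigma\subset\mathbb P^4$ be the Segre cubic hypersurface over $\mathbb C$ and $\mathcal S=\Sigma^\vee$ its dual variety. Let $P\in\Sigma$ be a smooth point of the Segre cubic which does not lie in any of the $15$ planes contained in $\Sigma$. Then the Kummer quartic $X_P$ obtained as the discriminant for the projection $\pi_P:\Sigma\dashrightarrow\mathbb P^3$ is the dual of the Kummer quartic $$X'_P:=\mathcal S\cap T_{P'}\mathcal S\subset T_{P'}\mathcal S\cong\mathbb P^3,$$ where $P'\in\mathcal S$ is the dual point of $P$.
   Context: The Segre cubic is $\Sigma=\{x\in\mathbb P^5\mid s_1(x)=s_3(x)=0\}$, $s_i(x)=\sum_{j=0}^5x_j^i$, regarded as a hypersurface in $\mathbb P^4=\{s_1=0\}$. It has $10$ nodes and contains exactly $15$ planes, namely the $\mathfrak S_6$-orbit of $\{x_0+x_3=x_1+x_4=x_2+x_5=0\}$. Its dual variety $\mathcal S=\Sigma^\vee$ (the Igusa quartic) is the quartic $\{x\in\mathbb P^5\mid s_1(x)=s_2(x)^2-4s_4(x)=0\}$. The dual point $P'\in\mathcal S$ of a smooth point $P\in\Sigma$ is the tangent hyperplane of $\Sigma$ at $P$. By biduality the tangent hyperplane $T_{P'}\mathcal S$ is the space of hyperplanes of $\mathbb P^4$ passing through $P$, i.e. the dual of the $\mathbb P^3$ of lines through $P$, which is the target of the projection $\pi_P$ with centre $P$. Discriminant: choose coordinates $(u,x_0,x_1,x_2,x_3)$ on $\mathbb P^4$ with $P=(1,0,0,0,0)$ and write the equation of $\Sigma$ as $L(x)u^2+2Q(x)u+G(x)=0$,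 with $L,Q,G$ homogeneous of degrees $1,2,3$; then $X_P=\{L(x)G(x)-Q(x)^2=0\}\subset\mathbb P^3$. A Kummer quartic is a quartic surface in $\mathbb P^3$ with exactly $16$ singular points. *)

(* Defs.v *)
From mathcomp Require Export all_boot all_order all_fingroup all_algebra.
From mathcomp Require Export complex reals mpoly.

Set Implicit Arguments.
Unset Strict Implicit.
Unset Printing Implicit Defensive.

Import GRing.Theory.
Local Open Scope ring_scope.

(* A point of P^(n-1) is represented by a nonzero row vector of length n, up to
   a nonzero scalar; a subset of P^(n-1) is a predicate on vectors, of which
   only the values at nonzero vectors matter.  A row vector h also represents a
   hyperplane, namely {x | x *m h^T = 0}, i.e. a point of the dual space. *)

Section ProjectiveGeometry.
Variables (K : fieldType) (n : nat).
Implicit Types (X A : 'rV[K]_n -> Prop) (p v h x : 'rV[K]_n).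

Definition vanishes_on (F : {mpoly K[n]}) X : Prop :=
  forall x, x != 0 -> X x -> F.@[x 0] = 0.

Definition zariski_closure A x : Prop :=
  forall (d : nat) (F : {mpoly K[n]}),
    F \is d.-homog -> vanishes_on F A -> F.@[x 0] = 0.

Definition grad (F : {mpoly K[n]}) p : 'rV[K]_n := \row_i (F^`M(i)).@[p 0].

(* The linear subspace of K^n whose projectivization is the embedded tangent
   space of X (with its reduced structure) at p. *)
Definition tangent_space X p v : Prop :=
  forall (d : nat) (F : {mpoly K[n]}),
    F \is d.-homog -> vanishes_on F X -> v *m (grad F p)^T = 0.

Definition tangent_hyperplane X p h : Prop :=
  [/\ p != 0, X p, h != 0 &
      forall v, tangent_space X p v <-> v *m h^T = 0].

(* For a hypersurface X, the tangent space at p has codimension 0 or 1, and p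
   is smooth exactly when the codimension is 1.  The following three notions are
   meant for hypersurfaces only. *)
Definition smooth_point X p : Prop := exists h, tangent_hyperplane X p h.

Definition singular_point X p : Prop :=
  [/\ p != 0, X p & ~ smooth_point X p].

Definition dual_variety X : 'rV[K]_n -> Prop :=
  zariski_closure (fun h => exists p, tangent_hyperplane X p h).

Definition hypersurface_of_degree (d : nat) X : Prop :=
  exists F : {mpoly K[n]},
    [/\ F != 0, F \is d.-homog & forall x, x != 0 -> (X x <-> F.@[x 0] = 0)].

Definition has_exactly_points (N : nat) X : Prop :=
  exists f : 'I_N -> 'rV[K]_n,
    [/\ forall i, f i != 0,
        forall i j (c : K), f i = c *: f j -> i = j &
        forall x, x != 0 -> (X x <-> exists i, exists c : K, x = c *: f i)].

End ProjectiveGeometry.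

Definition kummer_quartic (K : fieldType) (X : 'rV[K]_4 -> Prop) : Prop :=
  hypersurface_of_degree 4 X /\ has_exactly_points 16 (singular_point X).

Section Segre.
Variable K : fieldType.

Definition power_sum (i : nat) (x : 'rV[K]_6) : K := \sum_(j < 6) x 0 j ^+ i.

Definition segre_cubic (x : 'rV[K]_6) : Prop :=
  power_sum 1 x = 0 /\ power_sum 3 x = 0.

(* The image under s of the plane x_0 + x_3 = x_1 + x_4 = x_2 + x_5 = 0. *)
Definition segre_plane (s : 'S_6) (x : 'rV[K]_6) : Prop :=
  forall i : 'I_3, x 0 (s (lshift 3 i)) + x 0 (s (rshift 3 i)) = 0.

Definition base_point : 'rV[K]_(1 + 4) := row_mx 1%:M 0.

(* Coordinates y = (u, x_0, ..., x_3) on P^4 = {s_1 = 0}, given by the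
   parametrization y |-> y *m B, in which P is the point (1, 0, 0, 0, 0). *)
Definition coordinates_at (P : 'rV[K]_6) (B : 'M[K]_(1 + 4, 6)) : Prop :=
  [/\ row_free B, forall y : 'rV[K]_(1 + 4), power_sum 1 (y *m B) = 0 &
      base_point *m B = P].

Definition segre_in (B : 'M[K]_(1 + 4, 6)) (y : 'rV[K]_(1 + 4)) : Prop :=
  segre_cubic (y *m B).

(* The equation of the Segre cubic in these coordinates is
   L u^2 + 2 Q u + G = 0. *)
Definition segre_equation (B : 'M[K]_(1 + 4, 6)) (L Q G : {mpoly K[4]}) : Prop :=
  [/\ L \is 1.-homog, Q \is 2.-homog, G \is 3.-homog &
      forall (u : K) (x : 'rV[K]_4),
        power_sum 3 (row_mx u%:M x *m B)
        = L.@[x 0] * u ^+ 2 + Q.@[x 0] * u *+ 2 + G.@[x 0]].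

Definition discriminant (L Q G : {mpoly K[4]}) (x : 'rV[K]_4) : Prop :=
  (L * G - Q ^+ 2).@[x 0] = 0.

(* The dual variety of the Segre cubic, in the dual coordinates. *)
Definition igusa_in (B : 'M[K]_(1 + 4, 6)) : 'rV[K]_(1 + 4) -> Prop :=
  dual_variety (segre_in B).

(* The tangent hyperplane section of the dual variety at P'.  The hyperplanes
   of P^4 through the base point have dual coordinates (0, h), where h is the
   corresponding plane in the space P^3 of lines through that point. *)
Definition tangent_section (B : 'M[K]_(1 + 4, 6)) (P' : 'rV[K]_(1 + 4))
    (h : 'rV[K]_4) : Prop :=
  igusa_in B (row_mx 0 h) /\ tangent_space (igusa_in B) P' (row_mx 0 h).

End Segre.

(* Main.v *)
(* Write s_k for the power sums, V = {s_1 = 0}, E = s_2^2 - 4 s_4, and identify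
   V with its dual by the standard quadratic form.  Up to a scalar, the gradient
   of s_3 on V at q is the centred vector of the q_j^2, and that of E at y is the
   centred vector of the s_2 y_j - 4 y_j^3.  If s_3(q) = 0, the sextic with roots
   q_j shows that E(grad s_3 (q)) = 0 and grad E (grad s_3 (q)) = s_5(q) q up to
   constants; if E(y) = 0, the sextic with roots y_j is the square of a cubic plus
   a linear term, whence s_3(grad E (y)) = 0 and grad s_3 (grad E (y)) is a
   multiple of y.  On the Segre cubic s_5 vanishes exactly on the 15 planes, so the
   two Gauss maps are inverse to each other off these planes and off the ten
   tropes of E.

   Reduced tangent spaces are computed by gradients once the form is known to
   generate a radical ideal, which holds for a form with finitely many critical
   points in at least three variables: a repeated factor along a generic line
   would sweep out infinitely many critical points.

   A critical point of the discriminant with L <> 0 lifts to one of the ten nodes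
   of the cubic; those with L = 0 are the six lines through P, which come in pairs,
   as the intersection of a line with a conic, for each of the three synthemes
   containing a fixed duad.  A critical point y of the section of E satisfies
   grad E (y) = l P; it is P' if l <> 0, and lies on one of the 15 double lines of E
   if l = 0.  Finally a point x of the discriminant off its 16 tropes lifts to the
   point q of the cubic where the line is tangent, y = grad s_3 (q) lies on the
   tangent section, and its tangent plane there is s_5(q) x, i.e. x. *)

(* Tangent spaces and dual varieties quantify over every form vanishing on a set of points, so
   nothing can be differentiated until each of the four equations (cubic, quartic, tangent section,
   discriminant) is known to divide every form vanishing on its zeros. The quartic, and the cubic in
   the same way, use a cone criterion instead: it suffices that the critical points lie on a
   hypersurface N = 0 that is a cone with vertex v, for some v where the form is nonzero.
   Irreducibility is never proved. A Gauss image is shown to be dense by listing finitely many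
   hyperplanes off which it is the whole hypersurface, with a point outside the hypersurface on each
   of them. The position of P enters as P_i + P_j <> 0 for i <> j, which on the cubic means avoiding
   the 15 planes. To keep the symmetry under permutations, identities are proved in six coordinates
   with sum zero, and bases enter only through [B] and its dual basis. *)
From HB Require Import structures.
Require Import Defs.
From mathcomp Require Import separable.
From mathcomp Require Import ring zify.

Set Implicit Arguments.
Unset Strict Implicit.
Unset Printing Implicit Defensive.

Import GRing.Theory Num.Theory.
Local Open Scope ring_scope.

(** * Forms with few critical points *)

(* Locked: unification otherwise unfolds the sum over the support. *)
HB.lock Definition line (K : fieldType) (n : nat)
    (F : {mpoly K[n]}) (a v : 'rV[K]_n) : {poly K} :=
  mmap polyC (fun i => (a 0 i)%:P + (v 0 i) *: 'X) F.

Section Ind.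
Variables (K : fieldType) (n : nat).
Implicit Types (F G : {mpoly K[n]}) (a p v : 'rV[K]_n).

(** Evaluation and restriction to a line are ring morphisms and derivatives obey the Leibniz rule,
    so identities between them need checking on constants and variables only. *)
Lemma mpoly_ring_ind (T : {mpoly K[n]} -> Prop) :
  (forall c, T c%:MP) -> (forall i, T 'X_i) ->
  (forall F G, T F -> T G -> T (F + G)) ->
  (forall F G, T F -> T G -> T (F * G)) -> forall F, T F.
Proof.
move=> TC TX TD TM F; rewrite (mpolyE F).
apply: (big_ind T); [by rewrite -mpolyC0 | exact: TD | move=> m _].
rewrite -mul_mpolyC; apply: (TM) => //; rewrite mpolyXE_id.
apply: (big_ind T); [by rewrite -mpolyC1 | exact: TM | move=> i _].
by elim: (m i) => [|k IH]; rewrite ?expr0 -?mpolyC1 // exprS; apply: TM.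
Qed.

Lemma lineD a v : {morph (fun F => line F a v) : F G / F + G}.
Proof. rewrite line.unlock; exact: mmapD. Qed.
Lemma lineM a v : {morph (fun F => line F a v) : F G / F * G}.
Proof. rewrite line.unlock; exact: rmorphM. Qed.
Lemma lineC a v c : line c%:MP a v = c%:P.
Proof. rewrite line.unlock; exact: mmapC. Qed.
Lemma lineX a v i : line 'X_i a v = (a 0 i)%:P + (v 0 i) *: 'X.
Proof. by rewrite line.unlock mmapX mmap1U. Qed.

Lemma horner_line F a v t : (line F a v).[t] = F.@[(a + t *: v) 0].
Proof.
elim/mpoly_ring_ind: F => [c|i|F G IHp IHq|F G IHp IHq].
- by rewrite lineC mevalC hornerC.
- by rewrite lineX mevalXU !hornerE !mxE mulrC.
- by rewrite lineD mevalD hornerD IHp IHq.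
- by rewrite lineM mevalM hornerM IHp IHq.
Qed.

Definition dgrad (F : {mpoly K[n]}) (p v : 'rV[K]_n) : K :=
  \sum_i v 0 i * (F^`M(i)).@[p 0].

Lemma deriv_line F a v : (line F a v)^`().[0] = dgrad F a v.
Proof.
rewrite /dgrad; elim/mpoly_ring_ind: F => [c|i|F G IHp IHq|F G IHp IHq].
- rewrite lineC derivC hornerC big1 // => i _.
  by rewrite mderivC meval0 mulr0.
- rewrite lineX derivD derivC derivZ derivX add0r hornerZ hornerC mulr1.
  rewrite (bigD1 i) //= mderivX big1 => [|j ji].
    have -> : (U_(i) - U_(i) = 0)%MM by apply/mnmP=> j; rewrite mnmBE subnn mnm0E.
    by rewrite mnm1E eqxx scale1r mpolyX0 meval1 mulr1 addr0.
  by rewrite mderivX mnm1E (negPf (_ : i != j)) 1?eq_sym // scale0r meval0 mulr0.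
- rewrite lineD derivD hornerD IHp IHq -big_split /=; apply: eq_bigr => i _.
  by rewrite mderivD mevalD mulrDr.
- rewrite lineM derivM hornerD !hornerM IHp IHq !horner_line scale0r addr0.
  rewrite mulr_suml mulr_sumr -big_split /=; apply: eq_bigr => i _.
  by rewrite mderivM mevalD !mevalM; ring.
Qed.
End Ind.

Lemma meval_homog (K : fieldType) n d (F : {mpoly K[n]}) (c : K) (p : 'rV_n) :
  F \is d.-homog -> F.@[(c *: p) 0] = c ^+ d * F.@[p 0].
Proof.
move=> hF; rewrite !mevalE mulr_sumr; apply: eq_big_seq => m /(dhomog_mf hF) <-.
rewrite /= mdegE -prodrXr mulrCA; congr (_ * _); rewrite -big_split /=.
by apply: eq_bigr => i _; rewrite mxE exprMn.
Qed.

Section NumClosed.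
Variable K : numClosedFieldType.

Lemma poly_ext (p q : {poly K}) : (forall t, p.[t] = q.[t]) -> p = q.
Proof.
move=> pq; apply/eqP; rewrite -subr_eq0; apply/negPn/negP => r_neq0.
set r := p - q in r_neq0.
pose s := [seq i%:R : K | i <- iota 0 (size r)].
have uniq_s : uniq s.
  by rewrite map_inj_uniq ?iota_uniq // => i j /eqP; rewrite eqr_nat => /eqP.
have root_s : all (root r) s.
  by apply/allP=> t _; rewrite /root /r hornerD hornerN pq subrr.
by have := max_poly_roots r_neq0 root_s uniq_s; rewrite size_map size_iota ltnn.
Qed.

Section Poly.
Variable n : nat.
Implicit Types (F G : {mpoly K[n]}) (p v : 'rV[K]_n).

(** Derivatives are read off from values: neither Euler's relation nor the gradient of the
    discriminant then needs partial derivatives to be expanded. *)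
Lemma dgrad_eval F p v (g : {poly K}) :
  (forall t, F.@[(p + t *: v) 0] = g.[t]) -> dgrad F p v = g^`().[0].
Proof.
move=> Fg; rewrite -deriv_line; congr (_^`().[0]).
by apply: poly_ext => t; rewrite horner_line.
Qed.

Lemma euler d F p : F \is d.-homog -> dgrad F p p = d%:R * F.@[p 0].
Proof.
move=> hF; rewrite (@dgrad_eval _ _ _ (F.@[p 0] *: (1 + 'X) ^+ d)).
  rewrite derivZ hornerZ deriv_exp derivD derivC derivX add0r mul1r.
  by rewrite hornerMn ?horner_exp !hornerE expr1n mulrC.
move=> t; rewrite -[p in p + _]scale1r -scalerDl (meval_homog _ _ hF).
by rewrite !hornerE mulrC ?horner_exp ?hornerE.
Qed.

Lemma meval_zero F : F.@[(0 : 'rV[K]_n) 0] = F@_0.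
Proof.
elim/mpoly_ring_ind: F => [c|i|F G IHF IHG|F G IHF IHG].
- by rewrite mevalC mcoeffC eqxx mulr1.
- by rewrite mevalXU mxE mcoeffX mnm1_eq0.
- by rewrite mevalD mcoeffD IHF IHG.
- by rewrite mevalM IHF IHG rmorphM.
Qed.

(** Induction on the degree of the monomial m: the partial derivatives of F vanish everywhere too,
    and in characteristic zero the coefficient of m is determined by one of lower degree in a
    partial derivative. *)
Lemma mpoly_ext0 F : (forall p, F.@[p 0] = 0) -> F = 0.
Proof.
move=> F0; apply/mpolyP => m; rewrite mcoeff0.
have [k] := ubnP (mdeg m); elim: k m F F0 => // k IH m F F0 degm.
have [->|m_neq0] := eqVneq m 0%MM; first by rewrite -meval_zero.
have [i mi] : exists i, m i != 0%N.
  apply/existsP; apply: contra_neqT m_neq0; rewrite negb_exists => /forallP m0.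
  by apply/mnmP=> i; rewrite mnm0E; have /= := m0 i; rewrite negbK => /eqP.
have dF0 p : (F^`M(i)).@[p 0] = 0.
  have := @dgrad_eval F p (delta_mx 0 i) 0.
  rewrite deriv0 horner0 /dgrad (bigD1 i) //= big1 ?addr0 => [|j ji].
    by rewrite mxE !eqxx mul1r; apply=> t; rewrite F0 horner0.
  by rewrite mxE (negPf ji) andbF mul0r.
have mE : (m = m - U_(i) + U_(i))%MM by rewrite submK // lep1mP.
have degm' : (mdeg (m - U_(i)) < k)%N.
  by move: degm; rewrite [in mdeg m]mE mdegD mdeg1 addn1 ltnS.
have /eqP := IH _ _ dF0 degm'.
by rewrite mcoeff_mderiv -mE mulrn_eq0 /= => /eqP.
Qed.

Lemma mpoly_neq0_ex F : F != 0 -> exists p, F.@[p 0] != 0.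
Proof.
move=> F_neq0; have [//|nex] := boolp.pselect (exists p, F.@[p 0] != 0).
case/eqP: F_neq0; apply: mpoly_ext0 => p; apply/eqP/negPn/negP => Fp.
by apply: nex; exists p.
Qed.

End Poly.
End NumClosed.

(** * Restriction of a polynomial to the line of direction v through the generic point *)

HB.lock Definition gline (K : numClosedFieldType) (n : nat)
    (F : {mpoly K[n]}) (v : 'rV[K]_n) : {poly {mpoly K[n]}} :=
  mmap (polyC \o @mpolyC n K) (fun i => ('X_i)%:P + ((v 0 i)%:MP *: 'X)) F.

Section GenericLine.
Variables (K : numClosedFieldType) (n : nat).
Implicit Types (F G f : {mpoly K[n]}) (a b p v : 'rV[K]_n).

Lemma glineD v : {morph (fun F => gline F v) : F G / F + G}.
Proof. rewrite gline.unlock; exact: mmapD. Qed.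
Lemma glineM v : {morph (fun F => gline F v) : F G / F * G}.
Proof. rewrite gline.unlock; exact: rmorphM. Qed.
Lemma glineC v c : gline c%:MP v = c%:MP%:P.
Proof. rewrite gline.unlock; exact: mmapC. Qed.
Lemma glineX v i : gline 'X_i v = ('X_i)%:P + ((v 0 i)%:MP *: 'X).
Proof. by rewrite gline.unlock mmapX mmap1U. Qed.

Lemma gline_horner0 F v : (gline F v).[0] = F.
Proof.
elim/mpoly_ring_ind: F => [c|i|p q IHp IHq|p q IHp IHq].
- by rewrite glineC hornerC.
- by rewrite glineX !hornerE ?mulr0 ?addr0.
- by rewrite glineD hornerD; congr (_ + _).
- by rewrite glineM hornerM; congr (_ * _).
Qed.

Lemma gline_spec F a v : map_poly (meval (a 0)) (gline F v) = line F a v.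
Proof.
elim/mpoly_ring_ind: F => [c|i|p q IHp IHq|p q IHp IHq].
- by rewrite glineC lineC map_polyC /= mevalC.
- rewrite glineX lineX rmorphD /= map_polyC /= mevalXU -mul_polyC rmorphM /=.
  by rewrite map_polyC map_polyX /= mevalC mul_polyC.
- by rewrite glineD rmorphD lineD; congr (_ + _).
- by rewrite glineM rmorphM lineM; congr (_ * _).
Qed.

(** The coefficient of t^d in F(a + t v) is free of a. Normalising F(v) = 1 thus makes the
    restriction monic, and division by it needs no denominators. *)
Definition homog_line d F v : Prop :=
  (size (gline F v) <= d.+1)%N /\ (gline F v)`_d = (F.@[v 0])%:MP.

Lemma homog_lineM d e F G v :
  homog_line d F v -> homog_line e G v -> homog_line (d + e) (F * G) v.
Proof.
move=> [szF FE] [szG GE]; split; rewrite glineM.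
  apply: leq_trans (size_polyMleq _ _) _.
  by move: szF szG; lia.
rewrite coefM mevalM mpolyCM -FE -GE.
have d_lt : (d < (d + e).+1)%N by rewrite ltnS leq_addr.
rewrite (bigD1 (Ordinal d_lt)) //= addKn big1 ?addr0 // => i.
rewrite -val_eqE /= neq_ltn => /orP[i_lt|i_gt].
  rewrite [X in _ * X]nth_default ?mulr0 //; apply: leq_trans szG _.
  by move: i_lt; lia.
by rewrite [X in X * _]nth_default ?mul0r //; apply: leq_trans szF _.
Qed.

Lemma homog_line_dhomog d F v : F \is d.-homog -> homog_line d F v.
Proof.
move=> hF; rewrite [F]mpolyE big_seq.
apply: (big_ind (fun G => homog_line d G v)) => [|G H [szG GE] [szH HE]|m mF].
- by rewrite /homog_line -mpolyC0 glineC mevalC mpolyC0 size_poly0 coef0.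
- split; rewrite glineD; last by rewrite coefD mevalD mpolyCD; congr (_ + _).
  by apply: leq_trans (size_polyD _ _) _; rewrite geq_max szG szH.
rewrite -mul_mpolyC -[d]add0n; apply: homog_lineM.
  by split; rewrite glineC ?coefC ?mevalC ?size_polyC ?leq_b1.
rewrite -(dhomog_mf hF mF) /= mdegE mpolyXE_id.
apply: (big_ind2 (fun e G => homog_line e G v)) => [|e1 G1 e2 G2|i _].
- by split; rewrite -mpolyC1 glineC ?coefC ?mevalC ?size_polyC ?leq_b1.
- exact: homog_lineM.
elim: (m i) => [|k IH].
  by split; rewrite expr0 -mpolyC1 glineC ?coefC ?mevalC ?size_polyC ?leq_b1.
rewrite exprS -add1n; apply: homog_lineM IH.
split; rewrite glineX.
  apply: leq_trans (size_polyD _ _) _; rewrite geq_max.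
  rewrite (leq_trans (size_polyC_leq1 _)) //.
  by rewrite (leq_trans (size_scale_leq _ _)) // size_polyX.
by rewrite coefD coefC coefZ coefX /= add0r mulr1 mevalXU.
Qed.

End GenericLine.

(** * Forms without repeated roots on the generic line *)

Section Radical.
Variables (K : numClosedFieldType) (n : nat).
Implicit Types (F G f N : {mpoly K[n]}) (a b p v : 'rV[K]_n).

(** Over a domain [coprimep] means coprimality over the fraction field, here that of the polynomials
    in the base point. *)
Definition generically_separable f v :=
  coprimep (gline f v) (gline f v)^`().

Lemma gline_monic d f v :
  f \is d.-homog -> f.@[v 0] = 1 -> gline f v \is monic /\ size (gline f v) = d.+1.
Proof.
move=> hf fv; have [szf] := homog_line_dhomog v hf; rewrite fv mpolyC1 => fd.
have sz : size (gline f v) = d.+1.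
  apply/eqP; rewrite eqn_leq szf ltnNge; apply/negP => szd.
  by move/eqP: fd; rewrite nth_default // eq_sym oner_eq0.
by rewrite monicE lead_coefE sz /= fd.
Qed.

(** Clearing denominators leaves a constant c instead of 1; coprimality survives specialisation
    wherever c does not vanish. *)
Lemma Bezout_const (A : idomainType) (p q : {poly A}) :
  coprimep p q -> exists u w c, c != 0 /\ u * p + w * q = c%:P.
Proof.
case/Bezout_coprimepP=> [[u w]] /= /eqp_size; rewrite size_poly1 => /eqP.
by case/size_poly1P => c c_neq0 E; exists u, w, c.
Qed.

(** Divide F by the monic f on the generic line, with remainder r of degree below d. Where the
    Bezout constant c is nonzero, f has d distinct roots on the line; they are roots of F, hence of
    r, so r vanishes there. Thus c r = 0 identically, and the quotient at t = 0 is the cofactor. *)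
Lemma generically_separable_dvd d f v F :
  f \is d.-homog -> f.@[v 0] = 1 -> generically_separable f v ->
  (forall p, f.@[p 0] = 0 -> F.@[p 0] = 0) -> exists H, F = H * f.
Proof.
move=> hf fv sepf F0; have [f_monic szf] := gline_monic hf fv.
have [u [w [c [c_neq0 uwc]]]] := Bezout_const sepf.
have := Pdiv.RingMonic.rdivp_eq f_monic (gline F v).
set q := Pdiv.CommonRing.rdivp _ _; set r := Pdiv.CommonRing.rmodp _ _ => Fqr.
have szr : (size r <= d)%N.
  by rewrite -ltnS -szf Pdiv.CommonRing.ltn_rmodp monic_neq0.
suff r0 : r = 0.
  by exists q.[0]; rewrite -[LHS](gline_horner0 F v) Fqr r0 addr0 hornerM gline_horner0.
suff cr0 i : c * r`_i = 0.
  apply/polyP=> i; rewrite coef0; apply/eqP.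
  by have /eqP := cr0 i; rewrite mulf_eq0 (negPf c_neq0).
apply: mpoly_ext0 => a; rewrite mevalM; have [->|ca_neq0] := eqVneq (c.@[a 0]) 0.
  by rewrite mul0r.
pose sp := map_poly (meval (a 0)) : {poly {mpoly K[n]}} -> {poly K}.
have [rs fE] := closed_field_poly_normal (line f a v).
have lead1 : lead_coef (line f a v) = 1.
  by rewrite -gline_spec; apply/monicP/monic_map.
have szl : size (line f a v) = d.+1.
  by rewrite -gline_spec size_map_poly_id0 // (monicP f_monic) rmorph1 oner_neq0.
rewrite lead1 scale1r in fE.
have sz_rs : size rs = d by move: szl; rewrite fE size_prod_XsubC => -[].
have uniq_rs : uniq rs.
  rewrite -separable_prod_XsubC -fE separable_poly.unlock.
  apply/Bezout_coprimepP; exists (sp u, sp w) => /=.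
  rewrite -gline_spec deriv_map -!rmorphM -rmorphD /= uwc map_polyC /=.
  by rewrite polyC_eqp1.
suff -> : (r`_i).@[a 0] = 0 by rewrite mulr0.
have -> : (r`_i).@[a 0] = (sp r)`_i by rewrite coef_map.
suff -> : sp r = 0 by rewrite coef0.
apply/eqP/negPn/negP => r_neq0.
have := max_poly_roots r_neq0 _ uniq_rs; rewrite sz_rs.
rewrite ltnNge (leq_trans (size_poly _ _) szr) => noroot.
suff : false by []; apply: noroot; apply/allP => z z_rs.
have fz : (line f a v).[z] = 0.
  by rewrite fE; apply/eqP; rewrite -/(root _ _) root_prod_XsubC.
have Fz : (line F a v).[z] = 0 by rewrite horner_line F0 // -horner_line.
rewrite /root; move: Fz; rewrite -gline_spec Fqr rmorphD rmorphM /= gline_spec.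
by rewrite hornerD hornerM fz mulr0 add0r => ->.
Qed.


Lemma dgradM F G p v :
  dgrad (F * G) p v = dgrad F p v * G.@[p 0] + F.@[p 0] * dgrad G p v.
Proof.
by rewrite -!deriv_line lineM derivM hornerD !hornerM !horner_line scale0r addr0.
Qed.

Lemma horner_const_meval (q : {poly {mpoly K[n]}}) w a :
  q.[w%:MP].@[a 0] = (map_poly (meval (a 0)) q).[w].
Proof. by rewrite -[X in _ = _.[X]](mevalC (a 0) w) horner_map. Qed.

(* A zero of a repeated factor of f on a generic line a + K v is a critical point
   of f, so N, being constant along v, would vanish at the generic point a. *)
Lemma generically_separable_crit d f v N :
  f \is d.-homog -> f.@[v 0] = 1 -> N != 0 ->
  (forall a t, N.@[(a + t *: v) 0] = N.@[a 0]) ->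
  (forall p, (forall b, dgrad f p b = 0) -> N.@[p 0] = 0) ->
  generically_separable f v.
Proof.
move=> hf fv N_neq0 Nv Ncrit; apply/negPn/negP => nsep.
have [f_monic szf] := gline_monic hf fv; set fl := gline f v in nsep f_monic szf.
pose G := gcdp fl fl^`().
have G_neq0 : G != 0 by rewrite gcdp_eq0 negb_and (monic_neq0 f_monic).
have szG : (1 < size G)%N.
  move: G_neq0 nsep; rewrite -size_poly_eq0 /generically_separable /coprimep -/fl -/G.
  by case: (size G) => [|[|k]].
(* Squarefree part of the common factor: its roots are simple for a generic base point. *)
pose H := G %/ gcdp G G^`().
have sepH : separable_poly H by apply: make_separable.
have dG_neq0 : G^`() != 0.
  apply/eqP => /(congr1 (fun p : {poly _} => p`_(size G).-2))/eqP.
  rewrite coef_deriv coef0; have -> : (size G).-2.+1 = (size G).-1.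
    by case: (size G) szG => [|[|k]].
  rewrite -lead_coefE -(@scaler_nat K) scaler_eq0 lead_coef_eq0 (negPf G_neq0) orbF.
  by rewrite pnatr_eq0; case: (size G) szG => [|[|k]].
have szH : (1 < size H)%N.
  have gcd_neq0 : gcdp G G^`() != 0 by rewrite gcdp_eq0 negb_and G_neq0.
  rewrite size_divp //.
  have := leq_ltn_trans (leq_gcdpr G dG_neq0) (lt_size_deriv G_neq0).
  by move: szG; move: (size G) (size _) => x y; lia.
have HG : H %| G by apply/divp_dvd/dvdp_gcdl.
have := dvdp_trans HG (dvdp_gcdl fl fl^`()).
case/Pdiv.WeakIdomain.dvdpP=> [[c1 q1]] /= c1_neq0 E1.
have := dvdp_trans HG (dvdp_gcdr fl fl^`()).
case/Pdiv.WeakIdomain.dvdpP=> [[c2 q2]] /= c2_neq0 E2.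
move: sepH; rewrite separable_poly.unlock => /Bezout_const[u1 [u2 [c [c_neq0 uc]]]].
have lcH : lead_coef H != 0 
  by apply: contraTneq (szH) => /eqP; rewrite lead_coef_eq0 => /eqP->; rewrite size_poly0.
(* At this base point the two division constants, the Bezout constant of H and its leading
   coefficient survive, and N is nonzero. *)
have /mpoly_neq0_ex[a] : c1 * c2 * c * lead_coef H * N != 0 by rewrite !mulf_neq0.
rewrite !mevalM !mulf_eq0 !negb_or -!andbA => /and5P[c1a c2a ca lHa Na].
pose sp := map_poly (meval (a 0)) : {poly {mpoly K[n]}} -> {poly K}.
have [w Hw] : exists w, (sp H).[w] = 0.
  have /closed_rootP[w /rootP Hw] : size (sp H) != 1%N.
    by rewrite size_map_poly_id0 // neq_ltn szH orbT.
  by exists w.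
have dHw : (sp H)^`().[w] != 0.
  apply: contra_neqN ca; rewrite deriv_map -/(sp H^`()) => /eqP Hw'.
  have <- : (sp (u1 * H + u2 * H^`())).[w] = c.@[a 0].
    by rewrite uc /sp map_polyC hornerC.
  rewrite [sp _]rmorphD /= !rmorphM /= -/(sp H) -/(sp H^`()).
  by rewrite hornerD !hornerM Hw Hw' !mulr0 addr0.
have spfl : sp fl = line f a v by exact: gline_spec.
have E1a : c1.@[a 0] *: sp fl = sp q1 * sp H.
  by rewrite -rmorphM /= -E1 /sp -mul_polyC rmorphM /= map_polyC mul_polyC.
have E2a : c2.@[a 0] *: sp fl^`() = sp q2 * sp H.
  by rewrite -rmorphM /= -E2 /sp -mul_polyC rmorphM /= map_polyC mul_polyC.
have fx : f.@[(a + w *: v) 0] = 0.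
  have /eqP := congr1 (fun g => g.[w]) E1a.
  by rewrite hornerZ hornerM Hw mulr0 mulf_eq0 (negPf c1a) spfl horner_line => /eqP.
have dfx : (sp fl^`()).[w] = 0.
  have /eqP := congr1 (fun g => g.[w]) E2a.
  by rewrite hornerZ hornerM Hw mulr0 mulf_eq0 (negPf c2a) => /eqP.
(* Differentiating c1 f = q1 H in t at w gives 0 = q1 H', and H' is nonzero there. *)
have q1w : (sp q1).[w] = 0.
  have /eqP := congr1 (fun g => g^`().[w]) E1a.
  rewrite derivZ derivM hornerZ hornerD !hornerM Hw mulr0 add0r deriv_map dfx mulr0.
  by rewrite eq_sym mulf_eq0 (negPf dHw) orbF => /eqP.
suff /Ncrit : forall b, dgrad f (a + w *: v) b = 0 by rewrite Nv => /eqP; apply/negP.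
(* Now differentiate c1 f = q1 H in the base point: f, q1 and H all vanish at w, so only c1 times
   the derivative of f remains. *)
move=> b; have := congr1 (fun g => dgrad g.[w%:MP] a b) E1.
rewrite hornerZ hornerM !dgradM !horner_const_meval -/(sp _) -/(sp _) -/(sp _).
rewrite Hw q1w spfl horner_line fx !(mulr0, mul0r, addr0, add0r) => /eqP.
rewrite mulf_eq0 (negPf c1a) /= => /eqP <-.
rewrite -deriv_line; apply/esym/dgrad_eval => t.
rewrite horner_const_meval gline_spec !horner_line.
by congr (f.@[_ 0]); rewrite addrAC.
Qed.

End Radical.

(** * The standard bilinear form and linear forms *)

Section Dot.
Variables (K : fieldType) (n : nat).
Implicit Types (u v w : 'rV[K]_n) (c : K).

Definition dot u v : K := \sum_i u 0 i * v 0 i.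

Lemma mul_trE u v : u *m v^T = (dot u v)%:M.
Proof. by apply/matrixP=> i j; rewrite !ord1 !mxE; apply: eq_bigr => k _; rewrite !mxE. Qed.

Lemma mul_tr_eq0 u v : (u *m v^T = 0) <-> (dot u v = 0).
Proof.
rewrite mul_trE; split=> [/matrixP/(_ 0 0)|->]; last exact: raddf0.
by rewrite !mxE.
Qed.

Lemma dotC u v : dot u v = dot v u.
Proof. by apply: eq_bigr => i _; rewrite mulrC. Qed.

Lemma dotDl u v w : dot (u + v) w = dot u w + dot v w.
Proof. by rewrite /dot -big_split; apply: eq_bigr => i _; rewrite mxE mulrDl. Qed.

Lemma dotZl c u v : dot (c *: u) v = c * dot u v.
Proof. by rewrite /dot mulr_sumr; apply: eq_bigr => i _; rewrite mxE mulrA. Qed.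

Lemma dotDr u v w : dot u (v + w) = dot u v + dot u w.
Proof. by rewrite dotC dotDl !(dotC u). Qed.

Lemma dotZr c u v : dot u (c *: v) = c * dot u v.
Proof. by rewrite dotC dotZl dotC. Qed.

Lemma dot0l u : dot 0 u = 0.
Proof. by rewrite -(scale0r 0) dotZl mul0r. Qed.

Lemma dot_delta i v : dot (delta_mx 0 i) v = v 0 i.
Proof.
rewrite /dot (bigD1 i) //= big1 ?addr0 => [|j ji]; first by rewrite mxE !eqxx mul1r.
by rewrite mxE (negPf ji) andbF mul0r.
Qed.

Lemma row_neq0P v : reflect (exists i, v 0 i != 0) (v != 0).
Proof.
apply: (iffP idP) => [v_neq0|]; last by case=> i; apply: contraNneq => ->; rewrite mxE.
apply/existsP; apply: contraNT v_neq0; rewrite negb_exists => /forallP v0.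
by apply/eqP/rowP=> i; have /= := v0 i; rewrite mxE negbK => /eqP.
Qed.

Lemma dot_eq0_proportional u v :
  u != 0 -> (forall w, dot w u = 0 -> dot w v = 0) -> exists c, v = c *: u.
Proof.
case/row_neq0P=> i ui uv; exists (v 0 i / u 0 i); apply/rowP=> j; rewrite mxE.
have := uv (u 0 i *: delta_mx 0 j + (- u 0 j) *: delta_mx 0 i).
rewrite !dotDl !dotZl !dot_delta => E; apply: (mulfI ui).
have /E/eqP : u 0 i * u 0 j + - u 0 j * u 0 i = 0 by ring.
by rewrite mulNr subr_eq0 => /eqP->; field.
Qed.

Lemma exists_orthogonal2 u v : (2 < n)%N ->
  exists w, [/\ w != 0, dot u w = 0 & dot v w = 0].
Proof.
move=> n_gt2; pose M := (col_mx u v)^T; pose k := kermx M.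
have : k != 0.
  rewrite -mxrank_eq0 mxrank_ker subn_eq0 -ltnNge.
  exact: leq_ltn_trans (rank_leq_col _) n_gt2.
case/rowV0Pn=> w /sub_kermxP wM w_neq0; exists w.
have : M^T *m w^T = 0 by rewrite -trmx_mul wM trmx0.
rewrite trmxK mul_col_mx -[0]vsubmxK => /eq_col_mx[]; rewrite !linear0.
by move=> /mul_tr_eq0 uw /mul_tr_eq0 vw.
Qed.

Definition linear_form v : {mpoly K[n]} := \sum_i v 0 i *: 'X_i.

Lemma meval_linear_form u v : (linear_form v).@[u 0] = dot u v.
Proof.
rewrite /linear_form raddf_sum; apply: eq_bigr => i _.
by rewrite /= mevalZ mevalXU mulrC.
Qed.

Lemma linear_form_homog v : linear_form v \is 1.-homog.
Proof.
by apply: rpred_sum => i _; apply: rpredZ; rewrite dhomogX /= mdeg1.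
Qed.

Lemma linear_form_neq0 v : v != 0 -> linear_form v != 0.
Proof.
case/row_neq0P=> i vi; apply: contraNneq vi => v0.
by rewrite -dot_delta -meval_linear_form v0 meval0.
Qed.

Lemma dgrad_dot (f : {mpoly K[n]}) p v : dgrad f p v = dot v (grad f p).
Proof. by apply: eq_bigr => i _; rewrite mxE. Qed.

End Dot.

(** * Radical forms, and removal of hyperplanes from a zero set *)

Section Radical.
Variables (K : numClosedFieldType) (n : nat).
Implicit Types (F G f N : {mpoly K[n]}) (a b p v l : 'rV[K]_n).

Lemma dgrad_linear_form l p v : dgrad (linear_form l) p v = dot v l.
Proof.
rewrite (dgrad_eval (g := (dot p l)%:P + dot v l *: 'X)) => [|t].
  by rewrite derivD derivC derivZ derivX !hornerE.
by rewrite meval_linear_form dotDl dotZl !hornerE mulrC.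
Qed.

(** By the Nullstellensatz, f generates a radical ideal. The condition is put in terms of values
    because a form F in a tangent space condition is known only through its zeros. *)
Definition radical_form f :=
  forall F, (forall p, f.@[p 0] = 0 -> F.@[p 0] = 0) -> exists H, F = H * f.

(** A line of direction v through a point with N <> 0 stays off N = 0, so it meets no critical point
    of f. *)
Lemma radical_crit d f v N :
  f \is d.-homog -> f.@[v 0] != 0 -> N != 0 ->
  (forall a t, N.@[(a + t *: v) 0] = N.@[a 0]) ->
  (forall p, grad f p = 0 -> N.@[p 0] = 0) ->
  radical_form f.
Proof.
move=> hf fv N_neq0 Nv Ncrit F F0; pose c := (f.@[v 0])^-1.
have c_neq0 : c != 0 by rewrite invr_eq0.
have hcf : c *: f \is d.-homog by apply: rpredZ.
have cfv : (c *: f).@[v 0] = 1 by rewrite mevalZ mulVf.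
have sep : generically_separable (c *: f) v.
  apply: (generically_separable_crit hcf cfv N_neq0 Nv) => p crit.
  apply: Ncrit; apply/rowP=> i; rewrite [RHS]mxE; apply: (mulfI c_neq0).
  rewrite mulr0 -(crit (delta_mx 0 i)) dgrad_dot dot_delta !mxE.
  by rewrite mderivZ mevalZ.
have [|H ->] := generically_separable_dvd (F := F) hcf cfv sep.
  move=> p /eqP; rewrite mevalZ mulf_eq0 (negPf c_neq0) => /eqP; exact: F0.
by exists (c *: H); rewrite -scalerAr scalerAl.
Qed.

(** For each c there is a hyperplane through both c and v, as the dimension exceeds 2; N is the
    product of their equations. *)
Lemma form_vanishing_on_lines (cs : seq 'rV[K]_n) v : (2 < n)%N ->
  exists N : {mpoly K[n]}, [/\ N != 0,
    forall a t, N.@[(a + t *: v) 0] = N.@[a 0] &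
    forall c k, c \in cs -> N.@[(k *: c) 0] = 0].
Proof.
move=> n_gt2; elim: cs => [|c cs [N [N_neq0 Nv Ncs]]].
  by exists 1; split=> [|a t|//]; rewrite ?oner_neq0 // !meval1.
have [w [w_neq0 vw cw]] := exists_orthogonal2 v c n_gt2.
exists (linear_form w * N); split=> [|a t|c' k].
- by rewrite mulf_neq0 ?linear_form_neq0.
- by rewrite !mevalM Nv !meval_linear_form dotDl dotZl vw mulr0 addr0.
rewrite inE mevalM meval_linear_form dotZl => /orP[/eqP->|c'_cs].
  by rewrite cw mulr0 mul0r.
by rewrite Ncs // mulr0.
Qed.

Section FiniteCritical.
Variables (d : nat) (f : {mpoly K[n]}) (cs : seq 'rV[K]_n).
Hypotheses (n_gt2 : (2 < n)%N) (hf : f \is d.-homog).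
Hypothesis crit : forall p, grad f p = 0 -> exists2 c, c \in cs & exists k, p = k *: c.

(** Every point is critical for the zero form, and finitely many lines do not fill the space. *)
Lemma finite_crit_neq0 : f != 0.
Proof.
have [N [N_neq0 _ Ncs]] := form_vanishing_on_lines cs 0 n_gt2.
have [p Np] := mpoly_neq0_ex N_neq0; apply: contra_neq Np => f0.
have [|c c_cs [k ->]] := crit (p := p); last exact: Ncs.
by apply/rowP=> i; rewrite !mxE f0 mderiv0 meval0.
Qed.

Lemma radical_finite_crit : radical_form f.
Proof.
have [v fv] := mpoly_neq0_ex finite_crit_neq0.
have [N [N_neq0 Nv Ncs]] := form_vanishing_on_lines cs v n_gt2.
by apply: (radical_crit hf fv N_neq0 Nv) => p /crit[c c_cs [k ->]]; apply: Ncs.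
Qed.

End FiniteCritical.

(** Replaces irreducibility. F l vanishes on f = 0, so F l = H f. On the hyperplane l = 0 the
    product H f is zero but f is not identically zero, so H is zero there. Differentiating F l = H f
    at a point where l = f = 0 then leaves F(p) l_i = 0. *)
Lemma vanishing_off_hyperplane f F l :
  radical_form f -> l != 0 ->
  (exists2 p, dot p l = 0 & f.@[p 0] != 0) ->
  (forall p, f.@[p 0] = 0 -> dot p l != 0 -> F.@[p 0] = 0) ->
  forall p, f.@[p 0] = 0 -> F.@[p 0] = 0.
Proof.
move=> rad_f /row_neq0P[i li] [x xl fx] F0 p fp.
have [pl|pl] := eqVneq (dot p l) 0; last exact: F0.
have [H FH] : exists H, F * linear_form l = H * f.
  apply: rad_f => q fq; rewrite mevalM meval_linear_form.
  by have [->|/F0->//] := eqVneq (dot q l) 0; rewrite ?mulr0 ?mul0r.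
have Hp : H.@[p 0] = 0.
  have prod0 : line H x (p - x) * line f x (p - x) = 0.
    rewrite -lineM -FH lineM; apply/eqP; rewrite mulf_eq0; apply/orP; right.
    apply/eqP; apply: poly_ext => t.
    rewrite horner_line meval_linear_form horner0 dotDl dotZl -scaleN1r dotDl dotZl.
    by rewrite xl pl !(mulr0, addr0).
  move/eqP: prod0; rewrite mulf_eq0 => /orP[]/eqP/(congr1 (fun q => q.[_])) E.
    by have := E 1; rewrite horner_line horner0 scale1r addrC subrK.
  have := E 0; rewrite horner_line horner0 scale0r addr0 => fx0.
  by rewrite fx0 eqxx in fx.
have := congr1 (fun G => dgrad G p (delta_mx 0 i)) FH.
rewrite /= !dgradM Hp fp meval_linear_form pl !mulr0 mul0r addr0 add0r => /eqP.
by rewrite dgrad_linear_form dot_delta mulf_eq0 (negPf li) orbF => /eqP.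
Qed.

Lemma vanishing_off_hyperplanes f F (ls : seq 'rV[K]_n) :
  radical_form f ->
  (forall l, l \in ls -> l != 0 /\ exists2 p, dot p l = 0 & f.@[p 0] != 0) ->
  (forall p, f.@[p 0] = 0 -> (forall l, l \in ls -> dot p l != 0) -> F.@[p 0] = 0) ->
  forall p, f.@[p 0] = 0 -> F.@[p 0] = 0.
Proof.
move=> rad_f; elim: ls F => [|l ls IH] F ls_ok F0; first by move=> p fp; apply: F0.
have [l_neq0 lx] := ls_ok l (mem_head _ _).
apply: (vanishing_off_hyperplane rad_f l_neq0 lx) => p fp pl.
have : (F * linear_form l).@[p 0] = 0.
  apply: IH fp => [m m_ls|q fq qls]; first by apply: ls_ok; rewrite inE m_ls orbT.
  rewrite mevalM meval_linear_form; have [->|ql] := eqVneq (dot q l) 0.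
    by rewrite mulr0.
  rewrite F0 ?mul0r // => m; rewrite inE => /orP[/eqP->//|]; exact: qls.
by move=> /eqP; rewrite mevalM meval_linear_form mulf_eq0 (negPf pl) orbF => /eqP.
Qed.

End Radical.

(** * Tangent spaces, singular points and closures from a radical equation *)

Section Hypersurface.
Variables (K : numClosedFieldType) (n d : nat) (f : {mpoly K[n]}).
Variable X : 'rV[K]_n -> Prop.
Implicit Types p q v h : 'rV[K]_n.
Hypotheses (d_gt0 : (0 < d)%N) (hf : f \is d.-homog) (rad_f : radical_form f).
Hypothesis XE : forall p, p != 0 -> (X p <-> f.@[p 0] = 0).
Hypothesis X_point : exists2 z, z != 0 & X z.

(** [vanishes_on] ignores the zero vector; the point of X rules out nonzero constants F, the only
    forms that could fail there. *)
Lemma vanishes_on_zero e (F : {mpoly K[n]}) :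
  F \is e.-homog -> vanishes_on F X -> forall p, f.@[p 0] = 0 -> F.@[p 0] = 0.
Proof.
move=> hF F0 p fp; have [->|p_neq0] := eqVneq p 0; last by apply: F0 => //; apply/XE.
have [z z_neq0 Xz] := X_point.
have -> : (0 : 'rV[K]_n) = 0 *: z by rewrite scale0r.
by rewrite (meval_homog _ _ hF) F0 // mulr0.
Qed.

(** A form vanishing on X is H f, and its differential at p is H(p) times that of f. *)
Lemma tangent_spaceE p v : p != 0 -> X p -> tangent_space X p v <-> dot v (grad f p) = 0.
Proof.
move=> p_neq0 Xp; have fp : f.@[p 0] = 0 by apply/XE.
split=> [tv|tv e F hF F0].
  by apply/mul_tr_eq0; apply: (tv d) => // q q_neq0 /XE; apply.
have [H ->] := rad_f (vanishes_on_zero hF F0).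
by apply/mul_tr_eq0; rewrite -dgrad_dot dgradM fp !dgrad_dot tv !mulr0 addr0.
Qed.

Lemma tangent_hyperplaneE p h :
  tangent_hyperplane X p h <->
  [/\ p != 0, X p, h != 0 & exists2 c, c != 0 & h = c *: grad f p].
Proof.
split=> [[p_neq0 Xp h_neq0 tE]|[p_neq0 Xp h_neq0 [c c_neq0 hE]]]; split=> //.
  have hv v : dot v h = 0 <-> dot v (grad f p) = 0.
    by rewrite -tangent_spaceE // -mul_tr_eq0; split=> /tE.
  have [c gE] := dot_eq0_proportional h_neq0 (fun v => (hv v).1).
  have [c0|c_neq0] := eqVneq c 0; last first.
    by exists c^-1; rewrite ?invr_eq0 // gE scalerA mulVf // scale1r.
  have [i hi] := row_neq0P _ h_neq0; case/eqP: hi.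
  rewrite -dot_delta; apply/hv.
  by rewrite gE c0 scale0r dotC dot0l.
move=> v; rewrite tangent_spaceE // mul_tr_eq0 hE dotZr.
by split=> [->|/eqP]; rewrite ?mulr0 // mulf_eq0 (negPf c_neq0) => /eqP.
Qed.

(** Euler's relation places every critical point on X. *)
Lemma singular_pointE p : singular_point X p <-> p != 0 /\ grad f p = 0.
Proof.
split=> [[p_neq0 Xp nsm]|[p_neq0 gp]].
  split=> //; apply/eqP/negPn/negP => gp; apply: nsm; exists (grad f p).
  by apply/tangent_hyperplaneE; split=> //; exists 1; rewrite ?oner_neq0 ?scale1r.
have Xp : X p.
  apply/XE => //; have := euler p hf; rewrite dgrad_dot gp dotC dot0l => /esym/eqP.
  by rewrite mulf_eq0 pnatr_eq0 eqn0Ngt d_gt0 => /eqP.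
split=> // -[h /tangent_hyperplaneE[_ _ /negP h_neq0 [c _ hE]]].
by apply: h_neq0; rewrite hE gp scaler0.
Qed.

End Hypersurface.

Lemma zariski_closureE (K : numClosedFieldType) n d (g : {mpoly K[n]}) ls
    (A : 'rV[K]_n -> Prop) :
  g \is d.-homog -> radical_form g -> ls != [::] ->
  (forall l, l \in ls -> l != 0 /\ exists2 p : 'rV[K]_n, dot p l = 0 & g.@[p 0] != 0) ->
  (forall h : 'rV[K]_n, A h -> g.@[h 0] = 0) ->
  (forall h : 'rV[K]_n, h != 0 -> g.@[h 0] = 0 -> (forall l, l \in ls -> dot h l != 0) -> A h) ->
  forall x : 'rV[K]_n, zariski_closure A x <-> g.@[x 0] = 0.
Proof.
move=> hg rad_g ls_neq0 ls_ok gA Ag x.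
split=> [clx|gx e F hF F0]; first by apply: (clx d) => // p _; exact: gA.
apply: (vanishing_off_hyperplanes rad_g ls_ok _ gx) => p gp pls.
(* Lying off a single hyperplane already excludes the zero vector, which is why [ls] must be
   nonempty. *)
have p_neq0 : p != 0.
  case: ls ls_neq0 {ls_ok Ag} pls => // l ls _ /(_ l (mem_head _ _)).
  by apply: contraNneq => ->; rewrite dot0l.
by apply: F0 => //; apply: Ag.
Qed.

(** * The Segre cubic and the Igusa quartic *)

Section Identities.
Variable K : numClosedFieldType.
Implicit Types (x y : 'rV[K]_6).

Lemma sum6 (F : 'I_6 -> K) : \sum_j F j =
  F (inord 0) + F (inord 1) + F (inord 2) + F (inord 3) + F (inord 4) + F (inord 5).
Proof.
rewrite !big_ord_recl big_ord0 addr0 !addrA.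
by do !congr (_ + _); congr F; apply: val_inj; rewrite /= inordK.
Qed.


(** Fully expanded, so that [ring] proves Newton's identities and the factorisation of the sextic
    directly. *)
Definition elem_sym x (k : nat) : K :=
  let a := x 0 (inord 0) in let b := x 0 (inord 1) in let c := x 0 (inord 2) in
  let d := x 0 (inord 3) in let e := x 0 (inord 4) in let f := x 0 (inord 5) in
  let s2 := b * c + b * d + b * e + b * f + c * d + c * e + c * f + d * e + d * f + e * f in
  let s3 := b * c * d + b * c * e + b * c * f + b * d * e + b * d * f + b * e * f
            + c * d * e + c * d * f + c * e * f + d * e * f in
  let s4 := b * c * d * e + b * c * d * f + b * c * e * f + b * d * e * f + c * d * e * f in
  match k with
  | 1 => a + b + c + d + e + f
  | 2 => a * (b + c + d + e + f) + s2
  | 3 => a * s2 + s3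
  | 4 => a * s3 + s4
  | 5 => a * s4 + b * c * d * e * f
  | _ => a * b * c * d * e * f
  end.

Arguments elem_sym : simpl never.

Lemma prod_sub_coords x (t : K) :
  \prod_j (t - x 0 j) = t ^+ 6 - elem_sym x 1 * t ^+ 5 + elem_sym x 2 * t ^+ 4
     - elem_sym x 3 * t ^+ 3 + elem_sym x 4 * t ^+ 2 - elem_sym x 5 * t + elem_sym x 6.
Proof.
have -> : \prod_j (t - x 0 j) = (t - x 0 (inord 0)) * (t - x 0 (inord 1)) *
   (t - x 0 (inord 2)) * (t - x 0 (inord 3)) * (t - x 0 (inord 4)) * (t - x 0 (inord 5)).
  rewrite !big_ord_recl big_ord0 mulr1 !mulrA.
  by do !congr (_ * _); congr (_ - _); congr (x 0 _); apply: val_inj; rewrite /= inordK.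
rewrite /elem_sym; ring.
Qed.

Lemma sextic x j :
  x 0 j ^+ 6 - elem_sym x 1 * x 0 j ^+ 5 + elem_sym x 2 * x 0 j ^+ 4
     - elem_sym x 3 * x 0 j ^+ 3 + elem_sym x 4 * x 0 j ^+ 2 - elem_sym x 5 * x 0 j
     + elem_sym x 6 = 0.
Proof. by rewrite -prod_sub_coords (bigD1 j) //= subrr mul0r. Qed.

Local Notation p := power_sum.

Lemma newton x : 
  [/\ p 1 x = elem_sym x 1,
      p 2 x = elem_sym x 1 ^+ 2 - 2%:R * elem_sym x 2,
      p 3 x = elem_sym x 1 ^+ 3 - 3%:R * elem_sym x 1 * elem_sym x 2 + 3%:R * elem_sym x 3,
      p 4 x = elem_sym x 1 * p 3 x - elem_sym x 2 * p 2 x + elem_sym x 3 * p 1 x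
              - 4%:R * elem_sym x 4 &
      p 5 x = elem_sym x 1 * p 4 x - elem_sym x 2 * p 3 x + elem_sym x 3 * p 2 x
              - elem_sym x 4 * p 1 x
              + 5%:R * elem_sym x 5].
Proof. by rewrite /power_sum !sum6 /elem_sym; split; ring. Qed.

(* The gradients of s_3 and of s_2^2 - 4 s_4, up to the factors 3 and 4, projected
   orthogonally to the hyperplane s_1 = 0. *)
Definition segre_dual x : 'rV[K]_6 := \row_j (x 0 j ^+ 2 - p 2 x / 6%:R).
Definition igusa_dual x : 'rV[K]_6 :=
  \row_j (p 2 x * x 0 j - 4%:R * x 0 j ^+ 3 + 2%:R / 3%:R * p 3 x).
Definition igusa x : K := p 2 x ^+ 2 - 4%:R * p 4 x.

Lemma power_sum_segre_dual1 x : p 1 (segre_dual x) = 0.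
Proof. rewrite /power_sum !sum6 !mxE /power_sum !sum6; by field. Qed.

Lemma power_sum_igusa_dual1 x : p 1 x = 0 -> p 1 (igusa_dual x) = 0.
Proof.
move=> x1; transitivity (p 2 x * p 1 x); last by rewrite x1 mulr0.
rewrite /power_sum !sum6 !mxE /power_sum !sum6; by field.
Qed.

(** Euler's relation for the quartic E, of whose gradient [igusa_dual] is a quarter. *)
Lemma dot_igusa_dual x : p 1 x = 0 -> dot (igusa_dual x) x = igusa x.
Proof.
move=> x1; rewrite /dot /igusa.
transitivity (p 2 x * p 2 x - 4%:R * p 4 x + 2%:R / 3%:R * p 3 x * p 1 x).
  rewrite /power_sum !sum6 !mxE /power_sum !sum6; ring.
by rewrite x1; ring.
Qed.


(** * From the cubic to the quartic and back *)

Section SegrePoint.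
Variable x : 'rV[K]_6.
Hypotheses (x1 : p 1 x = 0) (x3 : p 3 x = 0).

Let e1 : elem_sym x 1 = 0. Proof. by have [<- _ _ _ _] := newton x. Qed.
Let e3 : elem_sym x 3 = 0.
Proof.
have [_ _ E _ _] := newton x; move: E; rewrite x3 e1 !(mulr0, mul0r) expr0n subr0 add0r.
by move/esym/eqP; rewrite mulf_eq0 pnatr_eq0 => /eqP.
Qed.
Let p2 : p 2 x = - (2%:R * elem_sym x 2).
Proof. by have [_ -> _ _ _] := newton x; rewrite e1; ring. Qed.
Let p4 : p 4 x = 2%:R * elem_sym x 2 ^+ 2 - 4%:R * elem_sym x 4.
Proof. by have [_ _ _ -> _] := newton x; rewrite e1 e3 p2; ring. Qed.
Let p5 : p 5 x = 5%:R * elem_sym x 5.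
Proof. by have [_ _ _ _ ->] := newton x; rewrite e1 e3 x3 x1; ring. Qed.

Let sextic0 j : x 0 j ^+ 6 =
  - (elem_sym x 2 * x 0 j ^+ 4 + elem_sym x 4 * x 0 j ^+ 2 - elem_sym x 5 * x 0 j + elem_sym x 6).
Proof.
by apply/eqP; rewrite -addr_eq0 -(sextic x j) e1 e3; apply/eqP; ring.
Qed.

(** With e_1 = e_3 = e_5 = 0 the sextic is even, so - x_i is a root whenever x_i is; taking x_i
    nonzero makes the two indices different. *)
Lemma opp_coord_segre : p 5 x = 0 -> exists i j, i != j /\ x 0 i + x 0 j = 0.
Proof.
move=> /eqP; rewrite p5 mulf_eq0 pnatr_eq0 /= => /eqP e5.
have [->|/row_neq0P[i xi]] := eqVneq x 0.
  by exists ord0, ord_max; rewrite !mxE addr0.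
have : \prod_j (- x 0 i - x 0 j) = 0.
  rewrite prod_sub_coords -(sextic x i) e1 e3 e5; ring.
move/eqP/prodf_eq0 => [j _ xij]; exists i, j; split; last first.
  by apply/eqP; rewrite -oppr_eq0 opprD.
by apply: contraTneq xij => <-; rewrite -opprD oppr_eq0 -mulr2n mulrn_eq0.
Qed.

(** Here y_j = x_j^2 + e_2 / 3, so y_j^3 contains x_j^6, which the sextic lowers. The terms in x_j^4
    and x_j^2 cancel, leaving - 4 e_5 x_j + k; the coordinates have sum zero, so k = 0, and e_5 =
    s_5 / 5. *)
Lemma igusa_dual_segre_dual : igusa_dual (segre_dual x) = (- (4%:R / 5%:R) * p 5 x) *: x.
Proof.
pose y := segre_dual x.
have yE j : y 0 j = x 0 j ^+ 2 + elem_sym x 2 / 3%:R.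
  by rewrite mxE p2; field.
have y1 : p 1 y = 0 by exact: power_sum_segre_dual1.
have y2 : p 2 y = 4%:R / 3%:R * elem_sym x 2 ^+ 2 - 4%:R * elem_sym x 4.
  transitivity (p 4 x + 2%:R * elem_sym x 2 / 3%:R * p 2 x + 6%:R * (elem_sym x 2 / 3%:R) ^+ 2).
    rewrite /power_sum !sum6 !yE; by field.
  by rewrite p4 p2; field.
pose k := 2%:R / 3%:R * p 3 y + 4%:R * elem_sym x 6
   + p 2 y * (elem_sym x 2 / 3%:R) - 4%:R * (elem_sym x 2 / 3%:R) ^+ 3.
have cE j : igusa_dual y 0 j = - 4%:R * elem_sym x 5 * x 0 j + k.
  have : x 0 j ^+ 6 = x 0 j ^+ 6 by []; rewrite {1}sextic0 => E.
  rewrite [LHS]mxE /k y2 yE.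
  transitivity (- 4%:R * x 0 j ^+ 6 - 4%:R * (elem_sym x 2 * x 0 j ^+ 4
      + elem_sym x 4 * x 0 j ^+ 2) + 2%:R / 3%:R * p 3 y
      + (4%:R / 3%:R * elem_sym x 2 ^+ 2 - 4%:R * elem_sym x 4) * (elem_sym x 2 / 3%:R)
      - 4%:R * (elem_sym x 2 / 3%:R) ^+ 3).
    by field.
  rewrite sextic0; by field.
have k0 : k = 0.
  have := power_sum_igusa_dual1 y1; rewrite {1}/power_sum sum6 !cE => E.
  have : 6%:R * k = 0.
    rewrite -E; transitivity (6%:R * k - 4%:R * elem_sym x 5 * p 1 x).
      by rewrite x1 mulr0 subr0.
    by rewrite /power_sum sum6; ring.
  by move/eqP; rewrite mulf_eq0 pnatr_eq0 => /eqP.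
apply/rowP=> j; rewrite -/y cE k0 [RHS]mxE p5; by field.
Qed.

(** By Euler, E at the dual point is proportional to its product with x, which is s_3(x) when s_1(x)
    = 0. *)
Lemma igusa_segre_dual : igusa (segre_dual x) = 0.
Proof.
rewrite -dot_igusa_dual ?power_sum_segre_dual1 // igusa_dual_segre_dual dotZl.
suff -> : dot x (segre_dual x) = 0 by rewrite mulr0.
transitivity (p 3 x - p 2 x / 6%:R * p 1 x); last by rewrite x1 x3; ring.
by rewrite /dot sum6 !mxE /power_sum !sum6; field.
Qed.

End SegrePoint.

(** * From the quartic to the cubic and back *)

Section IgusaPoint.
Variable y : 'rV[K]_6.
Hypotheses (y1 : p 1 y = 0) (yE : igusa y = 0).

Let e1 : elem_sym y 1 = 0. Proof. by have [<- _ _ _ _] := newton y. Qed.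
Let p2 : p 2 y = - (2%:R * elem_sym y 2).
Proof. by have [_ -> _ _ _] := newton y; rewrite e1; ring. Qed.
Let p3 : p 3 y = 3%:R * elem_sym y 3.
Proof. by have [_ _ -> _ _] := newton y; rewrite e1; ring. Qed.
Let e4 : elem_sym y 4 = elem_sym y 2 ^+ 2 / 4%:R.
Proof.
have [_ _ _ E _] := newton y; move: yE; rewrite /igusa E e1 y1 p2 => E'.
suff : 16%:R * (elem_sym y 4 - elem_sym y 2 ^+ 2 / 4%:R) = 0.
  by move/eqP; rewrite mulf_eq0 pnatr_eq0 subr_eq0 => /eqP.
rewrite -E'; by field.
Qed.

Let igusa_dualE j :
  igusa_dual y 0 j = - 4%:R * (y 0 j ^+ 3 + elem_sym y 2 / 2%:R * y 0 j - elem_sym y 3 / 2%:R).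
Proof. rewrite mxE p2 p3; by field. Qed.

(** E(y) = 0 says e_4 = e_2^2 / 4, exactly what completing the square requires. *)
Lemma sextic_square_cubic (t : K) : \prod_j (t - y 0 j) =
  (t ^+ 3 + elem_sym y 2 / 2%:R * t - elem_sym y 3 / 2%:R) ^+ 2
  - (elem_sym y 5 - elem_sym y 2 * elem_sym y 3 / 2%:R) * t
  + (elem_sym y 6 - elem_sym y 3 ^+ 2 / 4%:R).
Proof. rewrite prod_sub_coords e1 e4; by field. Qed.

(** The coordinates of [igusa_dual] are - 4 times the values at y_j of the cubic whose square
    appears in the sextic. Their squares are therefore affine in y_j, and centring removes the
    constant. *)
Lemma segre_dual_igusa_dual : exists r, segre_dual (igusa_dual y) = r *: y.
Proof.
pose r := 16%:R * (elem_sym y 5 - elem_sym y 2 * elem_sym y 3 / 2%:R).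
pose k := - 16%:R * (elem_sym y 6 - elem_sym y 3 ^+ 2 / 4%:R).
have c2 j : igusa_dual y 0 j ^+ 2 = r * y 0 j + k.
  have := sextic y j; rewrite -prod_sub_coords sextic_square_cubic igusa_dualE => E.
  apply/eqP; rewrite -subr_eq0 -(mulr0 16%:R) -E /r /k; apply/eqP.
  by field.
have kE : p 2 (igusa_dual y) / 6%:R = k.
  transitivity (k + r / 6%:R * p 1 y); last by rewrite y1 mulr0 addr0.
  rewrite {1}/power_sum sum6 !c2 /power_sum sum6; by field.
by exists r; apply/rowP=> j; rewrite mxE kE c2 mxE addrK.
Qed.

(** With c_j^2 = r y_j + k, the sum of the c_j^3 is r times the product of c with y, zero by Euler,
    plus k s_1(c) = 0. *)
Lemma power_sum_igusa_dual3 : p 3 (igusa_dual y) = 0.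
Proof.
have [r E] := segre_dual_igusa_dual.
have E' j : igusa_dual y 0 j ^+ 2 = r * y 0 j + p 2 (igusa_dual y) / 6%:R.
  by have := congr1 (fun u : 'rV_6 => u 0 j) E; rewrite !mxE => <-; rewrite subrK.
transitivity (r * dot (igusa_dual y) y
    + p 2 (igusa_dual y) / 6%:R * p 1 (igusa_dual y)); last first.
  by rewrite dot_igusa_dual // yE power_sum_igusa_dual1 // !mulr0 addr0.
rewrite {1}/power_sum /dot {2}/power_sum !mulr_sumr -big_split; apply: eq_bigr => j _ /=.
by rewrite exprS E'; ring.
Qed.

(** When the cubic vanishes at all y_j, the linear remainder reads b = a y_j. Summing over j gives b
    = 0, and a nonzero coordinate gives a = 0. *)
Lemma igusa_dual_eq0_prod : igusa_dual y = 0 -> y != 0 -> forall t,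
  \prod_j (t - y 0 j) = (t ^+ 3 + elem_sym y 2 / 2%:R * t - elem_sym y 3 / 2%:R) ^+ 2.
Proof.
move=> c0 y_neq0.
have c0j j : y 0 j ^+ 3 + elem_sym y 2 / 2%:R * y 0 j - elem_sym y 3 / 2%:R = 0.
  have := igusa_dualE j; rewrite c0 mxE => /esym/eqP.
  by rewrite mulf_eq0 oppr_eq0 pnatr_eq0 => /eqP.
set a := elem_sym y 5 - elem_sym y 2 * elem_sym y 3 / 2%:R.
set b := elem_sym y 6 - elem_sym y 3 ^+ 2 / 4%:R.
have ab j : b = a * y 0 j.
  have := sextic y j; rewrite -prod_sub_coords sextic_square_cubic c0j -/a -/b.
  by rewrite expr0n sub0r addrC => /eqP; rewrite subr_eq0 => /eqP.
have b0 : b = 0.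
  have : 6%:R * b = 0.
    transitivity (a * p 1 y); last by rewrite y1 mulr0.
    rewrite /power_sum mulr_sumr (eq_bigr (fun=> b)) => [|j _]; last by rewrite expr1 -ab.
    by rewrite sumr_const card_ord mulr_natl.
  by move/eqP; rewrite mulf_eq0 pnatr_eq0 => /eqP.
have [j yj] := row_neq0P _ y_neq0.
have a0 : a = 0 by have /eqP := ab j; rewrite b0 eq_sym mulf_eq0 (negPf yj) orbF => /eqP.
by move=> t; rewrite sextic_square_cubic -/a -/b a0 b0 mul0r subr0 addr0.
Qed.

End IgusaPoint.

End Identities.

(** * Synthemes and the classification of critical points *)

(* The splittings of the six indices into two triples; they index the nodes of the
   Segre cubic and the tropes of the Igusa quartic. *)
Definition splits : seq (seq bool) :=
  [seq true :: b | b <- [:: [:: true; true; false; false; false];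
    [:: true; false; true; false; false]; [:: true; false; false; true; false];
    [:: true; false; false; false; true]; [:: false; true; true; false; false];
    [:: false; true; false; true; false]; [:: false; true; false; false; true];
    [:: false; false; true; true; false]; [:: false; false; true; false; true];
    [:: false; false; false; true; true]]].

(* The list m encodes the syntheme with duads {m_k, m_(k+3)}, k < 3. *)
Definition synthemes : seq (seq nat) :=
  [:: [:: 0; 2; 4; 1; 3; 5]; [:: 0; 2; 3; 1; 4; 5]; [:: 0; 2; 3; 1; 5; 4];
      [:: 0; 1; 4; 2; 3; 5]; [:: 0; 1; 3; 2; 4; 5]; [:: 0; 1; 3; 2; 5; 4];
      [:: 0; 1; 4; 3; 2; 5]; [:: 0; 1; 2; 3; 4; 5]; [:: 0; 1; 2; 3; 5; 4];
      [:: 0; 1; 3; 4; 2; 5]; [:: 0; 1; 2; 4; 3; 5]; [:: 0; 1; 2; 4; 5; 3];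
      [:: 0; 1; 3; 5; 2; 4]; [:: 0; 1; 2; 5; 3; 4]; [:: 0; 1; 2; 5; 4; 3]]%N.

Definition duad (m : seq nat) (i j : nat) : bool :=
  has (fun k => ((nth 0 m k == i) && (nth 0 m (k + 3) == j))
             || ((nth 0 m k == j) && (nth 0 m (k + 3) == i)))%N (iota 0 3).

Lemma syntheme_perm m : m \in synthemes -> perm_eq m (iota 0 6).
Proof. by apply/allP: m. Qed.

(** A check over the 720 permutations: positions k and k + 3 form a duad, and order is forgotten. *)
Lemma perm_syntheme m : perm_eq m (iota 0 6) ->
  exists2 l, l \in synthemes &
    forall k, (k < 3)%N -> duad m (nth 0 l k)%N (nth 0 l (k + 3))%N.
Proof.
rewrite -mem_permutations => m_perm.
have : all (fun m => has (fun l =>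
    all (fun k => duad m (nth 0 l k)%N (nth 0 l (k + 3))%N) (iota 0 3)) synthemes)
  (permutations (iota 0 6)) by vm_compute.
move/allP/(_ m m_perm)/hasP => [l l_syn /allP lm]; exists l => // k k_lt.
by apply: lm; rewrite mem_iota.
Qed.

Lemma perm_of_pair i j : (i < 6)%N -> (j < 6)%N -> i != j ->
  exists a b c d, perm_eq [:: i; a; b; j; c; d] (iota 0 6).
Proof.
move=> i_lt j_lt ij.
have : all (fun i => all (fun j => (i == j) || has (fun m =>
    (nth 0 m 0 == i) && (nth 0 m 3 == j))%N (permutations (iota 0 6)))
  (iota 0 6)) (iota 0 6) by vm_compute.
move/allP/(_ i); rewrite mem_iota => /(_ i_lt)/allP/(_ j); rewrite mem_iota.
move=> /(_ j_lt); rewrite (negPf ij) => /hasP[m].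
rewrite mem_permutations => m_perm.
have := perm_size m_perm; case: m m_perm => [|m0 [|m1 [|m2 [|m3 [|m4 [|m5 [|]]]]]]] //=.
by move=> m_perm _ /andP[/eqP<- /eqP<-]; exists m1, m2, m4, m5.
Qed.

Lemma perm_lt m k : perm_eq m (iota 0 6) -> (k < 6)%N -> (nth 0%N m k < 6)%N.
Proof.
move=> m_perm k_lt; have : nth 0%N m k \in m by rewrite mem_nth ?(perm_size m_perm).
by rewrite (perm_mem m_perm) mem_iota.
Qed.

(** * Planes and nodes of the cubic, double lines of the quartic *)

Section Coordinates.
Variable K : numClosedFieldType.
Implicit Types (x y v : 'rV[K]_6) (m : seq nat).

Definition entry x (k : nat) : K := x 0 (inord k).

Lemma sum_perm m (F : 'I_6 -> K) : perm_eq m (iota 0 6) ->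
  \sum_j F j = F (inord (nth 0 m 0)) + F (inord (nth 0 m 1)) + F (inord (nth 0 m 2))
    + F (inord (nth 0 m 3)) + F (inord (nth 0 m 4)) + F (inord (nth 0 m 5)).
Proof.
move=> m_perm; transitivity (\sum_(k <- m) F (inord k)).
  by rewrite sum6 (perm_big (iota 0 6)) //= !big_cons big_nil addr0 !addrA.
have := perm_size m_perm; case: m m_perm => [|m0 [|m1 [|m2 [|m3 [|m4 [|m5 [|]]]]]]] //= _ _.
by rewrite !big_cons big_nil addr0 !addrA.
Qed.

Lemma perm_cover m (j : 'I_6) : perm_eq m (iota 0 6) ->
  exists2 k, (k < 6)%N & j = inord (nth 0%N m k).
Proof.
move=> m_perm; have j_m : (j : nat) \in m by rewrite (perm_mem m_perm) mem_iota ltn_ord.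
exists (index (j : nat) m); last by rewrite nth_index // inord_val.
have m6 : size m = 6%N by rewrite (perm_size m_perm).
by move: j_m; rewrite -index_mem m6.
Qed.

Lemma duad_sym_rel (e : nat -> nat -> Prop) m i j :
  (forall a b, e a b -> e b a) ->
  (forall k, (k < 3)%N -> e (nth 0%N m k) (nth 0%N m (k + 3))) ->
  duad m i j -> e i j.
Proof.
move=> e_sym em /hasP[k]; rewrite mem_iota => /em ek.
by case/orP=> /andP[/eqP<- /eqP<-] //; apply: e_sym.
Qed.

(** A list r shorter than six is completed by zeros, through the default of [nth]. *)
Definition arrange m (r : seq K) : 'rV[K]_6 := \row_j nth 0 r (index (val j) m).

Lemma arrangeE m r k : perm_eq m (iota 0 6) -> (k < 6)%N ->
  arrange m r 0 (inord (nth 0%N m k)) = nth 0 r k.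
Proof.
move=> m_perm k_lt; rewrite mxE /= inordK ?perm_lt // index_uniq //.
  by rewrite (perm_size m_perm).
by rewrite (perm_uniq m_perm) iota_uniq.
Qed.

Definition on_plane m x : Prop :=
  forall k, (k < 3)%N -> entry x (nth 0%N m k) + entry x (nth 0%N m (k + 3)) = 0.

(** Together with s_1 = 0, a double line of the Igusa quartic. *)
Definition paired m x : Prop :=
  forall k, (k < 3)%N -> entry x (nth 0%N m k) = entry x (nth 0%N m (k + 3)).

Lemma on_plane_syntheme m x : perm_eq m (iota 0 6) -> on_plane m x ->
  exists2 l, l \in synthemes & on_plane l x.
Proof.
move=> /perm_syntheme[l l_syn lm] xm; exists l => // k k_lt.
apply: (duad_sym_rel (e := fun i j => entry x i + entry x j = 0) _ xm (lm k k_lt)).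
by move=> a b; rewrite addrC.
Qed.

Lemma paired_syntheme m x : perm_eq m (iota 0 6) -> paired m x ->
  exists2 l, l \in synthemes & paired l x.
Proof.
move=> /perm_syntheme[l l_syn lm] xm; exists l => // k k_lt.
apply: (duad_sym_rel (e := fun i j => entry x i = entry x j) _ xm (lm k k_lt)).
by move=> a b ->.
Qed.

Lemma on_plane_segre_plane m x : perm_eq m (iota 0 6) -> on_plane m x ->
  exists s : 'S_6, segre_plane s x.
Proof.
move=> m_perm xm.
have s_inj : injective (fun i : 'I_6 => inord (nth 0%N m i) : 'I_6).
  move=> i j /(congr1 val); have m6 := perm_size m_perm.
  have m_lt k : (k < 6)%N -> (nth 0%N m k < 6)%N.
    move=> k_lt; have : nth 0%N m k \in m by rewrite mem_nth ?m6.
    by rewrite (perm_mem m_perm) mem_iota.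
  rewrite /= !inordK ?m_lt // => /eqP; rewrite nth_uniq ?m6 // => [/eqP/val_inj//|].
  by rewrite (perm_uniq m_perm) iota_uniq.
exists (perm s_inj) => i; have := xm i (ltn_ord i).
by rewrite /entry !permE /= addnC.
Qed.

(** The remaining four coordinates have sum zero, and their cubes sum to 3 (a + b)(a + c)(a + d).
    Each factor gives a syntheme containing the duad of i and j. *)
Lemma segre_opp_coord_plane x i j : segre_cubic x -> i != j ->
  x 0 i + x 0 j = 0 -> exists2 l, l \in synthemes & on_plane l x.
Proof.
move=> [x1 x3] ij xij.
have [a [b [c [d m_perm]]]] := perm_of_pair (ltn_ord i) (ltn_ord j) ij.
move: x1 x3; rewrite /power_sum !(sum_perm _ m_perm) /= !inord_val -/(entry _ _) -/(entry _ _)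
   -/(entry _ _) -/(entry _ _) !expr1.
have -> : x 0 j = - x 0 i by apply/eqP; rewrite -addr_eq0 addrC xij.
move=> x1 x3.
have : 3%:R * ((entry x a + entry x b) * (entry x a + entry x c) * (entry x a + entry x d)) = 0.
  rewrite -[RHS]x3 /entry.
  have -> : x 0 (inord d) = - (x 0 (inord a) + x 0 (inord b) + x 0 (inord c)).
    by apply/eqP; rewrite -addr_eq0 -x1 /entry; apply/eqP; ring.
  ring.
move/eqP; rewrite !mulf_eq0 pnatr_eq0 /= -orbA.
have xd : entry x a + entry x b + entry x c + entry x d = 0.
  by rewrite -[RHS]x1 /entry; ring.
have plane a' b' c' d' : perm_eq [:: val i; a'; b'; val j; c'; d'] [:: val i; a; b; val j; c; d] ->
    entry x a' + entry x b' + entry x c' + entry x d' = 0 ->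
    entry x a' + entry x c' = 0 -> exists2 l, l \in synthemes & on_plane l x.
  move=> /perm_trans/(_ m_perm) p' sum0 ac; apply: (on_plane_syntheme p').
  case=> [|[|[|]]] //= _; rewrite ?ac //; first by rewrite /entry !inord_val.
  by rewrite -[RHS]sum0 -[LHS]addr0 -ac; ring.
case/or3P=> /eqP E.
- apply: (plane a c b d) => //.
  + by rewrite perm_cons; apply/seq.permP=> P /=; lia.
  + by rewrite -[RHS]xd; ring.
- by apply: (plane a b c d).
- apply: (plane a b d c) => //.
  + by apply/seq.permP=> P /=; lia.
  + by rewrite -[RHS]xd; ring.
Qed.

Definition node (b : seq bool) : 'rV[K]_6 := \row_j (if nth false b j then 1 else -1).

(** The coordinates are c or - c, and their sum is 2 c times the number of plus signs less 3, so
    there are three of each. Taking c to be coordinate 0 matches the normal form of [splits]. *)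
Lemma node_of_square v (r : K) : power_sum 1 v = 0 -> (forall j, v 0 j ^+ 2 = r) ->
  exists2 b, b \in splits & exists k, v = k *: node b.
Proof.
move=> v1 v2; pose c := entry v 0; pose b j := v 0 j == c.
have [c0|c_neq0] := eqVneq c 0.
  exists [:: true; true; true; false; false; false] => //; exists 0.
  apply/rowP=> j; rewrite mxE mul0r; apply/eqP.
  by rewrite -sqrf_eq0 v2 -(v2 (inord 0)) -/(entry _ _) -/c c0 expr0n.
have vE j : v 0 j = if b j then c else - c.
  rewrite /b; case: eqP => // vc; apply/eqP.
  have : v 0 j ^+ 2 == c ^+ 2 by rewrite !v2.
  by rewrite eqf_sqr => /orP[/eqP|].
have bE : (b (inord 0) + b (inord 1) + b (inord 2) + b (inord 3)
           + b (inord 4) + b (inord 5) = 3)%N.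
  have : (2 * c) * ((b (inord 0) + b (inord 1) + b (inord 2) + b (inord 3)
           + b (inord 4) + b (inord 5))%N%:R - 3%:R) = 0.
    rewrite -[RHS]v1 /power_sum sum6 !vE !natrD.
    do 6 case: (b _); rewrite /=; ring.
  move/eqP; rewrite !mulf_eq0 pnatr_eq0 (negPf c_neq0) subr_eq0 eqr_nat /=.
  by move/eqP.
have b0 : b (inord 0) by rewrite /b eqxx.
pose l := [:: b (inord 0); b (inord 1); b (inord 2); b (inord 3); b (inord 4); b (inord 5)].
exists l.
  move: b0 bE; rewrite /l.
  by do 6 case: (b _).
exists c; apply/rowP=> j; rewrite !mxE vE.
have -> : nth false l j = b j.
  rewrite -[in RHS](inord_val j) /l; case: j => -[|[|[|[|[|[|]]]]]] //.
by case: (b j); rewrite ?mulr1 ?mulrN1.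
Qed.

(** The sextic is the square of a cubic, so the six coordinates are its three roots, each taken
    twice. *)
Lemma igusa_dual_eq0_paired y : power_sum 1 y = 0 -> igusa y = 0 -> y != 0 -> igusa_dual y = 0 ->
  exists2 l, l \in synthemes & paired l y.
Proof.
move=> y1 yE y_neq0 c0; pose e2 := elem_sym y 2 / 2%:R; pose e3 := elem_sym y 3 / 2%:R.
pose c : {poly K} := 'X^3 + (e2 *: 'X - e3%:P).
have szc : size c = 4.
  rewrite size_polyDl size_polyXn // ltnS.
  rewrite (leq_trans (size_polyD _ _)) // geq_max size_polyN.
  rewrite (leq_trans (size_scale_leq _ _)) ?size_polyX //.
  by rewrite (leq_trans (size_polyC_leq1 _)).
have lcc : lead_coef c = 1.
  rewrite lead_coefE szc /= !coefD coefXn coefZ coefX coefN coefC /=.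
  by rewrite mulr0 subr0 addr0.
have [rs cE] := closed_field_poly_normal c; rewrite lcc scale1r in cE.
have sz_rs : size rs = 3 by move: szc; rewrite cE size_prod_XsubC => -[].
have : \prod_(z <- [seq y 0 j | j <- enum 'I_6]) ('X - z%:P)
     = \prod_(z <- rs ++ rs) ('X - z%:P).
  rewrite big_cat /= -cE big_map big_enum /= -expr2; apply: poly_ext => t.
  rewrite horner_prod (eq_bigr (fun j => t - y 0 j)) => [|j _]; last by rewrite hornerXsubC.
  by rewrite igusa_dual_eq0_prod // /c !hornerE.
move/prod_XsubC_eq; rewrite perm_sym => /(perm_iotaP 0)[m].
rewrite size_map size_enum_ord => m_perm rsE.
apply: (paired_syntheme m_perm) => k k_lt; rewrite /entry.
have m6 := perm_size m_perm; rewrite size_iota in m6.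
have yn i : (i < 6)%N ->
    nth 0 [seq y 0 j | j <- enum 'I_6] (nth 0%N m i) = y 0 (inord (nth 0%N m i)).
  move=> i_lt; have m_lt : (nth 0%N m i < 6)%N.
    have : nth 0%N m i \in m by rewrite mem_nth ?m6.
    by rewrite (perm_mem m_perm) mem_iota.
  rewrite (nth_map ord0) ?size_enum_ord //; congr (y 0 _).
  by apply: val_inj; rewrite /= nth_enum_ord // inordK.
have rn i : (i < 6)%N -> nth 0 (rs ++ rs) i = y 0 (inord (nth 0%N m i)).
  by move=> i_lt; rewrite rsE (nth_map 0%N) ?m6 // yn.
rewrite -!rn; try lia.
by rewrite !nth_cat sz_rs k_lt addnK ltnNge leq_addl.
Qed.

(** All coordinates are roots of one nonzero cubic, so two of any four agree. Indices 0 and 1 are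
    left out to keep room for the cone vertex in [radical_igusa]. *)
Lemma igusa_dual_eq0_coincide y : igusa_dual y = 0 ->
  exists i j : nat, [/\ (2 <= i)%N, (i < j)%N, (j < 6)%N & entry y i = entry y j].
Proof.
move=> c0.
pose c : {poly K} := - 4%:R *: 'X^3 + (power_sum 2 y *: 'X + (2%:R / 3%:R * power_sum 3 y)%:P).
have c_neq0 : c != 0.
  apply/eqP => /(congr1 (fun q : {poly K} => q`_3))/eqP.
  rewrite !coefD !coefZ coefXn coefX coefC coef0 /= mulr1 mulr0 !addr0.
  by rewrite oppr_eq0 pnatr_eq0.
have szc : (size c <= 4)%N.
  rewrite (leq_trans (size_polyD _ _)) // geq_max.
  rewrite (leq_trans (size_scale_leq _ _)) ?size_polyXn //=.
  rewrite (leq_trans (size_polyD _ _)) // geq_max.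
  rewrite (leq_trans (size_scale_leq _ _)) ?size_polyX //=.
  by rewrite (leq_trans (size_polyC_leq1 _)).
pose s := [:: entry y 2; entry y 3; entry y 4; entry y 5].
have cs : all (root c) s.
  have c0j j : root c (y 0 j).
    have := congr1 (fun u : 'rV_6 => u 0 j) c0; rewrite !mxE => E.
    by apply/rootP; rewrite -[RHS]E !(hornerD, hornerZ, hornerXn, hornerX, hornerC); ring.
  by rewrite /= !c0j.
have : ~~ uniq s.
  apply/negP => us; have := max_poly_roots c_neq0 cs us.
  by rewrite ltnNge szc.
rewrite /= !inE !negb_and !negbK orbF -!orbA.
by do ![case/orP]; move=> /eqP E; first [by exists 2, 3 | by exists 2, 4 | by exists 2, 5
  | by exists 3, 4 | by exists 3, 5 | by exists 4, 5].
Qed.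

End Coordinates.

(** * The two points where a line meets a diagonal conic *)

Section ConicLine.
Variable K : numClosedFieldType.

(* The two intersection points are the column and the row of the rank one matrix
   W through its entry W_11. *)
Lemma conic_line_entry (X Y Z d1 d2 d3 : K) :
  X * d1 ^+ 2 + Y * d2 ^+ 2 + Z * d3 ^+ 2 = - (X * Y * Z) ->
  X != 0 -> Y != 0 -> Z != 0 -> Y * Z + d1 ^+ 2 != 0 ->
  exists p1 p2 p3 q1 q2 q3 : K,
  [/\ p1 * X * d1 + p2 * Y * d2 + p3 * Z * d3 = 0,
      q1 * X * d1 + q2 * Y * d2 + q3 * Z * d3 = 0,
      p1 ^+ 2 * X + p2 ^+ 2 * Y + p3 ^+ 2 * Z = 0,
      q1 ^+ 2 * X + q2 ^+ 2 * Y + q3 ^+ 2 * Z = 0 &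
      p1 * q1 * X + p2 * q2 * Y + p3 * q3 * Z != 0 /\
      forall a b c, a * X * d1 + b * Y * d2 + c * Z * d3 = 0 ->
        a ^+ 2 * X + b ^+ 2 * Y + c ^+ 2 * Z = 0 ->
        exists k, (a = k * p1 /\ b = k * p2 /\ c = k * p3) \/
                  (a = k * q1 /\ b = k * q2 /\ c = k * q3)].
Proof.
move=> S X0 Y0 Z0 w0; pose w := Y * Z + d1 ^+ 2.
have S' : Z * d3 ^+ 2 = - (X * Y * Z) - X * d1 ^+ 2 - Y * d2 ^+ 2.
  by rewrite -S; ring.
exists w, (d1 * d2 + Z * d3), (d1 * d3 - Y * d2).
exists w, (d1 * d2 - Z * d3), (d1 * d3 + Y * d2).
have pq : w * w * X + (d1 * d2 + Z * d3) * (d1 * d2 - Z * d3) * Y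
    + (d1 * d3 - Y * d2) * (d1 * d3 + Y * d2) * Z = 2%:R * X * Y * Z * w.
  transitivity (w ^+ 2 * X + (d1 ^+ 2 * d2 ^+ 2 - Z * (Z * d3 ^+ 2)) * Y
     + (d1 ^+ 2 * (Z * d3 ^+ 2) - Y ^+ 2 * d2 ^+ 2 * Z)); first by ring.
  rewrite S' /w; ring.
have pq0 : w * w * X + (d1 * d2 + Z * d3) * (d1 * d2 - Z * d3) * Y
    + (d1 * d3 - Y * d2) * (d1 * d3 + Y * d2) * Z != 0.
  by rewrite pq !mulf_neq0 // pnatr_eq0.
split.
- transitivity (d1 * (X * d1 ^+ 2 + Y * d2 ^+ 2 + Z * d3 ^+ 2 + X * Y * Z)).
    by rewrite /w; ring.
  by rewrite S addNr mulr0.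
- transitivity (d1 * (X * d1 ^+ 2 + Y * d2 ^+ 2 + Z * d3 ^+ 2 + X * Y * Z)).
    by rewrite /w; ring.
  by rewrite S addNr mulr0.
- transitivity ((X * d1 ^+ 2 + Y * d2 ^+ 2 + Z * d3 ^+ 2 + X * Y * Z) * w).
    by rewrite /w; ring.
  by rewrite S addNr mul0r.
- transitivity ((X * d1 ^+ 2 + Y * d2 ^+ 2 + Z * d3 ^+ 2 + X * Y * Z) * w).
    by rewrite /w; ring.
  by rewrite S addNr mul0r.
split=> // a b c l0 Q0.
(* The polar form of the conic pairs p with q to k, and pairs (a, b, c) with q and p to u and t. As
   p and q are isotropic and span the line, k (a, b, c) = u p + t q there, and the conic gives u t =
   0. *)
pose k := 2%:R * X * Y * Z * w.
have k0 : k != 0 by rewrite !mulf_neq0 // pnatr_eq0.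
pose u := (a * w * X + b * (d1 * d2 - Z * d3) * Y + c * (d1 * d3 + Y * d2) * Z).
pose t := (a * w * X + b * (d1 * d2 + Z * d3) * Y + c * (d1 * d3 - Y * d2) * Z).
pose l := a * X * d1 + b * Y * d2 + c * Z * d3.
pose T := X * d1 ^+ 2 + Y * d2 ^+ 2 + Z * d3 ^+ 2 + X * Y * Z.
have T0 : T = 0 by rewrite /T S addNr.
have aE : k * a = u * w + t * w.
  transitivity (u * w + t * w - 2%:R * d1 * w * l); last by rewrite [l]l0; ring.
  by rewrite /k /u /t /l /w; ring.
have bE : k * b = u * (d1 * d2 + Z * d3) + t * (d1 * d2 - Z * d3).
  transitivity (u * (d1 * d2 + Z * d3) + t * (d1 * d2 - Z * d3)
     - 2%:R * d2 * w * l + 2%:R * Y * Z * b * T); last by rewrite [l]l0 T0; ring.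
  by rewrite /k /u /t /l /w /T; ring.
have cE : k * c = u * (d1 * d3 - Y * d2) + t * (d1 * d3 + Y * d2).
  transitivity (u * (d1 * d3 - Y * d2) + t * (d1 * d3 + Y * d2)
     - 2%:R * d3 * w * l + 2%:R * Y * Z * c * T); last by rewrite [l]l0 T0; ring.
  by rewrite /k /u /t /l /w /T; ring.
have : u * t = 0.
  have : 2%:R * (u * t) = 0.
    rewrite -(mulr0 k) -Q0.
    transitivity ((k * a) * a * X + (k * b) * b * Y + (k * c) * c * Z); last by ring.
    by rewrite aE bE cE /u /t; ring.
  by move/eqP; rewrite mulf_eq0 pnatr_eq0 => /eqP.
move/eqP; rewrite mulf_eq0 => /orP[]/eqP E.
- exists (t / k); right; move: aE bE cE; rewrite E => aE bE cE.
  by split; [|split]; apply: (mulfI k0); rewrite ?aE ?bE ?cE; field.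
- exists (u / k); left; move: aE bE cE; rewrite E => aE bE cE.
  by split; [|split]; apply: (mulfI k0); rewrite ?aE ?bE ?cE; field.
Qed.

(** If W_11 vanishes another diagonal entry serves, since the relation gives X W_11 + Y W_22 + Z
    W_33 = 2 X Y Z. *)
Lemma conic_line (X Y Z d1 d2 d3 : K) :
  X * d1 ^+ 2 + Y * d2 ^+ 2 + Z * d3 ^+ 2 = - (X * Y * Z) ->
  X != 0 -> Y != 0 -> Z != 0 ->
  exists p1 p2 p3 q1 q2 q3 : K,
  [/\ p1 * X * d1 + p2 * Y * d2 + p3 * Z * d3 = 0,
      q1 * X * d1 + q2 * Y * d2 + q3 * Z * d3 = 0,
      p1 ^+ 2 * X + p2 ^+ 2 * Y + p3 ^+ 2 * Z = 0,
      q1 ^+ 2 * X + q2 ^+ 2 * Y + q3 ^+ 2 * Z = 0 &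
      p1 * q1 * X + p2 * q2 * Y + p3 * q3 * Z != 0 /\
      forall a b c, a * X * d1 + b * Y * d2 + c * Z * d3 = 0 ->
        a ^+ 2 * X + b ^+ 2 * Y + c ^+ 2 * Z = 0 ->
        exists k, (a = k * p1 /\ b = k * p2 /\ c = k * p3) \/
                  (a = k * q1 /\ b = k * q2 /\ c = k * q3)].
Proof.
move=> S X0 Y0 Z0.
have [w1|] := eqVneq (Y * Z + d1 ^+ 2) 0; last exact: conic_line_entry.
have [w2|w2] := eqVneq (Z * X + d2 ^+ 2) 0; last first.
  have S' : Y * d2 ^+ 2 + Z * d3 ^+ 2 + X * d1 ^+ 2 = - (Y * Z * X).
    by transitivity (- (X * Y * Z)); [rewrite -S | ]; ring.
  have [p2 [p3 [p1 [q2 [q3 [q1 [lp lq Qp Qq [Bpq cov]]]]]]]] :=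
    conic_line_entry S' Y0 Z0 X0 w2.
  exists p1, p2, p3, q1, q2, q3; split.
  - by rewrite -lp; ring.
  - by rewrite -lq; ring.
  - by rewrite -Qp; ring.
  - by rewrite -Qq; ring.
  split; first by apply: contraNneq Bpq => Bpq; apply/eqP; rewrite -[RHS]Bpq; ring.
  move=> a b c la Qa; have [||k [[bE [cE aE]]|[bE [cE aE]]]] := cov b c a.
  - by rewrite -la; ring.
  - by rewrite -Qa; ring.
  - by exists k; left.
  - by exists k; right.
have w3 : X * Y + d3 ^+ 2 != 0.
  apply/eqP => w3.
  have : 2%:R * X * Y * Z = 0.
    transitivity (X * (Y * Z + d1 ^+ 2) + Y * (Z * X + d2 ^+ 2) + Z * (X * Y + d3 ^+ 2)
      - (X * d1 ^+ 2 + Y * d2 ^+ 2 + Z * d3 ^+ 2 + X * Y * Z)); first by ring.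
    by rewrite w1 w2 w3 S; ring.
  by apply/eqP; rewrite !mulf_neq0 // pnatr_eq0.
have S' : Z * d3 ^+ 2 + X * d1 ^+ 2 + Y * d2 ^+ 2 = - (Z * X * Y).
  by transitivity (- (X * Y * Z)); [rewrite -S | ]; ring.
have [p3 [p1 [p2 [q3 [q1 [q2 [lp lq Qp Qq [Bpq cov]]]]]]]] :=
  conic_line_entry S' Z0 X0 Y0 w3.
exists p1, p2, p3, q1, q2, q3; split.
- by rewrite -lp; ring.
- by rewrite -lq; ring.
- by rewrite -Qp; ring.
- by rewrite -Qq; ring.
split; first by apply: contraNneq Bpq => Bpq; apply/eqP; rewrite -[RHS]Bpq; ring.
move=> a b c la Qa; have [||k [[cE [aE bE]]|[cE [aE bE]]]] := cov c a b.
- by rewrite -la; ring.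
- by rewrite -Qa; ring.
- by exists k; left.
- by exists k; right.
Qed.

End ConicLine.

(** * The discriminant on the hyperplane s_1 = 0 *)

Section Duad.
Variable K : numClosedFieldType.
Implicit Types (x y v w : 'rV[K]_6) (m : seq nat).

Definition syntheme_vector m (a b c : K) : 'rV[K]_6 :=
  arrange m [:: a; b; c; - a; - b; - c].

Lemma syntheme_vectorE m a b c k : perm_eq m (iota 0 6) -> (k < 6)%N ->
  syntheme_vector m a b c 0 (inord (nth 0%N m k)) = nth 0 [:: a; b; c; - a; - b; - c] k.
Proof. exact: arrangeE. Qed.

Lemma row_perm_ext m x y : perm_eq m (iota 0 6) ->
  (forall k, (k < 6)%N -> entry x (nth 0%N m k) = entry y (nth 0%N m k)) -> x = y.
Proof.
move=> m_perm xy; apply/rowP=> j; have [k k_lt ->] := perm_cover j m_perm.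
exact: xy.
Qed.

Lemma on_plane_vector m x : perm_eq m (iota 0 6) -> on_plane m x ->
  x = syntheme_vector m (entry x (nth 0%N m 0)) (entry x (nth 0%N m 1)) (entry x (nth 0%N m 2)).
Proof.
move=> m_perm xm; apply: (row_perm_ext m_perm) => k k_lt.
rewrite {2}/entry syntheme_vectorE //.
have x0 := xm 0%N erefl; have x1 := xm 1%N erefl; have x2 := xm 2%N erefl.
case: k k_lt => [|[|[|[|[|[|]]]]]] //= _; apply/eqP; rewrite -addr_eq0 addrC ?x0 ?x1 ?x2 //.
Qed.

Lemma vector_on_plane m a b c : perm_eq m (iota 0 6) -> on_plane m (syntheme_vector m a b c).
Proof.
move=> m_perm k k_lt; rewrite /entry !syntheme_vectorE //; try lia.
by case: k k_lt => [|[|[|]]] //= _; rewrite subrr.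
Qed.

Lemma on_plane_sum1 m x : perm_eq m (iota 0 6) -> on_plane m x -> power_sum 1 x = 0.
Proof.
move=> m_perm xm; have x0 := xm 0%N erefl; have x1 := xm 1%N erefl; have x2 := xm 2%N erefl.
rewrite /power_sum (sum_perm _ m_perm); rewrite /entry /= in x0 x1 x2.
transitivity (0 + 0 + 0 : K); last by rewrite !addr0.
by rewrite -{1}x0 -{1}x1 -x2; ring.
Qed.

Lemma split_perm b : b \in splits -> exists2 m, perm_eq m (iota 0 6) &
  [seq nth false b i | i <- m] = [:: true; true; true; false; false; false].
Proof.
have : all (fun b => has (fun m =>
    [seq nth false b i | i <- m] == [:: true; true; true; false; false; false])
  (permutations (iota 0 6))) splits by vm_compute.
move=> /allP H /H/hasP[m]; rewrite mem_permutations => m_perm /eqP mE.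
by exists m.
Qed.

Lemma node_at b m k : perm_eq m (iota 0 6) -> (k < 6)%N ->
  [seq nth false b i | i <- m] = [:: true; true; true; false; false; false] ->
  node K b 0 (inord (nth 0%N m k)) = if (k < 3)%N then 1 else -1.
Proof.
move=> m_perm k_lt mE; rewrite mxE /= inordK ?perm_lt //.
have -> : nth false b (nth 0%N m k) = nth false [seq nth false b i | i <- m] k.
  by rewrite (nth_map 0%N) // (perm_size m_perm).
by rewrite mE; case: k k_lt => [|[|[|[|[|[|]]]]]].
Qed.

Lemma node_sum b : b \in splits -> power_sum 1 (node K b) = 0.
Proof.
move=> /split_perm[m m_perm mE]; rewrite /power_sum (sum_perm _ m_perm).
by rewrite !(node_at m_perm _ mE) //=; ring.
Qed.

Lemma node_square b j : node K b 0 j ^+ 2 = 1.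
Proof. by rewrite mxE; case: ifP; rewrite ?sqrrN expr1n. Qed.

Lemma node_cube b : b \in splits -> power_sum 3 (node K b) = 0.
Proof.
move=> /node_sum <-; apply: eq_bigr => j _.
by rewrite exprSr node_square mul1r expr1.
Qed.

Lemma node_neq0 b : node K b != 0.
Proof.
apply/row_neq0P; exists ord0; rewrite mxE; case: ifP; rewrite ?oppr_eq0 oner_neq0 //.
Qed.

Lemma node_opposite b : b \in splits -> exists i j, i != j /\ node K b 0 i + node K b 0 j = 0.
Proof.
move=> /split_perm[m m_perm mE]; exists (inord (nth 0%N m 0)), (inord (nth 0%N m 3)).
split; last by rewrite !(node_at m_perm _ mE) //= subrr.
apply/eqP => /(congr1 (fun j => node K b 0 j)); rewrite !(node_at m_perm _ mE) //= => /eqP.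
by rewrite -subr_eq0 opprK -mulr2n pnatr_eq0.
Qed.

End Duad.

Arguments node_at {K b m k}.
Arguments syntheme_vectorE {K m a b c k}.

Section Center.
Variables (K : numClosedFieldType) (P : 'rV[K]_6).
Implicit Types (x y v w : 'rV[K]_6) (m : seq nat).
Local Notation p := power_sum.
Hypotheses (P1 : p 1 P = 0) (P3 : p 3 P = 0).
Hypothesis offP : forall i j : 'I_6, i != j -> P 0 i + P 0 j != 0.

Let sumP : \sum_j P 0 j = 0.
Proof. by rewrite -[RHS]P1; apply: eq_bigr => j _; rewrite expr1. Qed.

Lemma square_not_const (r : K) : ~ forall j, P 0 j ^+ 2 = r.
Proof.
move=> /(node_of_square P1)[b /(node_opposite K)[i [j [ij bij]]] [k PE]].
by have /eqP[] := offP ij; rewrite PE !mxE -mulrDr; rewrite !mxE in bij; rewrite bij mulr0.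
Qed.

Lemma center_p5 : p 5 P != 0.
Proof.
by apply/eqP => /(opp_coord_segre P1 P3)[i [j [/offP/eqP]]].
Qed.

Lemma segre_dual_center_neq0 : segre_dual P != 0.
Proof.
apply/eqP => P0; apply: (@square_not_const (p 2 P / 6%:R)) => j.
have := congr1 (fun u : 'rV_6 => u 0 j) P0; rewrite !mxE => /eqP.
by rewrite subr_eq0 => /eqP.
Qed.

Definition polar_L v : K := \sum_j P 0 j ^+ 2 * v 0 j.
Definition polar_Q v : K := \sum_j P 0 j * v 0 j ^+ 2.
Definition polar_QQ v w : K := \sum_j P 0 j * v 0 j * w 0 j.

(** L = 0 at a node would put its line to P inside the cubic. Label the coordinates of P on the two
    triples a, b', c and d, e, f. Modulo s_1, 6 (a + d)(a + e)(a + f) is 3 (a + d + e + f) L + 2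
    s_3, so P would have two opposite coordinates. *)
Lemma polar_L_node b : b \in splits -> polar_L (node K b) != 0.
Proof.
move=> /split_perm[m m_perm mE]; apply/eqP => L0.
move: P1 P3 L0; rewrite /polar_L /power_sum !(sum_perm _ m_perm) !(node_at m_perm _ mE) //=.
have neq i j : (i < 6)%N -> (j < 6)%N -> i != j ->
    P 0 (inord (nth 0%N m i)) + P 0 (inord (nth 0%N m j)) != 0.
  move=> i_lt j_lt ij; apply: offP; apply: contra_neq ij => /(congr1 val).
  rewrite /= !inordK ?perm_lt // => /eqP; rewrite nth_uniq ?(perm_size m_perm) //.
    by move/eqP.
  by rewrite (perm_uniq m_perm) iota_uniq.
have n03 := neq 0%N 3%N erefl erefl erefl.
have n04 := neq 0%N 4%N erefl erefl erefl.
have n05 := neq 0%N 5%N erefl erefl erefl.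
move: n03 n04 n05.
set a := P 0 (inord (nth 0%N m 0)); set b' := P 0 (inord (nth 0%N m 1)).
set c := P 0 (inord (nth 0%N m 2)); set d := P 0 (inord (nth 0%N m 3)).
set e := P 0 (inord (nth 0%N m 4)); set f := P 0 (inord (nth 0%N m 5)).
clearbody a b' c d e f => n03 n04 n05 s1 s3 s2.
have : 6%:R * ((a + d) * (a + e) * (a + f)) = 0.
  have cE : c = - (a + b' + d + e + f).
    by apply/eqP; rewrite -addr_eq0 -s1; apply/eqP; ring.
  move: s2 s3; rewrite cE => s2 s3.
  rewrite -[RHS](addr0 0) -[X in _ = X + _](mulr0 (3%:R * (a + d + e + f))).
  rewrite -[X in _ = _ + X](mulr0 2%:R).
  by rewrite -{1}s2 -s3; ring.
by apply/eqP; rewrite !mulf_neq0 // pnatr_eq0.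
Qed.


Lemma power_sum1E v : p 1 v = \sum_j v 0 j.
Proof. by apply: eq_bigr => j _; rewrite expr1. Qed.

(* With v the lift of a direction x, one has L = 3 polar_L, 2 Q = 3 polar_Q and
   G = s_3; disc_grad is a third of the gradient. *)
Definition disc v : K := 3%:R * polar_L v * p 3 v - 9%:R / 4%:R * polar_Q v ^+ 2.
Definition disc_grad v : 'rV[K]_6 :=
  \row_j (p 3 v * P 0 j ^+ 2 + 3%:R * polar_L v * v 0 j ^+ 2
          - 3%:R * polar_Q v * P 0 j * v 0 j).

Lemma polar_L_shift v u : polar_L (v + u *: P) = polar_L v.
Proof.
transitivity (polar_L v + u * p 3 P); last by rewrite P3 mulr0 addr0.
rewrite /polar_L /power_sum mulr_sumr -big_split; apply: eq_bigr => j _ /=.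
by rewrite !mxE; ring.
Qed.

Lemma polar_Q_shift v u : polar_Q (v + u *: P) = polar_Q v + 2%:R * u * polar_L v.
Proof.
transitivity (polar_Q v + 2%:R * u * polar_L v + u ^+ 2 * p 3 P); last first.
  by rewrite P3 mulr0 addr0.
rewrite /polar_Q /polar_L /power_sum !mulr_sumr -!big_split; apply: eq_bigr => j _ /=.
by rewrite !mxE; ring.
Qed.

Lemma power_sum3_shift v u :
  p 3 (v + u *: P) = p 3 v + 3%:R * u * polar_Q v + 3%:R * u ^+ 2 * polar_L v.
Proof.
transitivity (p 3 v + 3%:R * u * polar_Q v + 3%:R * u ^+ 2 * polar_L v + u ^+ 3 * p 3 P).
  rewrite /polar_Q /polar_L /power_sum !mulr_sumr -!big_split; apply: eq_bigr => j _ /=.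
  by rewrite !mxE; ring.
by rewrite P3 mulr0 addr0.
Qed.

(** The discriminant of a quadratic polynomial does not change when its variable is translated, so
    [disc] depends only on the line through P. *)
Lemma disc_shift v u : disc (v + u *: P) = disc v.
Proof.
by rewrite /disc polar_L_shift polar_Q_shift power_sum3_shift; field.
Qed.

Lemma disc_grad_shift v u : disc_grad (v + u *: P) = disc_grad v.
Proof.
apply/rowP=> j; rewrite !mxE polar_L_shift polar_Q_shift power_sum3_shift; ring.
Qed.

Lemma power_sum1_shift v u : p 1 v = 0 -> p 1 (v + u *: P) = 0.
Proof.
rewrite !power_sum1E => v1; rewrite (eq_bigr (fun j => v 0 j + u * P 0 j)) => [|j _].
  by rewrite big_split /= v1 -mulr_sumr sumP mulr0 addr0.
by rewrite !mxE.
Qed.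

Lemma polar_L_scale v u : polar_L (u *: v) = u * polar_L v.
Proof. by rewrite /polar_L mulr_sumr; apply: eq_bigr => j _; rewrite mxE; ring. Qed.
Lemma polar_Q_scale v u : polar_Q (u *: v) = u ^+ 2 * polar_Q v.
Proof. by rewrite /polar_Q mulr_sumr; apply: eq_bigr => j _; rewrite mxE; ring. Qed.
Lemma power_sum_scale k v u : p k (u *: v) = u ^+ k * p k v.
Proof. by rewrite /power_sum mulr_sumr; apply: eq_bigr => j _; rewrite mxE exprMn. Qed.

Lemma dot_disc_grad v w : dot w (disc_grad v) =
  p 3 v * polar_L w + 3%:R * polar_L v * (\sum_j v 0 j ^+ 2 * w 0 j)
  - 3%:R * polar_Q v * polar_QQ v w.
Proof.
transitivity (\sum_j (p 3 v * (P 0 j ^+ 2 * w 0 j)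
    + 3%:R * polar_L v * (v 0 j ^+ 2 * w 0 j)
    - 3%:R * polar_Q v * (P 0 j * v 0 j * w 0 j))).
  by apply: eq_bigr => j _; rewrite !mxE; ring.
by rewrite sumrB big_split /= -!mulr_sumr.
Qed.

Lemma disc_line v w : exists2 g : {poly K},
  (forall t, disc (v + t *: w) = g.[t]) & g^`().[0] = 3%:R * dot w (disc_grad v).
Proof.
pose c1 := \sum_j v 0 j ^+ 2 * w 0 j; pose c2 := \sum_j v 0 j * w 0 j ^+ 2.
pose gL := (polar_L v)%:P + polar_L w *: 'X.
pose gQ := (polar_Q v)%:P + (2%:R * polar_QQ v w) *: 'X + polar_Q w *: 'X^2.
pose gG := (p 3 v)%:P + (3%:R * c1) *: 'X + (3%:R * c2) *: 'X^2 + p 3 w *: 'X^3.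
exists (3%:R *: (gL * gG) - (9%:R / 4%:R) *: (gQ * gQ)) => [t|].
  rewrite /disc.
  have -> : polar_L (v + t *: w) = polar_L v + t * polar_L w.
    rewrite /polar_L mulr_sumr -big_split; apply: eq_bigr => j _ /=.
    by rewrite !mxE; ring.
  have -> : polar_Q (v + t *: w)
      = polar_Q v + t * (2%:R * polar_QQ v w) + t ^+ 2 * polar_Q w.
    rewrite /polar_Q /polar_QQ !mulr_sumr -!big_split; apply: eq_bigr => j _ /=.
    by rewrite !mxE; ring.
  have -> : p 3 (v + t *: w)
      = p 3 v + t * (3%:R * c1) + t ^+ 2 * (3%:R * c2) + t ^+ 3 * p 3 w.
    rewrite /power_sum !mulr_sumr -!big_split; apply: eq_bigr => j _ /=.
    by rewrite !mxE; ring.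
  rewrite /gL /gQ /gG !(hornerD, hornerN, hornerZ, hornerM, hornerC, hornerX, hornerXn).
  by field.
rewrite /gL /gQ /gG !(derivD, derivN, derivZ, derivM, derivC, derivX, derivXn) dot_disc_grad -/c1.
rewrite !(hornerD, hornerN, hornerZ, hornerM, hornerC, hornerX, hornerXn, hornerMn) /=.
by rewrite ?(expr0n, expr1n, expr1) /=; field.
Qed.

Lemma orthogonal_const (g : 'rV[K]_6) :
  (forall w, p 1 w = 0 -> dot w g = 0) -> forall i j, g 0 i = g 0 j.
Proof.
move=> g0 i j; pose w : 'rV[K]_6 := delta_mx 0 i + (-1) *: delta_mx 0 j.
have one k : dot (delta_mx 0 k) (const_mx 1) = 1 :> K by rewrite dot_delta mxE.
have w1 : p 1 w = 0.
  rewrite power_sum1E; transitivity (dot w (const_mx 1)).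
    by apply: eq_bigr => k _; rewrite [const_mx 1 _ _]mxE mulr1.
  by rewrite dotDl dotZl !one mulr1 subrr.
have := g0 w w1; rewrite dotDl dotZl !dot_delta mulN1r => /eqP.
by rewrite subr_eq0 => /eqP.
Qed.

(** If L <> 0, move v along its line to q with Q(q) = 0. Testing against q itself gives L s_3(q) =
    0, and the gradient is then 3 L q_j^2, constant in j, so q is a node. If L = 0, testing against
    v gives Q = 0; the gradient is s_3(v) P_j^2, and the P_j^2 are not all equal. *)
Lemma disc_crit v : p 1 v = 0 ->
  (forall w, p 1 w = 0 -> dot w (disc_grad v) = 0) ->
  (exists2 b, b \in splits & exists u k, v = k *: node K b + u *: P) \/
  [/\ polar_L v = 0, polar_Q v = 0 & p 3 v = 0].
Proof.
move=> v1 crit; have [L0|L_neq0] := eqVneq (polar_L v) 0.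
  right; have Q0 : polar_Q v = 0.
    have := crit v v1; rewrite dot_disc_grad L0 !(mulr0, mul0r, add0r).
    have -> : polar_QQ v v = polar_Q v.
      by apply: eq_bigr => j _; rewrite expr2 mulrA.
    move/eqP; rewrite oppr_eq0 !mulf_eq0 pnatr_eq0 /= orbb => /eqP //.
  split=> //; apply/eqP/negPn/negP => C_neq0.
  apply: (@square_not_const (P 0 ord0 ^+ 2)) => j; apply: (mulfI C_neq0).
  have := orthogonal_const crit j ord0; rewrite !mxE L0 Q0.
  by rewrite !(mulr0, mul0r, subr0, addr0).
left; pose u := - polar_Q v / (2%:R * polar_L v); pose q := v + u *: P.
have q1 : p 1 q = 0 by exact: power_sum1_shift.
have Qq : polar_Q q = 0 by rewrite polar_Q_shift /u; field; rewrite L_neq0.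
have Lq : polar_L q = polar_L v by exact: polar_L_shift.
have critq w : p 1 w = 0 -> dot w (disc_grad q) = 0.
  by rewrite disc_grad_shift; exact: crit.
have Cq : p 3 q = 0.
  have := critq q q1; rewrite dot_disc_grad Qq !(mulr0, mul0r, subr0).
  have -> : \sum_j q 0 j ^+ 2 * q 0 j = p 3 q by apply: eq_bigr => j _; rewrite -exprSr.
  have -> : p 3 q * polar_L q + 3%:R * polar_L q * p 3 q = 4%:R * polar_L q * p 3 q by ring.
  by move/eqP; rewrite !mulf_eq0 pnatr_eq0 Lq (negPf L_neq0) => /eqP.
have q2 j : q 0 j ^+ 2 = q 0 ord0 ^+ 2.
  apply: (mulfI (_ : 3%:R * polar_L q != 0)); first by rewrite mulf_neq0 ?pnatr_eq0 ?Lq.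
  have := orthogonal_const critq j ord0; rewrite !mxE Cq Qq.
  by rewrite !(mulr0, mul0r, subr0, add0r).
have [b b_s [k qE]] := node_of_square q1 q2.
by exists b => //; exists (- u), k; rewrite -qE /q scaleNr addrK.
Qed.

Lemma disc_grad_node b : b \in splits ->
  forall w, p 1 w = 0 -> dot w (disc_grad (node K b)) = 0.
Proof.
move=> b_s w w1; rewrite dot_disc_grad (node_cube K b_s).
have -> : polar_Q (node K b) = 0.
  by rewrite -[RHS]sumP; apply: eq_bigr => j _; rewrite node_square mulr1.
have -> : \sum_j node K b 0 j ^+ 2 * w 0 j = 0.
  by rewrite -[RHS]w1 power_sum1E; apply: eq_bigr => j _; rewrite node_square mul1r.
by ring.
Qed.


Section Syntheme.
Variable m : seq nat.
Hypothesis m_perm : perm_eq m (iota 0 6).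
Let c i := inord (nth 0%N m i) : 'I_6.
Definition duad_sum i : K := P 0 (inord (nth 0%N m i)) + P 0 (inord (nth 0%N m (i + 3))).
Definition duad_diff i : K := P 0 (inord (nth 0%N m i)) - P 0 (inord (nth 0%N m (i + 3))).
Local Notation X := (duad_sum 0).
Local Notation Y := (duad_sum 1).
Local Notation Z := (duad_sum 2).
Local Notation d1 := (duad_diff 0).
Local Notation d2 := (duad_diff 1).
Local Notation d3 := (duad_diff 2).

Lemma duad_neq i j : (i < 6)%N -> (j < 6)%N -> i != j -> c i != c j.
Proof.
move=> i_lt j_lt; apply: contra_neq => /(congr1 val).
rewrite /= !inordK ?perm_lt // => /eqP; rewrite nth_uniq ?(perm_size m_perm) //.
  by move/eqP.
by rewrite (perm_uniq m_perm) iota_uniq.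
Qed.

Lemma duad_sum_neq0 i : (i < 3)%N -> duad_sum i != 0.
Proof. by move=> i_lt; apply: offP; apply: duad_neq; lia. Qed.

Lemma duad_sum0 : X + Y + Z = 0.
Proof.
rewrite -[RHS]P1 /power_sum (sum_perm _ m_perm) /duad_sum /=; ring.
Qed.

(** A pair with sum S and difference d has cubes summing to (S^3 + 3 S d^2) / 4, and X + Y + Z = 0
    turns the sum of the S^3 into 3 X Y Z. This is the hypothesis of [conic_line]; on the plane of
    m, L gives the line and Q the conic. *)
Lemma duad_relation : X * d1 ^+ 2 + Y * d2 ^+ 2 + Z * d3 ^+ 2 = - (X * Y * Z).
Proof.
apply/eqP; rewrite -subr_eq0 opprK; apply/eqP.
have cube : X ^+ 3 + Y ^+ 3 + Z ^+ 3 = 3%:R * X * Y * Z.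
  have -> : Z = - (X + Y) by apply/eqP; rewrite -addr_eq0 addrC duad_sum0.
  ring.
have : 4%:R * p 3 P = X ^+ 3 + Y ^+ 3 + Z ^+ 3
    + 3%:R * (X * d1 ^+ 2 + Y * d2 ^+ 2 + Z * d3 ^+ 2).
  rewrite /power_sum (sum_perm _ m_perm) /duad_sum /duad_diff /=; ring.
rewrite P3 mulr0 cube => E.
apply: (mulfI (_ : 3%:R != 0 :> K)); first by rewrite pnatr_eq0.
by rewrite mulr0 E; ring.
Qed.

Lemma polar_L_on_plane (x y z : K) :
  polar_L (syntheme_vector m x y z) = x * X * d1 + y * Y * d2 + z * Z * d3.
Proof.
rewrite /polar_L (sum_perm _ m_perm) !(syntheme_vectorE m_perm) //= /duad_sum /duad_diff /=.
ring.
Qed.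

Lemma polar_QQ_on_plane (x y z x' y' z' : K) :
  polar_QQ (syntheme_vector m x y z) (syntheme_vector m x' y' z')
  = x * x' * X + y * y' * Y + z * z' * Z.
Proof.
rewrite /polar_QQ (sum_perm _ m_perm) !(syntheme_vectorE m_perm) //= /duad_sum /=.
ring.
Qed.

Lemma polar_QE v : polar_Q v = polar_QQ v v.
Proof. by apply: eq_bigr => j _; rewrite expr2 mulrA. Qed.

Lemma power_sum3_on_plane v : on_plane m v -> p 3 v = 0.
Proof.
move=> /(on_plane_vector m_perm)->.
rewrite /power_sum (sum_perm _ m_perm) !(syntheme_vectorE m_perm) //=; ring.
Qed.

Lemma scale_syntheme_vector (k x y z : K) :
  k *: syntheme_vector m x y z = syntheme_vector m (k * x) (k * y) (k * z).
Proof.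
apply: (row_perm_ext m_perm) => i i_lt; rewrite /entry mxE !syntheme_vectorE //.
by case: i i_lt => [|[|[|[|[|[|]]]]]] //= _; rewrite mulrN.
Qed.

(** Since s_3 is zero on the plane, its points with L = Q = 0 are those joined to P by a line of the
    cubic. *)
Lemma lines_on_plane : exists v w,
  [/\ on_plane m v, on_plane m w, polar_L v = 0 /\ polar_L w = 0,
      polar_Q v = 0 /\ polar_Q w = 0 & polar_QQ v w != 0 /\
      forall x, on_plane m x -> polar_L x = 0 -> polar_Q x = 0 ->
        exists k, x = k *: v \/ x = k *: w].
Proof.
have [||||p1 [p2 [p3 [q1 [q2 [q3 [lp lq Qp Qq [Bpq cov]]]]]]]] := @conic_line K X Y Z d1 d2 d3.
- exact: duad_relation.
- exact: duad_sum_neq0.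
- exact: duad_sum_neq0.
- exact: duad_sum_neq0.
exists (syntheme_vector m p1 p2 p3), (syntheme_vector m q1 q2 q3).
rewrite !polar_QE !polar_L_on_plane !polar_QQ_on_plane -!expr2.
split=> //; try exact: vector_on_plane.
split=> // x /(on_plane_vector m_perm) ->.
rewrite polar_QE polar_L_on_plane polar_QQ_on_plane -!expr2 => lx Qx.
by have [k [[-> [-> ->]]|[-> [-> ->]]]] := cov _ _ _ lx Qx; exists k;
  rewrite !scale_syntheme_vector; [left | right].
Qed.

(** Shows that the discriminant is not identically zero on L = 0, where it is a multiple of Q^2. *)
Lemma on_plane_L0_Q_neq0 : exists v, [/\ on_plane m v, polar_L v = 0 & polar_Q v != 0].
Proof.
have [v [w [vm wm [Lv Lw] [Qv Qw] [Bvw _]]]] := lines_on_plane.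
exists (v + w); split.
- by move=> k k_lt; rewrite /entry !mxE addrACA [X in X + _]vm // [X in _ + X]wm // addr0.
- rewrite -[RHS](addr0 0) -{1}Lv -Lw /polar_L -big_split; apply: eq_bigr => j _ /=.
  by rewrite !mxE; ring.
suff -> : polar_Q (v + w) = 2%:R * polar_QQ v w by rewrite mulf_neq0 // pnatr_eq0.
transitivity (polar_Q v + polar_Q w + 2%:R * polar_QQ v w); last by rewrite Qv Qw !add0r.
rewrite /polar_Q /polar_QQ mulr_sumr -!big_split; apply: eq_bigr => j _ /=.
by rewrite !mxE; ring.
Qed.

End Syntheme.

(* The synthemes containing the duad {0, 1}. *)
Definition first_synthemes := take 3 synthemes.

Lemma first_syntheme_perm m : m \in first_synthemes -> perm_eq m (iota 0 6).
Proof. by move/mem_take/syntheme_perm. Qed.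

(** P is off the hyperplane x_0 + x_1 = 0, so a line of the cubic through P meets it in one point.
    That point has opposite coordinates 0 and 1, hence lies on one of the three planes whose
    syntheme contains this duad. *)
Lemma line_on_plane v : p 1 v = 0 ->
  polar_L v = 0 -> polar_Q v = 0 -> p 3 v = 0 ->
  exists2 m, m \in first_synthemes & exists u, on_plane m (v + u *: P).
Proof.
move=> v1 L0 Q0 C0; have P01 : entry P 0 + entry P 1 != 0.
  by apply: offP; rewrite -val_eqE /= !inordK.
pose u := - (entry v 0 + entry v 1) / (entry P 0 + entry P 1).
pose w := v + u *: P.
have w01 : entry w 0 + entry w 1 = 0.
  have wE k : entry w k = entry v k + u * entry P k by rewrite /entry !mxE.
  by rewrite !wE /u; field.
have w1 : p 1 w = 0 by exact: power_sum1_shift.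
have w3 : p 3 w = 0 by rewrite power_sum3_shift L0 Q0 C0; ring.
have w0E : entry w 0 = - entry w 1 by apply/eqP; rewrite -addr_eq0 w01.
have sum4 : entry w 2 + entry w 3 + entry w 4 + entry w 5 = 0.
  rewrite -[RHS]w1 /power_sum sum6 -/(entry _ 0) w0E /entry; ring.
have : 3%:R * ((entry w 2 + entry w 3) * (entry w 2 + entry w 4) * (entry w 2 + entry w 5)) = 0.
  rewrite -[RHS]w3 /power_sum sum6 -/(entry _ 0) w0E -!/(entry _ _).
  have -> : entry w 5 = - (entry w 2 + entry w 3 + entry w 4).
    by apply/eqP; rewrite -addr_eq0 addrC sum4.
  ring.
move/eqP; rewrite !mulf_eq0 pnatr_eq0 /= -orbA => /or3P[]/eqP E.
- exists (nth [::] synthemes 0) => //; exists u; case=> [|[|[|]]] //= _.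
  by rewrite -[RHS]sum4 E add0r.
- exists (nth [::] synthemes 1) => //; exists u; case=> [|[|[|]]] //= _.
  by rewrite -[RHS]sum4 -[LHS](addr0) -E; ring.
- exists (nth [::] synthemes 2) => //; exists u; case=> [|[|[|]]] //= _.
  by rewrite -[RHS]sum4 -[LHS](addr0) -E; ring.
Qed.

Lemma first_syntheme01 m v : m \in first_synthemes -> on_plane m v -> entry v 0 + entry v 1 = 0.
Proof.
by rewrite !inE => /or3P[]/eqP-> vm; have := vm 0%N erefl; rewrite //= addrC.
Qed.

(** Two such synthemes make the squares of coordinates 2 to 5 equal, and Q = 0 adds those of 0 and
    1. So v is a multiple of a node, where L is nonzero. *)
Lemma first_synthemes_disjoint m m' v :
  m \in first_synthemes -> m' \in first_synthemes -> m != m' ->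
  on_plane m v -> on_plane m' v -> polar_L v = 0 -> polar_Q v = 0 -> v = 0.
Proof.
move=> m_f m'_f mm' vm vm' L0 Q0.
have v01 := first_syntheme01 m_f vm.
have v1 : p 1 v = 0 by exact: (on_plane_sum1 (first_syntheme_perm m_f) vm).
have sq i j : entry v i + entry v j = 0 -> entry v j ^+ 2 = entry v i ^+ 2.
  by move/eqP; rewrite addr_eq0 => /eqP->; rewrite sqrrN.
have [s3 s4 s5] : [/\ entry v 3 ^+ 2 = entry v 2 ^+ 2, entry v 4 ^+ 2 = entry v 2 ^+ 2 &
    entry v 5 ^+ 2 = entry v 2 ^+ 2].
  have v1m := vm 1%N erefl; have v2m := vm 2%N erefl.
  have v1m' := vm' 1%N erefl; have v2m' := vm' 2%N erefl.
  move: m_f m'_f mm' v1m v2m v1m' v2m'; rewrite !inE.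
  by move=> /or3P[]/eqP-> /or3P[]/eqP-> //= _ /sq E1 /sq E2 /sq E3 /sq E4;
     split; congruence.
have s1 := sq _ _ v01.
have Q01 : (entry v 0 ^+ 2 - entry v 2 ^+ 2) * (entry P 0 + entry P 1) = 0.
  rewrite -[RHS]Q0 /polar_Q sum6 -!/(entry _ _) s1 s3 s4 s5.
  have -> : entry P 0 = - (entry P 1 + entry P 2 + entry P 3 + entry P 4 + entry P 5).
    apply/eqP; rewrite -addr_eq0 -[X in _ == X]P1 /power_sum sum6 /entry; apply/eqP; ring.
  ring.
have s02 : entry v 0 ^+ 2 = entry v 2 ^+ 2.
  have P01 : entry P 0 + entry P 1 != 0 by apply: offP; rewrite -val_eqE /= !inordK.
  by move/eqP: Q01; rewrite mulf_eq0 (negPf P01) orbF subr_eq0 => /eqP.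
have vsq j : v 0 j ^+ 2 = entry v 2 ^+ 2.
  rewrite -[j]inord_val -/(entry _ _); case: j => -[|[|[|[|[|[|]]]]]] //= _; congruence.
have [b b_s [k vE]] := node_of_square v1 vsq.
move: L0; rewrite vE polar_L_scale => /eqP.
by rewrite mulf_eq0 (negPf (polar_L_node b_s)) orbF => /eqP->; rewrite scale0r.
Qed.

End Center.

(** * Points of the double lines, and critical points of the tangent section *)

Section Scale.
Variable K : numClosedFieldType.
Implicit Types (x y : 'rV[K]_6) (m : seq nat).
Local Notation p := power_sum.

Lemma segre_dual_scale k x : segre_dual (k *: x) = k ^+ 2 *: segre_dual x.
Proof. by apply/rowP=> j; rewrite !mxE power_sum_scale; field. Qed.

Lemma igusa_dual_scale k x : igusa_dual (k *: x) = k ^+ 3 *: igusa_dual x.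
Proof. by apply/rowP=> j; rewrite !mxE !power_sum_scale; field. Qed.

Lemma igusa_scale k x : igusa (k *: x) = k ^+ 4 * igusa x.
Proof. by rewrite /igusa !power_sum_scale; ring. Qed.

Lemma dot_segre_dual x : p 1 x = 0 -> p 3 x = 0 -> dot (segre_dual x) x = 0.
Proof.
move=> x1 x3; transitivity (p 3 x - p 2 x / 6%:R * p 1 x); last by rewrite x1 x3; ring.
by rewrite /dot sum6 !mxE /power_sum !sum6; field.
Qed.

Definition paired_vector m (a b c : K) : 'rV[K]_6 :=
  arrange m [:: a; b; c; a; b; c].

Lemma paired_vectorE m a b c k : perm_eq m (iota 0 6) -> (k < 6)%N ->
  paired_vector m a b c 0 (inord (nth 0%N m k)) = nth 0 [:: a; b; c; a; b; c] k.
Proof. exact: arrangeE. Qed.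

Lemma paired_vectorP m x : perm_eq m (iota 0 6) -> paired m x ->
  x = paired_vector m (entry x (nth 0%N m 0)) (entry x (nth 0%N m 1)) (entry x (nth 0%N m 2)).
Proof.
move=> m_perm xm; apply: (row_perm_ext m_perm) => k k_lt.
rewrite {2}/entry paired_vectorE //.
have x0 := xm 0%N erefl; have x1 := xm 1%N erefl; have x2 := xm 2%N erefl.
by case: k k_lt => [|[|[|[|[|[|]]]]]] //= _; rewrite ?x0 ?x1 ?x2.
Qed.

Lemma scale_paired_vector m k a b c : perm_eq m (iota 0 6) ->
  k *: paired_vector m a b c = paired_vector m (k * a) (k * b) (k * c).
Proof.
move=> m_perm; apply: (row_perm_ext m_perm) => i i_lt; rewrite /entry mxE !paired_vectorE //.
by case: i i_lt => [|[|[|[|[|[|]]]]]].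
Qed.

Lemma power_sum_paired m a b c i : perm_eq m (iota 0 6) ->
  p i (paired_vector m a b c) = 2%:R * (a ^+ i + b ^+ i + c ^+ i).
Proof.
move=> m_perm; rewrite /power_sum (sum_perm _ m_perm) !(paired_vectorE _ _ _ m_perm) //=; ring.
Qed.

Lemma igusa_dual_paired m a b c : perm_eq m (iota 0 6) -> a + b + c = 0 ->
  igusa_dual (paired_vector m a b c) = 0.
Proof.
move=> m_perm abc; have -> : c = - (a + b) by apply/eqP; rewrite -addr_eq0 addrC abc.
apply: (row_perm_ext m_perm) => i i_lt; rewrite /entry [LHS]mxE [RHS]mxE paired_vectorE //.
rewrite !power_sum_paired //.
by case: i i_lt => [|[|[|[|[|[|]]]]]] //= _; field.
Qed.

End Scale.

Arguments paired_vectorE {K m a b c k}.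

(** The residue modulo 3 of a position names its duad. *)
Lemma syntheme_mismatch m m' : m \in synthemes -> m' \in synthemes -> m != m' ->
  exists k a b, [/\ (k < 3)%N, (a < 6)%N, (b < 6)%N, (a %% 3 != b %% 3)%N &
    nth 0%N m k = nth 0%N m' a /\ nth 0%N m (k + 3) = nth 0%N m' b].
Proof.
have : all (fun m => all (fun m' => (m == m') || has (fun k => has (fun a => has (fun b =>
    [&& a %% 3 != b %% 3, nth 0 m k == nth 0 m' a & nth 0 m (k + 3) == nth 0 m' b])
  (iota 0 6)) (iota 0 6)) (iota 0 3)) synthemes)%N synthemes by vm_compute.
move=> /allP H /H/allP H' /H'/orP[->//|/hasP[k]].
rewrite mem_iota => k_lt /hasP[a]; rewrite mem_iota => a_lt /hasP[b]; rewrite mem_iota.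
by move=> b_lt /and3P[ab /eqP mk /eqP mk3] _; exists k, a, b.
Qed.

Section Center.
Variables (K : numClosedFieldType) (P : 'rV[K]_6).
Implicit Types (x y v w : 'rV[K]_6) (m : seq nat).
Local Notation p := power_sum.
Hypotheses (P1 : p 1 P = 0) (P3 : p 3 P = 0).
Hypothesis offP : forall i j : 'I_6, i != j -> P 0 i + P 0 j != 0.

(* The point where the double line {y_(m_k) = y_(m_(k+3)), k < 3} of the Igusa
   quartic meets the hyperplane orthogonal to P. *)
Definition syntheme_point m : 'rV[K]_6 :=
  paired_vector m (duad_sum P m 1 - duad_sum P m 2) (duad_sum P m 2 - duad_sum P m 0)
    (duad_sum P m 0 - duad_sum P m 1).

Section Syntheme.
Variable m : seq nat.
Hypothesis m_perm : perm_eq m (iota 0 6).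
Local Notation X := (duad_sum P m 0).
Local Notation Y := (duad_sum P m 1).
Local Notation Z := (duad_sum P m 2).

Let Z_E : Z = - (X + Y).
Proof. by apply/eqP; rewrite -addr_eq0 addrC (duad_sum0 P1 m_perm). Qed.

Lemma power_sum1_point : p 1 (syntheme_point m) = 0.
Proof. rewrite power_sum_paired //; ring. Qed.

Lemma igusa_dual_syntheme_point : igusa_dual (syntheme_point m) = 0.
Proof. by apply: igusa_dual_paired => //; ring. Qed.

Lemma dot_paired (a b c : K) : dot (paired_vector m a b c) P = a * X + b * Y + c * Z.
Proof.
rewrite /dot (sum_perm _ m_perm) !(paired_vectorE m_perm) //= /duad_sum /=; ring.
Qed.

Lemma dot_point : dot (syntheme_point m) P = 0.
Proof. by rewrite dot_paired; ring. Qed.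

Let diff_neq0 : X + 2%:R * Y = 0 -> 2%:R * X + Y != 0.
Proof.
move=> E1; apply/eqP => E2; have := duad_sum_neq0 offP m_perm (erefl : (0 < 3)%N).
have : 3%:R * X = 0.
  transitivity (2%:R * (2%:R * X + Y) - (X + 2%:R * Y)); first ring.
  by rewrite E1 E2 mulr0 subr0.
by move/eqP; rewrite mulf_eq0 pnatr_eq0 /= => ->.
Qed.

Lemma point_values_distinct i j : (i < 6)%N -> (j < 6)%N -> (i %% 3 != j %% 3)%N ->
  syntheme_point m 0 (inord (nth 0%N m i)) != syntheme_point m 0 (inord (nth 0%N m j)).
Proof.
have XYZ k : (k < 3)%N -> 3%:R * duad_sum P m k != 0.
  by move=> k_lt; rewrite mulf_neq0 ?pnatr_eq0 // (duad_sum_neq0 offP).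
have X0 := XYZ 0%N erefl; have Y0 := XYZ 1%N erefl; have Z0 := XYZ 2%N erefl.
have XY : Y - Z != Z - X.
  have E : Y - Z - (Z - X) = - (3%:R * Z) by rewrite Z_E; ring.
  by rewrite -subr_eq0 E oppr_eq0.
have YZ : Z - X != X - Y.
  have E : Z - X - (X - Y) = - (3%:R * X) by rewrite Z_E; ring.
  by rewrite -subr_eq0 E oppr_eq0.
have XZ : Y - Z != X - Y.
  have E : Y - Z - (X - Y) = 3%:R * Y by rewrite Z_E; ring.
  by rewrite -subr_eq0 E.
move=> i_lt j_lt; rewrite !(paired_vectorE m_perm) //.
case: i i_lt => [|[|[|[|[|[|]]]]]] //= _; case: j j_lt => [|[|[|[|[|[|]]]]]] //= _ _;
  by rewrite // eq_sym.
Qed.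


Lemma point_neq0 : syntheme_point m != 0.
Proof.
apply: contra_neq (@point_values_distinct 0 1 erefl erefl erefl) => ->.
by rewrite !mxE.
Qed.

Lemma paired_point y : paired m y -> p 1 y = 0 -> dot y P = 0 ->
  exists k, y = k *: syntheme_point m.
Proof.
move=> /(paired_vectorP m_perm)->; move: (entry _ _) (entry _ _) (entry _ _) => c b a.
rewrite power_sum_paired // dot_paired => abc l.
have cE : c = - (a + b).
  apply/eqP; rewrite -addr_eq0 addrC; move/eqP: abc.
  by rewrite mulf_eq0 pnatr_eq0 /= !expr1.
have ab : a * (2%:R * X + Y) = - (b * (X + 2%:R * Y)).
  by apply/eqP; rewrite -addr_eq0 -[X in _ == X]l cE Z_E; apply/eqP; ring.
have YZ : Y - Z = X + 2%:R * Y by rewrite Z_E; ring.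
have ZX : Z - X = - (2%:R * X + Y) by rewrite Z_E; ring.
have XYE : X - Y = - (Y - Z) - (Z - X) by ring.
rewrite /syntheme_point cE.
(* The linear equation in (a, b) has coefficients 2 X + Y and X + 2 Y, which cannot both vanish
   since X <> 0. *)
have [E|E] := eqVneq (X + 2%:R * Y) 0.
  have D := diff_neq0 E; have a0 : a = 0.
    by move: ab; rewrite E mulr0 oppr0 => /eqP; rewrite mulf_eq0 (negPf D) orbF => /eqP.
  exists (- b / (2%:R * X + Y)); rewrite scale_paired_vector //.
  by congr paired_vector; rewrite ?XYE ?YZ ?ZX ?E ?a0; field.
exists (a / (X + 2%:R * Y)); rewrite scale_paired_vector //.
have bE : b = - (a * (2%:R * X + Y)) / (X + 2%:R * Y) by rewrite ab; field.
by congr paired_vector; rewrite ?XYE ?YZ ?ZX ?bE; field.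
Qed.

(** Proportionality would make P_i^2 = P_j^2 on each duad, hence P_i = P_j. All differences then
    vanish and [duad_relation] reads X Y Z = 0. *)
Lemma point_not_segre_dual k : segre_dual P <> k *: syntheme_point m.
Proof.
move=> E; have dk i : (i < 3)%N -> duad_diff P m i = 0.
  move=> i_lt; have S0 := duad_sum_neq0 offP m_perm i_lt.
  have : segre_dual P 0 (inord (nth 0%N m i)) = segre_dual P 0 (inord (nth 0%N m (i + 3))).
    have Ej j : (k *: syntheme_point m) 0 j = k * syntheme_point m 0 j by rewrite mxE.
    rewrite E !Ej !(paired_vectorE m_perm) //; try lia.
    by case: i i_lt {S0} => [|[|[|]]].
  rewrite !mxE => /eqP; rewrite -subr_eq0 => /eqP sq.
  have : duad_sum P m i * duad_diff P m i = 0.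
    by rewrite -[RHS]sq /duad_sum /duad_diff; ring.
  by move/eqP; rewrite mulf_eq0 (negPf S0) => /eqP.
have := duad_relation P1 P3 m_perm; rewrite !dk // !expr0n !mulr0 !addr0 => /esym/eqP.
by rewrite oppr_eq0 !mulf_eq0 !(negPf (duad_sum_neq0 offP m_perm _)).
Qed.

End Syntheme.

Lemma points_distinct m m' k : m \in synthemes -> m' \in synthemes ->
  syntheme_point m = k *: syntheme_point m' -> m = m'.
Proof.
move=> m_syn m'_syn E; apply/eqP/negPn/negP => mm'.
have [i [a [b [i_lt a_lt b_lt ab [ma mb]]]]] := syntheme_mismatch m_syn m'_syn mm'.
have mp := syntheme_perm m_syn; have mp' := syntheme_perm m'_syn.
have k0 : k != 0.
  by apply: contra_neq (point_neq0 mp) => k0; rewrite E k0 scale0r.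
have /eqP[] := point_values_distinct mp' a_lt b_lt ab.
apply: (mulfI k0).
have Ej j : k * syntheme_point m' 0 j = syntheme_point m 0 j by rewrite E [RHS]mxE.
rewrite !Ej -ma -mb !(paired_vectorE mp) //; try lia.
by case: i i_lt {ma mb} => [|[|[|]]].
Qed.

Lemma quartic_section_crit y l : p 1 y = 0 -> dot y P = 0 -> igusa_dual y = l *: P ->
  (exists k, y = k *: segre_dual P) \/
  (exists2 m, m \in synthemes & exists k, y = k *: syntheme_point m).
Proof.
move=> y1 yP cy.
have yE : igusa y = 0 by rewrite -dot_igusa_dual // cy dotZl dotC yP mulr0.
have [->|y_neq0] := eqVneq y 0; first by left; exists 0; rewrite scale0r.
have [l0|l_neq0] := eqVneq l 0.
  right; have c0 : igusa_dual y = 0 by rewrite cy l0 scale0r.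
  have [m m_syn my] := igusa_dual_eq0_paired y1 yE y_neq0 c0.
  by exists m => //; apply: paired_point => //; exact: syntheme_perm.
left; have [r] := segre_dual_igusa_dual y1 yE; rewrite cy segre_dual_scale => E.
have r_neq0 : r != 0.
  apply/eqP => r0; move/eqP: E; rewrite r0 scale0r scaler_eq0 expf_eq0 /= (negPf l_neq0).
  by apply/negP; exact: segre_dual_center_neq0.
by exists (r^-1 * l ^+ 2); rewrite -scalerA E scalerA mulVf // scale1r.
Qed.

End Center.

(** * Coordinates on P^4 and its dual *)

Section Derivation.
Variables (K : numClosedFieldType) (n : nat).
Implicit Types (F G : {mpoly K[n]}) (p v l : 'rV[K]_n).

Lemma dgradD F G p v : dgrad (F + G) p v = dgrad F p v + dgrad G p v.
Proof. by rewrite -!deriv_line lineD derivD hornerD. Qed.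

Lemma dgradZ c F p v : dgrad (c *: F) p v = c * dgrad F p v.
Proof.
rewrite /dgrad mulr_sumr; apply: eq_bigr => i _.
by rewrite mderivZ mevalZ mulrCA.
Qed.

Lemma dgrad_sum I (r : seq I) (F : I -> {mpoly K[n]}) p v :
  dgrad (\sum_(i <- r) F i) p v = \sum_(i <- r) dgrad (F i) p v.
Proof.
elim: r => [|i r IH]; last by rewrite !big_cons dgradD IH.
by rewrite !big_nil /dgrad big1 // => i _; rewrite mderiv0 meval0 mulr0.
Qed.

Lemma dgrad_exp F k p v :
  dgrad (F ^+ k.+1) p v = k.+1%:R * F.@[p 0] ^+ k * dgrad F p v.
Proof.
elim: k => [|k IH]; first by rewrite expr1 expr0 !mul1r.
by rewrite exprS dgradM IH rmorphXn [X in _ = X * _ * _]mulrS exprS; ring.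
Qed.

Lemma row_dot_ext (u v : 'rV[K]_n) : (forall w, dot w u = dot w v) -> u = v.
Proof. by move=> uv; apply/rowP=> i; rewrite -!dot_delta. Qed.

End Derivation.

Lemma dot_mulmx (K : fieldType) m n (M : 'M[K]_(m, n)) (u : 'rV_m) (v : 'rV_n) :
  dot (u *m M) v = dot u (v *m M^T).
Proof.
suff /matrixP/(_ 0 0) : (dot (u *m M) v)%:M = (dot u (v *m M^T))%:M :> 'M_1 by rewrite !mxE.
by rewrite -!mul_trE trmx_mul trmxK mulmxA.
Qed.

Section Forms.
Variables (K : numClosedFieldType) (n : nat) (M : 'M[K]_(n, 6)).
Implicit Types (h v : 'rV[K]_n).

(** M will be [B] for the cubic, its dual basis for the quartic, and the last four rows of that
    basis for the tangent section. *)
Definition coord_form (j : 'I_6) : {mpoly K[n]} := linear_form (col j M)^T.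
Definition cubic_poly : {mpoly K[n]} := \sum_j coord_form j ^+ 3.
Definition quartic_poly : {mpoly K[n]} :=
  (\sum_j coord_form j ^+ 2) ^+ 2 + (- 4%:R) *: (\sum_j coord_form j ^+ 4).

Lemma dot_col h j : dot h (col j M)^T = (h *m M) 0 j.
Proof. by rewrite /dot mxE; apply: eq_bigr => i _; rewrite !mxE. Qed.

Lemma meval_coord_form h j : (coord_form j).@[h 0] = (h *m M) 0 j.
Proof. by rewrite meval_linear_form dot_col. Qed.

Lemma meval_sum_coord k h : (\sum_j coord_form j ^+ k).@[h 0] = power_sum k (h *m M).
Proof.
rewrite raddf_sum; apply: eq_bigr => j _.
by rewrite /= rmorphXn /= meval_coord_form.
Qed.

Lemma meval_cubic h : cubic_poly.@[h 0] = power_sum 3 (h *m M).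
Proof. exact: meval_sum_coord. Qed.

Lemma meval_quartic h : quartic_poly.@[h 0] = igusa (h *m M).
Proof.
by rewrite /quartic_poly mevalD mevalZ rmorphXn /= !meval_sum_coord /igusa mulNr.
Qed.

Lemma sum_coord_homog k : \sum_j coord_form j ^+ k \is k.-homog.
Proof.
apply: rpred_sum => j _; have := dhomogMn k (linear_form_homog (col j M)^T).
by rewrite mul1n.
Qed.

Lemma cubic_homog : cubic_poly \is 3.-homog.
Proof. exact: sum_coord_homog. Qed.

Lemma quartic_homog : quartic_poly \is 4.-homog.
Proof.
apply: rpredD; last by apply: rpredZ; exact: sum_coord_homog.
exact: (dhomogMn 2 (sum_coord_homog 2)).
Qed.

Lemma dgrad_sum_coord k h v : dgrad (\sum_j coord_form j ^+ k.+1) h v =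
  k.+1%:R * \sum_j (h *m M) 0 j ^+ k * (v *m M) 0 j.
Proof.
rewrite dgrad_sum mulr_sumr; apply: eq_bigr => j _.
by rewrite dgrad_exp meval_coord_form dgrad_linear_form dot_col mulrA.
Qed.

(** The rows of M have sum zero, so constant vectors are invisible and the gradient may be replaced
    by its centred version. *)
Lemma grad_cubic h (c : K) :
  const_mx c *m M^T = 0 :> 'rV_n ->
  c = power_sum 2 (h *m M) / 6%:R ->
  grad cubic_poly h = 3%:R *: (segre_dual (h *m M) *m M^T).
Proof.
move=> cM cE; apply: row_dot_ext => v; rewrite -dgrad_dot dgrad_sum_coord.
rewrite dotZr -dot_mulmx; congr (_ * _).
have <- : dot (v *m M) (segre_dual (h *m M) + const_mx c) = dot (v *m M) (segre_dual (h *m M)).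
  by rewrite dotDr [X in _ + X]dot_mulmx cM [X in _ + X]dotC dot0l addr0.
apply: eq_bigr => j _; rewrite [(segre_dual _ + _) 0 j]mxE [const_mx c 0 j]mxE cE.
by rewrite [segre_dual _ 0 j]mxE subrK mulrC.
Qed.

Lemma grad_quartic h (c : K) :
  const_mx c *m M^T = 0 :> 'rV_n ->
  c = - (2%:R / 3%:R * power_sum 3 (h *m M)) ->
  grad quartic_poly h = 4%:R *: (igusa_dual (h *m M) *m M^T).
Proof.
move=> cM cE; apply: row_dot_ext => v; rewrite -dgrad_dot dgradD dgradZ dgrad_exp.
rewrite !dgrad_sum_coord dotZr -dot_mulmx meval_sum_coord.
have <- : dot (v *m M) (igusa_dual (h *m M) + const_mx c) = dot (v *m M) (igusa_dual (h *m M)).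
  by rewrite dotDr [X in _ + X]dot_mulmx cM [X in _ + X]dotC dot0l addr0.
rewrite expr1 /dot.
transitivity (4%:R * (power_sum 2 (h *m M) * (\sum_j (h *m M) 0 j ^+ 1 * (v *m M) 0 j)
  - 4%:R * (\sum_j (h *m M) 0 j ^+ 3 * (v *m M) 0 j))); first by ring.
congr (_ * _); rewrite !mulr_sumr -sumrB; apply: eq_bigr => j _.
rewrite [(igusa_dual _ + _) 0 j]mxE [const_mx c 0 j]mxE cE [igusa_dual _ 0 j]mxE; ring.
Qed.

Definition difference_form (ij : 'I_6 * 'I_6) : {mpoly K[n]} :=
  coord_form ij.1 - coord_form ij.2.

(** N is a product of coordinate differences; it is constant along v because v has equal coordinates
    on the chosen pairs. *)
Lemma radical_differences d (f : {mpoly K[n]}) v (r : seq ('I_6 * 'I_6)) :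
  f \is d.-homog -> f.@[v 0] != 0 ->
  (forall ij, ij \in r -> (v *m M) 0 ij.1 = (v *m M) 0 ij.2) ->
  (forall ij, ij \in r -> exists h, (h *m M) 0 ij.1 != (h *m M) 0 ij.2) ->
  (forall p, grad f p = 0 -> exists2 ij, ij \in r & (p *m M) 0 ij.1 = (p *m M) 0 ij.2) ->
  radical_form f.
Proof.
move=> hf fv vr r_neq crit.
have evalN h : (\prod_(ij <- r) difference_form ij).@[h 0] =
    \prod_(ij <- r) ((h *m M) 0 ij.1 - (h *m M) 0 ij.2).
  rewrite rmorph_prod; apply: eq_bigr => ij _.
  by rewrite /= mevalB !meval_coord_form.
apply: (@radical_crit _ _ d f v (\prod_(ij <- r) difference_form ij)) => //.
- rewrite prodf_seq_neq0; apply/allP => ij /r_neq[h h_neq]; apply/implyP => _.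
  apply: contra_neq h_neq => ij0; apply/eqP; rewrite -subr_eq0.
  by rewrite -!meval_coord_form -mevalB -/(difference_form ij) ij0 meval0.
- move=> a t; rewrite !evalN; apply: eq_big_seq => ij /vr E.
  have lin k : ((a + t *: v) *m M) 0 k = (a *m M) 0 k + t * (v *m M) 0 k.
    by rewrite mulmxDl -scalemxAl [LHS]mxE [X in _ + X]mxE.
  by rewrite !lin E; ring.
move=> p /crit[ij ij_r E]; rewrite evalN; apply/eqP; rewrite prodf_seq_eq0; apply/hasP.
by exists ij => //=; rewrite E subrr.
Qed.

End Forms.

(** * The basis [B], its dual, and radicality of the cubic and the quartic *)

Section Coordinates.
Variables (K : numClosedFieldType) (P : 'rV[K]_6) (B : 'M[K]_(1 + 4, 6)).
Local Notation p := power_sum.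
Hypotheses (P1 : p 1 P = 0) (P3 : p 3 P = 0).
Hypothesis offP : forall i j : 'I_6, i != j -> P 0 i + P 0 j != 0.
Hypothesis B_coord : coordinates_at P B.

Let B_free : row_free B. Proof. by have [] := B_coord. Qed.
Lemma coord_sum1 y : p 1 (y *m B) = 0. Proof. by have [_ + _] := B_coord; apply. Qed.
Let B_base : base_point K *m B = P. Proof. by have [] := B_coord. Qed.

Lemma power_sum1D (u v : 'rV[K]_6) : p 1 (u + v) = p 1 u + p 1 v.
Proof. by rewrite !power_sum1E -big_split; apply: eq_bigr => j _; rewrite mxE. Qed.

Lemma mul_const_col (v : 'rV[K]_6) : v *m const_mx 1 = (p 1 v)%:M :> 'M_1.
Proof.
apply/matrixP=> i j; rewrite !ord1 !mxE power_sum1E mulr1n.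
by apply: eq_bigr => k _; rewrite mxE mulr1.
Qed.

Lemma exists_coord v : p 1 v = 0 -> exists y, v = y *m B.
Proof.
move=> v1; pose Z : 'M[K]_(6, 1) := const_mx 1.
have BZ : (B <= kermx Z)%MS.
  apply/sub_kermxP; apply/row_matrixP => i.
  by rewrite row_mul mul_const_col rowE coord_sum1 raddf0 row0.
have Z_neq0 : Z != 0.
  by apply/eqP => /matrixP/(_ 0 0)/eqP; rewrite !mxE oner_eq0.
have rkZ : (0 < \rank Z)%N by rewrite lt0n mxrank_eq0.
have : (kermx Z <= B)%MS.
  rewrite -(mxrank_leqif_sup BZ).2 eqn_leq (mxrank_leqif_sup BZ).1 /=.
  by rewrite mxrank_ker (eqnP B_free); lia.
have vZ : (v <= kermx Z)%MS by apply/sub_kermxP; rewrite mul_const_col v1 raddf0.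
by move=> /(submx_trans vZ)/submxP.
Qed.

(** The bilinear form has isotropic vectors, but it is nondegenerate on s_1 = 0: a vector orthogonal
    to that hyperplane is constant, and six equal coordinates with sum zero vanish. *)
Lemma gram_unit : B *m B^T \in unitmx.
Proof.
rewrite -row_free_unit -kermx_eq0; apply/rowV0P => z /sub_kermxP zG.
apply: (row_free_inj B_free); rewrite mul0mx.
have orth w : p 1 w = 0 -> dot w (z *m B) = 0.
  by move=> /exists_coord[y ->]; rewrite dot_mulmx -mulmxA zG dotC dot0l.
have const := orthogonal_const orth.
apply/rowP => j; rewrite [RHS]mxE.
have := coord_sum1 z; rewrite power_sum1E (eq_bigr (fun=> (z *m B) 0 j)) => [|i _ //].
by rewrite sumr_const card_ord => /eqP; rewrite mulrn_eq0 /= => /eqP.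
Qed.

(* Rows form the basis of V dual to the rows of B, so that a hyperplane with
   coordinates h is the point h *m dual_coord of V. *)
Definition dual_coord : 'M[K]_(1 + 4, 6) := invmx (B *m B^T) *m B.
Local Notation C := dual_coord.

Lemma mul_dual_coord : C *m B^T = 1%:M.
Proof. by rewrite /C -mulmxA mulVmx // gram_unit. Qed.

Lemma mul_coord_dual : B *m C^T = 1%:M.
Proof. by rewrite -[B]trmxK -trmx_mul mul_dual_coord trmx1. Qed.

Lemma dual_coord_sum1 h : p 1 (h *m C) = 0.
Proof. by rewrite mulmxA coord_sum1. Qed.

Lemma coord_dualK v : p 1 v = 0 -> v *m C^T *m B = v.
Proof. by move=> /exists_coord[y ->]; rewrite -(mulmxA y) mul_coord_dual mulmx1. Qed.

Lemma dual_coordK v : p 1 v = 0 -> v *m B^T *m C = v.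
Proof.
move=> /exists_coord[y ->]; rewrite /C -!mulmxA [B *m (B^T *m _)]mulmxA.
by rewrite [B *m B^T *m (_ *m _)]mulmxA mulmxV ?gram_unit // mul1mx.
Qed.

Lemma dot_dual y h : dot (y *m B) (h *m C) = dot y h.
Proof. by rewrite dot_mulmx -mulmxA [in C *m B^T]mul_dual_coord mulmx1. Qed.

Lemma const_mul_sum1 n (M : 'M[K]_(n, 6)) (c : K) :
  (forall y : 'rV[K]_n, p 1 (y *m M) = 0) -> const_mx c *m M^T = 0 :> 'rV_n.
Proof.
move=> M1; apply/rowP => i; rewrite [RHS]mxE -dot_delta.
rewrite -dot_mulmx dotC; transitivity (c * p 1 (delta_mx 0 i *m M)); last by rewrite M1 mulr0.
rewrite power_sum1E mulr_sumr.
by apply: eq_bigr => j _; rewrite [const_mx c 0 j]mxE.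
Qed.

Lemma grad_segre y : grad (cubic_poly B) y = 3%:R *: (segre_dual (y *m B) *m B^T).
Proof. by apply: grad_cubic; [apply: const_mul_sum1 coord_sum1 | reflexivity]. Qed.

Lemma grad_igusa h : grad (quartic_poly C) h = 4%:R *: (igusa_dual (h *m C) *m C^T).
Proof. by apply: grad_quartic; [apply: const_mul_sum1 dual_coord_sum1 | reflexivity]. Qed.

Lemma grad_igusa_mul h : grad (quartic_poly C) h *m B = 4%:R *: igusa_dual (h *m C).
Proof.
by rewrite grad_igusa -scalemxAl coord_dualK // power_sum_igusa_dual1 // dual_coord_sum1.
Qed.

Lemma delta_sub_sum1 (i j : 'I_6) :
  p 1 (delta_mx 0 i - delta_mx 0 j : 'rV[K]_6) = 0.
Proof.
have one k : p 1 (delta_mx 0 k : 'rV[K]_6) = 1.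
  rewrite power_sum1E (bigD1 k) //= big1 => [|l lk]; rewrite mxE ?eqxx ?addr0 //.
  by rewrite (negPf lk) andbF.
rewrite power_sum1D one -scaleN1r power_sum_scale one; ring.
Qed.

Lemma delta_sub_neq (i j : 'I_6) : i != j ->
  (delta_mx 0 i - delta_mx 0 j : 'rV[K]_6) 0 i != (delta_mx 0 i - delta_mx 0 j : 'rV[K]_6) 0 j.
Proof.
move=> ij; have ji : (j == i) = false by rewrite eq_sym (negPf ij).
rewrite !mxE !eqxx /= ?(negPf ij) ?ji subr0 sub0r.
by rewrite -subr_eq0 opprK -mulr2n pnatr_eq0.
Qed.

Lemma radical_segre : radical_form (cubic_poly B).
Proof.
(* The vector (1, 1, -2, 0, 0, 0) has s_1 = 0, s_3 = -6 and equal last coordinates. At a critical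
   point the coordinates agree up to sign, so two of the last three are equal. *)
pose v : 'rV[K]_6 := \row_j nth 0 [:: 1; 1; - 2%:R] j.
have vE k : (k < 6)%N -> v 0 (inord k) = nth 0 [:: 1; 1; - 2%:R] k.
  by move=> k_lt; rewrite mxE inordK.
have [y yE] : exists y, v = y *m B.
  by apply: exists_coord; rewrite power_sum1E sum6 !vE //=; ring.
apply: (@radical_differences _ _ B 3 (cubic_poly B) y
  [:: (inord 3, inord 4); (inord 3, inord 5); (inord 4, inord 5)]).
- exact: cubic_homog.
- rewrite meval_cubic -yE /power_sum sum6 !vE //=.
  have -> : 1 ^+ 3 + 1 ^+ 3 + (- 2%:R) ^+ 3 + 0 ^+ 3 + 0 ^+ 3 + 0 ^+ 3 = - 6%:R :> K by ring.
  by rewrite oppr_eq0 pnatr_eq0.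
- by move=> ij; rewrite -yE !inE => /or3P[]/eqP-> /=; rewrite !vE.
- move=> ij ij_r; have [h hE] := exists_coord (delta_sub_sum1 ij.1 ij.2).
  exists h; rewrite -hE; apply: delta_sub_neq.
  by move: ij_r; rewrite !inE => /or3P[]/eqP-> /=; rewrite -val_eqE /= !inordK.
move=> q; rewrite grad_segre => /eqP; rewrite scaler_eq0 pnatr_eq0 /= => /eqP sq0.
have {}sq0 : segre_dual (q *m B) = 0.
  by rewrite -[LHS]dual_coordK ?power_sum_segre_dual1 // sq0 mul0mx.
have sq j : (q *m B) 0 j ^+ 2 = (q *m B) 0 (inord 3) ^+ 2.
  have E k : (q *m B) 0 k ^+ 2 = p 2 (q *m B) / 6%:R.
    have := congr1 (fun u : 'rV_6 => u 0 k) sq0; rewrite [LHS]mxE [RHS]mxE => /eqP.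
    by rewrite subr_eq0 => /eqP.
  by rewrite !E.
have /eqP := sq (inord 4); have /eqP := sq (inord 5); rewrite !eqf_sqr.
case/orP=> /eqP E5 /orP[]/eqP E4.
- by exists (inord 3, inord 5); rewrite ?inE ?eqxx ?orbT.
- by exists (inord 3, inord 5); rewrite ?inE ?eqxx ?orbT.
- by exists (inord 3, inord 4); rewrite ?inE ?eqxx ?orbT.
- by exists (inord 4, inord 5); rewrite ?inE ?eqxx ?orbT //= E4 E5.
Qed.

Lemma radical_igusa : radical_form (quartic_poly C).
Proof.
(* The vector (1, -1, 0, 0, 0, 0) has E = -4 and equal coordinates from index 2 on. *)
pose v : 'rV[K]_6 := delta_mx 0 (inord 0) - delta_mx 0 (inord 1).
have v1 : p 1 v = 0 by exact: delta_sub_sum1.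
have vE k : (k < 6)%N -> v 0 (inord k) = nth 0 [:: 1; -1] k.
  move=> k_lt; rewrite !mxE /= -!val_eqE /= !inordK //.
  by case: k k_lt => [|[|[|[|[|[|]]]]]] //= _; rewrite ?subr0 ?sub0r.
pose r := [:: (2, 3); (2, 4); (2, 5); (3, 4); (3, 5); (4, 5)]%N.
pose r' := [seq (inord ij.1, inord ij.2) : 'I_6 * 'I_6 | ij <- r].
have r_spec ij : ij \in r' -> exists i j : nat,
    [/\ (2 <= i)%N, (i < j)%N, (j < 6)%N & ij = (inord i, inord j)].
  case/mapP=> -[i j] ij_r ->; exists i, j; move: ij_r; rewrite !inE;
  by do ![case/orP]; move=> /eqP[-> ->].
apply: (@radical_differences _ _ C 4 (quartic_poly C) (v *m B^T) r').
- exact: quartic_homog.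
- rewrite meval_quartic dual_coordK // /igusa /power_sum !sum6 !vE //=.
  set x := (X in X != 0); have -> : x = - 4%:R by rewrite /x; ring.
  by rewrite oppr_eq0 pnatr_eq0.
- move=> _ /r_spec[i [j [i2 ij j6 ->]]] /=; rewrite dual_coordK // !vE //; try lia.
  by rewrite !nth_default //=; lia.
- move=> _ /r_spec[i [j [i2 ij j6 ->]]] /=.
  exists ((delta_mx 0 (inord i) - delta_mx 0 (inord j)) *m B^T).
  rewrite dual_coordK ?delta_sub_sum1 //; apply: delta_sub_neq.
  by rewrite -val_eqE /= !inordK ?neq_ltn ?ij //; lia.
move=> h gh; have ch : igusa_dual (h *m C) = 0.
  have := grad_igusa_mul h; rewrite gh mul0mx => /esym/eqP.
  by rewrite scaler_eq0 pnatr_eq0 => /eqP.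
have [i [j [i2 ij j6 E]]] := igusa_dual_eq0_coincide ch.
exists (inord i, inord j); last exact: E.
apply/mapP; exists (i, j) => //; move: i2 ij j6.
by case: i {E} => [|[|[|[|[|i]]]]] //; case: j => [|[|[|[|[|[|j]]]]]] //; lia.
Qed.

End Coordinates.

(** * The dual of the cubic is the quartic, and the tangent hyperplane at the dual point *)

Section DualVariety.
Variables (K : numClosedFieldType) (P : 'rV[K]_6) (B : 'M[K]_(1 + 4, 6)).
Local Notation p := power_sum.
Hypotheses (P1 : p 1 P = 0) (P3 : p 3 P = 0).
Hypothesis offP : forall i j : 'I_6, i != j -> P 0 i + P 0 j != 0.
Hypothesis B_coord : coordinates_at P B.
Local Notation C := (dual_coord B).

Let B_free : row_free B. Proof. by have [] := B_coord. Qed.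
Let B_base : base_point K *m B = P. Proof. by have [] := B_coord. Qed.

Lemma base_point_neq0 : base_point K != 0.
Proof.
by apply/eqP => /(congr1 (fun u : 'rV_(1 + 4) => u 0 (lshift 4 0)))/eqP;
   rewrite row_mxEl !mxE oner_eq0.
Qed.

Lemma segre_inE y : y != 0 -> segre_in B y <-> (cubic_poly B).@[y 0] = 0.
Proof.
move=> _; rewrite meval_cubic /segre_in /segre_cubic.
by split=> [[]|E] //; split=> //; exact: (coord_sum1 B_coord).
Qed.

Lemma segre_in_base : segre_in B (base_point K).
Proof. by rewrite /segre_in B_base. Qed.

Lemma segre_tangentE y h : tangent_hyperplane (segre_in B) y h <->
  [/\ y != 0, segre_in B y, h != 0 & exists2 c, c != 0 & h = c *: (segre_dual (y *m B) *m B^T)].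
Proof.
have X_point : exists2 z, z != 0 & segre_in B z.
  by exists (base_point K); [exact: base_point_neq0 | exact: segre_in_base].
rewrite (tangent_hyperplaneE (cubic_homog B) (radical_segre B_coord) segre_inE X_point).
have n3 : 3%:R != 0 :> K by rewrite pnatr_eq0.
split=> -[y0 sy h0 [c c0 hE]]; split=> //.
- exists (c * 3%:R); first by rewrite mulf_neq0.
  by rewrite hE (grad_segre B_coord) scalerA.
- exists (c / 3%:R); first by rewrite mulf_neq0 // invr_eq0.
  by rewrite hE (grad_segre B_coord) scalerA divfK.
Qed.

Lemma igusa_inE h : igusa_in B h <-> (quartic_poly C).@[h 0] = 0.
Proof.
apply: (zariski_closureE (ls := [seq node K b *m C^T | b <- splits]) (quartic_homog C)
   (radical_igusa B_coord)) => //.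
- move=> _ /mapP[b b_s ->].
  have nb1 := node_sum K b_s; split.
    apply/eqP => nC; have := coord_dualK B_coord nb1; rewrite nC mul0mx => /esym.
    exact/eqP/node_neq0.
  have [m m_perm mE] := split_perm b_s.
  (* The entries 1 and -1 fall in the same triple, so y is orthogonal to the node, while E(y) =
     -4. *)
  pose y : 'rV[K]_6 := arrange m [:: 1; -1].
  have yE k : (k < 6)%N -> y 0 (inord (nth 0%N m k)) = nth 0 [:: 1; -1] k.
    exact: arrangeE.
  have y1 : p 1 y = 0 by rewrite power_sum1E (sum_perm _ m_perm) !yE //=; ring.
  exists (y *m B^T).
    rewrite -dot_mulmx (dual_coordK B_coord) // /dot (sum_perm _ m_perm).
    by rewrite !yE // !(node_at m_perm _ mE) //=; ring.
  rewrite meval_quartic (dual_coordK B_coord) // /igusa /power_sum !(sum_perm _ m_perm) !yE //=.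
  set x := (X in X != 0); have -> : x = - 4%:R by rewrite /x; ring.
  by rewrite oppr_eq0 pnatr_eq0.
- move=> {}h [q /segre_tangentE[q0 [q1 q3] h0 [c c0 ->]]].
  rewrite meval_quartic -scalemxAl (dual_coordK B_coord) ?power_sum_segre_dual1 //.
  by rewrite igusa_scale igusa_segre_dual // mulr0.
move=> {}h h0; rewrite meval_quartic => hE off.
set y := h *m C in hE; have y1 : p 1 y = 0 by exact: (dual_coord_sum1 B_coord).
have offy b : b \in splits -> dot y (node K b) != 0.
  by move=> b_s; rewrite /y dot_mulmx; apply: off; apply/mapP; exists b.
have yB : y *m B^T = h by rewrite /y -mulmxA (mul_dual_coord B_coord) mulmx1.
have y0 : y != 0 by apply: contra_neq h0 => y0; rewrite -yB y0 mul0mx.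
have [r rE] := segre_dual_igusa_dual y1 hE.
have c1 := power_sum_igusa_dual1 y1.
have igusa_dual_neq0 : igusa_dual y != 0.
  (* Each double line lies in a trope: 1 and -1 spread over the duads of m form a node, up to sign,
     orthogonal to y. *)
  apply/eqP => c0; have [m /syntheme_perm m_perm my] := igusa_dual_eq0_paired y1 hE y0 c0.
  pose n := syntheme_vector m 1 1 1 : 'rV[K]_6.
  have n1 : p 1 n = 0 by exact: on_plane_sum1 (vector_on_plane _ _ _ m_perm).
  have n2 j : n 0 j ^+ 2 = 1.
    have [k k_lt ->] := perm_cover j m_perm; rewrite syntheme_vectorE //.
    by case: k k_lt => [|[|[|[|[|[|]]]]]] //= _; rewrite ?sqrrN expr1n.
  have [b b_s [k nE]] := node_of_square n1 n2.
  have : k * dot y (node K b) = 0.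
    rewrite -dotZr -nE /dot (sum_perm _ m_perm) !syntheme_vectorE //=.
    have e0 := my 0%N erefl; have e1 := my 1%N erefl; have e2 := my 2%N erefl.
    rewrite /entry /= in e0 e1 e2; rewrite e0 e1 e2; ring.
  move/eqP; rewrite mulf_eq0 (negPf (offy b b_s)) orbF => /eqP k0.
  by have /eqP := n2 ord0; rewrite nE k0 scale0r mxE expr0n eq_sym oner_eq0.
have r0 : r != 0.
  (* If r = 0 the squares of [igusa_dual] y are all equal, so it is a multiple of a node, and Euler
     makes it orthogonal to y. *)
  apply/eqP => r0; rewrite r0 scale0r in rE.
  have c2 j : igusa_dual y 0 j ^+ 2 = p 2 (igusa_dual y) / 6%:R.
    have := congr1 (fun u : 'rV_6 => u 0 j) rE; rewrite [LHS]mxE [RHS]mxE => /eqP.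
    by rewrite subr_eq0 => /eqP.
  have [b b_s [k cE]] := node_of_square c1 c2.
  have : k * dot y (node K b) = 0 by rewrite -dotZr -cE dotC dot_igusa_dual.
  move/eqP; rewrite mulf_eq0 (negPf (offy b b_s)) orbF => /eqP k0.
  by rewrite cE k0 scale0r eqxx in igusa_dual_neq0.
exists (igusa_dual y *m C^T); apply/segre_tangentE.
have qB : igusa_dual y *m C^T *m B = igusa_dual y by exact: (coord_dualK B_coord c1).
split=> //.
- by apply: contra_neq igusa_dual_neq0 => q0; rewrite -qB q0 mul0mx.
- by rewrite /segre_in qB; split; [exact: c1 | exact: power_sum_igusa_dual3].
- exists r^-1; first by rewrite invr_eq0.
  by rewrite qB rE -scalemxAl yB scalerA mulVf // scale1r.
Qed.

Section DualPoint.
Variable P' : 'rV[K]_(1 + 4).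
Hypothesis P'_dual : tangent_hyperplane (segre_in B) (base_point K) P'.

Lemma dual_pointE : exists2 k, k != 0 & P' = k *: (segre_dual P *m B^T).
Proof. by have /segre_tangentE[_ _ _] := P'_dual; rewrite B_base. Qed.

Lemma igusa_at_dual_point : (quartic_poly C).@[(segre_dual P *m B^T) 0] = 0.
Proof.
by rewrite meval_quartic (dual_coordK B_coord) ?power_sum_segre_dual1 // igusa_segre_dual.
Qed.

Lemma dual_point_neq0 : segre_dual P *m B^T != 0.
Proof.
apply/eqP => E; have := dual_coordK B_coord (power_sum_segre_dual1 P).
by rewrite E mul0mx => /esym/eqP; apply/negP; exact: segre_dual_center_neq0.
Qed.

Lemma tangent_hyperplane_dual : tangent_hyperplane (igusa_in B) P' (base_point K).
Proof.
have [k k0 P'E] := dual_pointE.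
have X_point : exists2 z, z != 0 & igusa_in B z.
  exists (segre_dual P *m B^T); first exact: dual_point_neq0.
  by apply/igusa_inE; exact: igusa_at_dual_point.
have XE h (_ : h != 0) := igusa_inE h.
apply/(tangent_hyperplaneE (quartic_homog C) (radical_igusa B_coord) XE X_point).
have P'_C : P' *m C = k *: segre_dual P.
  by rewrite P'E -scalemxAl (dual_coordK B_coord) ?power_sum_segre_dual1.
have [_ _ P'0 _] := P'_dual; split=> //.
- by apply/igusa_inE; rewrite meval_quartic P'_C igusa_scale igusa_segre_dual // mulr0.
- exact: base_point_neq0.
(* The factor 4 comes from the gradient, k^3 from homogeneity and the rest from
   [igusa_dual_segre_dual]; s_5(P) <> 0 as P is off the planes. *)
pose e := 4%:R * k ^+ 3 * (- (4%:R / 5%:R) * p 5 P).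
have e0 : e != 0.
  rewrite !mulf_neq0 ?expf_neq0 ?oppr_eq0 ?mulf_neq0 ?invr_eq0 ?pnatr_eq0 //.
  exact: center_p5.
have gE : grad (quartic_poly C) P' = e *: base_point K.
  apply: (row_free_inj B_free); rewrite (grad_igusa_mul B_coord) P'_C.
  rewrite igusa_dual_scale igusa_dual_segre_dual //.
  by rewrite !scalerA -scalemxAl B_base.
by exists e^-1; rewrite ?invr_eq0 // gE scalerA mulVf // scale1r.
Qed.

Lemma mul_row_dual (h : 'rV[K]_4) : row_mx 0 h *m C = h *m dsubmx C.
Proof. by rewrite -[in LHS](vsubmxK C) mul_row_col mul0mx add0r. Qed.

(** The tangent space at P' is cut out by the base point, and every (0, h) satisfies that
    equation. *)
Lemma tangent_sectionE h : tangent_section B P' h <-> (quartic_poly (dsubmx C)).@[h 0] = 0.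
Proof.
rewrite meval_quartic -mul_row_dual -meval_quartic /tangent_section igusa_inE.
split=> [[]//|E]; split=> //.
have [_ _ _ tE] := tangent_hyperplane_dual; apply/tE.
by rewrite /base_point tr_row_mx mul_row_col mul0mx trmx0 mulmx0 addr0.
Qed.

End DualPoint.
End DualVariety.

(** * Counting projective points *)

Section Counting.
Variables (K : fieldType) (n : nat).
Implicit Types (X Y Z : 'rV[K]_n -> Prop).

Lemma has_exactly_points_union N M X Y Z :
  has_exactly_points N X -> has_exactly_points M Y ->
  (forall x, x != 0 -> Z x <-> X x \/ Y x) ->
  (forall x, x != 0 -> X x -> ~ Y x) ->
  has_exactly_points (N + M) Z.
Proof.
move=> [f [f0 f_inj fX]] [g [g0 g_inj gY]] ZE XY.
have fXi i : X (f i) by apply/fX => //; exists i, 1; rewrite scale1r.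
have gYi i : Y (g i) by apply/gY => //; exists i, 1; rewrite scale1r.
exists (fun k => match split k with inl i => f i | inr j => g j end); split.
- by move=> k; case: (split k).
- move=> k l c; case: (split_ordP k) => i ->; case: (split_ordP l) => j ->.
  + by move=> /f_inj ->.
  + move=> E; case: (XY (f i)) => //; apply/gY => //; by exists j, c.
  + move=> E; case: (XY (g i)) => //; apply/fX => //; by exists j, c.
  + by move=> /g_inj ->.
move=> x x0; rewrite ZE // fX // gY //; split.
- case=> [[i [c ->]]|[j [c ->]]].
    by exists (lshift M i), c; case: split_ordP => [k /lshift_inj->|k /eqP] //; rewrite eq_lrshift.
  by exists (rshift N j), c; case: split_ordP => [k /eqP|k /rshift_inj->] //; rewrite eq_rlshift.
- move=> [k [c ->]]; case: (split k) => i; [left | right]; by exists i, c.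
Qed.

Lemma has_exactly_points_seq (T : eqType) (s : seq T) (F : T -> 'rV[K]_n) X :
  uniq s -> (forall t, t \in s -> F t != 0) ->
  (forall t t' c, t \in s -> t' \in s -> F t = c *: F t' -> t = t') ->
  (forall x, x != 0 -> X x <-> exists2 t, t \in s & exists c, x = c *: F t) ->
  has_exactly_points (size s) X.
Proof.
move=> us F0 F_inj FX; exists (fun i => F (tnth (in_tuple s) i)); split.
- by move=> i; apply: F0; exact: mem_tnth.
- move=> i j c Eij; have E : tnth (in_tuple s) i = tnth (in_tuple s) j.
    by apply: (F_inj _ _ c _ _ Eij); exact: mem_tnth.
  by apply: tuple_uniqP E.
move=> x x0; rewrite FX //; split=> [[t t_s [c xE]]|[i [c xE]]].
  have /tnthP[i tE] : t \in in_tuple s by [].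
  by exists i, c; rewrite -tE.
by exists (tnth (in_tuple s) i); [exact: mem_tnth | exists c].
Qed.

End Counting.

(** * The tangent section and its 16 critical points *)

Section TangentSection.
Variables (K : numClosedFieldType) (P : 'rV[K]_6) (B : 'M[K]_(1 + 4, 6)).
Local Notation p := power_sum.
Hypotheses (P1 : p 1 P = 0) (P3 : p 3 P = 0).
Hypothesis offP : forall i j : 'I_6, i != j -> P 0 i + P 0 j != 0.
Hypothesis B_coord : coordinates_at P B.
Local Notation C := (dual_coord B).
Local Notation C' := (dsubmx (dual_coord B)).

Let B_base : base_point K *m B = P. Proof. by have [] := B_coord. Qed.

Lemma dot_base (y : 'rV[K]_(1 + 4)) : dot y (base_point K) = y 0 (lshift 4 0).
Proof.
rewrite dotC /dot (bigD1 (lshift 4 0)) //= big1 ?addr0 => [|i].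
  by rewrite row_mxEl !mxE mul1r.
rewrite -(splitK i); case: (split i) => j /=; first by rewrite ord1 eqxx.
by rewrite row_mxEr mxE mul0r.
Qed.

Lemma row_mx_head (y : 'rV[K]_(1 + 4)) : y = y 0 (lshift 4 0) *: base_point K + row_mx 0 (rsubmx y).
Proof.
rewrite -{1}[y]hsubmxK scale_row_mx add_row_mx scaler0 add0r addr0; congr row_mx.
by apply/matrixP=> i j; rewrite !ord1 !mxE mulr1.
Qed.

(** Inverse of h |-> h *m C', which identifies the coordinates h with the vectors of s_1 = 0
    orthogonal to P. *)
Definition section_coord (y : 'rV[K]_6) : 'rV[K]_4 := rsubmx (y *m B^T).

Lemma section_coord_row y : dot y P = 0 -> y *m B^T = row_mx 0 (section_coord y).
Proof.
move=> yP; rewrite [LHS]row_mx_head -dot_base [X in X *: _](_ : _ = 0) ?scale0r ?add0r //.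
by rewrite dotC -dot_mulmx B_base dotC.
Qed.

Lemma section_coordK y : p 1 y = 0 -> dot y P = 0 -> section_coord y *m C' = y.
Proof.
move=> y1 yP; rewrite -mul_row_dual -section_coord_row //.
exact: (dual_coordK B_coord y1).
Qed.

Lemma section_sum1 (h : 'rV[K]_4) : p 1 (h *m C') = 0.
Proof. by rewrite -mul_row_dual; exact: (dual_coord_sum1 B_coord). Qed.

Lemma section_dot (h : 'rV[K]_4) : dot (h *m C') P = 0.
Proof.
rewrite -mul_row_dual -B_base dotC (dot_dual B_coord) dotC dot_base.
by rewrite row_mxEl mxE.
Qed.

Lemma section_vectorK (h : 'rV[K]_4) : section_coord (h *m C') = h.
Proof.
by rewrite /section_coord -mul_row_dual -mulmxA (mul_dual_coord B_coord) mulmx1 row_mxKr.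
Qed.

Lemma section_coordZ k y : section_coord (k *: y) = k *: section_coord y.
Proof. by rewrite /section_coord -scalemxAl; apply/rowP=> j; rewrite !mxE. Qed.

Lemma center_dual_tail : P *m C'^T = 0.
Proof.
have : P *m C^T = base_point K by rewrite -B_base -mulmxA (mul_coord_dual B_coord) mulmx1.
rewrite -[in P *m _](vsubmxK C) tr_col_mx mul_mx_row => /eq_row_mx[_ //].
Qed.

Lemma dual_decomposition g : p 1 g = 0 ->
  exists k, g = k *: P + row_mx 0 (g *m C'^T) *m B.
Proof.
move=> g1; exists ((g *m C^T) 0 (lshift 4 0)).
rewrite -[LHS](coord_dualK B_coord g1) {1}[g *m C^T]row_mx_head mulmxDl -scalemxAl B_base.
congr (_ + row_mx 0 _ *m _).
by rewrite -[in LHS](vsubmxK C) tr_col_mx mul_mx_row row_mxKr.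
Qed.

Lemma grad_section h : grad (quartic_poly C') h = 4%:R *: (igusa_dual (h *m C') *m C'^T).
Proof. by apply: grad_quartic; [apply: const_mul_sum1 section_sum1 | reflexivity]. Qed.

(** Lagrange multipliers: the gradient of E must be normal to the hyperplane orthogonal to P. *)
Lemma grad_section_eq0 h : grad (quartic_poly C') h = 0 <->
  exists l, igusa_dual (h *m C') = l *: P.
Proof.
rewrite grad_section; split=> [/eqP|[l ->]]; last first.
  by rewrite -scalemxAl center_dual_tail !scaler0.
rewrite scaler_eq0 pnatr_eq0 /= => /eqP E.
have [l gE] := dual_decomposition (power_sum_igusa_dual1 (section_sum1 h)).
by exists l; rewrite gE E row_mx0 mul0mx addr0.
Qed.

Lemma section_crit h : grad (quartic_poly C') h = 0 <->
  (exists k, h = k *: section_coord (segre_dual P)) \/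
  (exists2 m, m \in synthemes & exists k, h = k *: section_coord (syntheme_point P m)).
Proof.
rewrite grad_section_eq0; split=> [[l E]|].
  have [[k yE]|[m m_s [k yE]]] := quartic_section_crit P1 offP (section_sum1 h) (section_dot h) E.
    by left; exists k; rewrite -section_coordZ -yE section_vectorK.
  by right; exists m => //; exists k; rewrite -section_coordZ -yE section_vectorK.
case=> [[k ->]|[m /syntheme_perm m_perm [k ->]]].
  exists (k ^+ 3 * (- (4%:R / 5%:R) * p 5 P)); rewrite -section_coordZ.
  rewrite section_coordK; first by rewrite igusa_dual_scale igusa_dual_segre_dual // scalerA.
    by rewrite power_sum_scale power_sum_segre_dual1 mulr0.
  by rewrite dotZl dot_segre_dual // mulr0.
exists 0; rewrite -section_coordZ section_coordK ?scale0r.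
- by rewrite igusa_dual_scale igusa_dual_syntheme_point // scaler0.
- by rewrite power_sum_scale power_sum1_point // mulr0.
- by rewrite dotZl dot_point // mulr0.
Qed.

Let section_nodes := section_coord (segre_dual P)
   :: [seq section_coord (syntheme_point P m) | m <- synthemes].

Let section_crit_finite h : grad (quartic_poly C') h = 0 ->
  exists2 c, c \in section_nodes & exists k, h = k *: c.
Proof.
move=> /section_crit[[k ->]|[m m_s [k ->]]].
  by exists (section_coord (segre_dual P)); [rewrite mem_head | exists k].
exists (section_coord (syntheme_point P m)); last by exists k.
by rewrite inE; apply/orP; right; apply/mapP; exists m.
Qed.

Lemma radical_section : radical_form (quartic_poly C').
Proof. exact: (radical_finite_crit _ (quartic_homog C') section_crit_finite). Qed.

Lemma quartic_section_neq0 : quartic_poly C' != 0.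
Proof. exact: (finite_crit_neq0 _ section_crit_finite). Qed.

Lemma section_coord_proportional y z k : p 1 y = 0 -> dot y P = 0 ->
  p 1 z = 0 -> dot z P = 0 -> section_coord y = k *: section_coord z -> y = k *: z.
Proof.
move=> y1 yP z1 zP E; rewrite -[LHS]section_coordK // E -scalemxAl section_coordK //.
Qed.

Lemma section_coord_eq0 y : p 1 y = 0 -> dot y P = 0 -> section_coord y = 0 -> y = 0.
Proof. by move=> y1 yP E; rewrite -[LHS]section_coordK // E mul0mx. Qed.

Lemma section_segre_dual_neq0 : section_coord (segre_dual P) != 0.
Proof.
apply/eqP => /section_coord_eq0 E; have /eqP[] := segre_dual_center_neq0 P1 offP.
by apply: E; [exact: power_sum_segre_dual1 | exact: dot_segre_dual].
Qed.

Lemma section_critical_points :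
  has_exactly_points 16 (fun h => h != 0 /\ grad (quartic_poly C') h = 0).
Proof.
apply: (@has_exactly_points_union _ _ 15 1
  (fun h => exists2 m, m \in synthemes & exists k, h = k *: section_coord (syntheme_point P m))
  (fun h => exists k, h = k *: section_coord (segre_dual P))).
- apply: (@has_exactly_points_seq _ _ _ synthemes
     (fun m => section_coord (syntheme_point P m))) => //.
  + move=> m /syntheme_perm m_perm; apply/eqP => /section_coord_eq0 E.
    have /eqP[] := point_neq0 P1 offP m_perm.
    by apply: E; [exact: power_sum1_point | exact: dot_point].
  + move=> m m' k m_s m'_s /section_coord_proportional E.
    apply: (points_distinct P1 offP m_s m'_s (k := k)); apply: E;
    by rewrite ?dot_point ?power_sum1_point // syntheme_perm.
- apply: (@has_exactly_points_seq _ _ _ [:: tt] (fun=> section_coord (segre_dual P))) => //.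
  + by move=> _ _; exact: section_segre_dual_neq0.
  + by case=> -[].
  move=> h h0; split=> [[k hE]|[_ _ [k hE]]]; [exists tt => // | ]; by exists k.
- move=> h h0; split=> [[_ /section_crit[]]|E]; [by right | by left | split=> //].
  by apply/section_crit; case: E; [right | left].
move=> h h0 [m /syntheme_perm m_perm [k hE]] [l hE'].
have l0 : l != 0 by apply: contra_neq h0 => l0; rewrite hE' l0 scale0r.
apply: (point_not_segre_dual P1 P3 offP m_perm (k := l^-1 * k)).
apply: section_coord_proportional.
- exact: power_sum_segre_dual1.
- exact: dot_segre_dual.
- exact: power_sum1_point.
- exact: dot_point.
by rewrite -scalerA -hE hE' scalerA mulVf // scale1r.
Qed.

End TangentSection.

(** * The discriminant and its dual *)

Section Discriminant.
Variables (K : numClosedFieldType) (P : 'rV[K]_6) (B : 'M[K]_(1 + 4, 6)).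
Local Notation p := power_sum.
Hypotheses (P1 : p 1 P = 0) (P3 : p 3 P = 0).
Hypothesis offP : forall i j : 'I_6, i != j -> P 0 i + P 0 j != 0.
Hypothesis B_coord : coordinates_at P B.
Variables (L Q G : {mpoly K[4]}).
Hypothesis LQG : segre_equation B L Q G.
Local Notation C := (dual_coord B).

Let B_base : base_point K *m B = P. Proof. by have [] := B_coord. Qed.
Let D := L * G - Q ^+ 2.
Implicit Types (x : 'rV[K]_4) (v w z : 'rV[K]_6).

Definition lift_direction (x : 'rV[K]_4) : 'rV[K]_6 := row_mx 0 x *m B.
Local Notation W := lift_direction.
(** The projection with centre P, of which [lift_direction] is a linear section. *)
Definition project_direction (v : 'rV[K]_6) : 'rV[K]_4 := rsubmx (v *m C^T).
Local Notation pr := project_direction.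

Lemma lift_sum1 x : p 1 (W x) = 0.
Proof. exact: (coord_sum1 B_coord). Qed.

Lemma liftD x b : W (x + b) = W x + W b.
Proof. by rewrite /W -mulmxDl add_row_mx addr0. Qed.

Lemma liftZ k x : W (k *: x) = k *: W x.
Proof. by rewrite /W scalemxAl scale_row_mx scaler0. Qed.

Lemma projectZ k v : pr (k *: v) = k *: pr v.
Proof. by rewrite /pr -scalemxAl; apply/rowP=> j; rewrite !mxE. Qed.

Lemma projectD v w : pr (v + w) = pr v + pr w.
Proof. by rewrite /pr mulmxDl; apply/rowP=> j; rewrite !mxE. Qed.

Lemma liftK x : pr (W x) = x.
Proof. by rewrite /pr /W -mulmxA (mul_coord_dual B_coord) mulmx1 row_mxKr. Qed.

Lemma project_center : pr P = 0.
Proof.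
by rewrite /pr -B_base -mulmxA (mul_coord_dual B_coord) mulmx1 row_mxKr.
Qed.

Lemma projectK v : p 1 v = 0 -> exists u, v = u *: P + W (pr v).
Proof.
move=> v1; exists ((v *m C^T) 0 (lshift 4 0)).
rewrite -[LHS](coord_dualK B_coord v1) {1}[v *m C^T]row_mx_head mulmxDl -scalemxAl B_base //.
Qed.

Lemma lift_eq_center x u : W x = u *: P -> x = 0.
Proof. by move=> E; rewrite -[x]liftK E projectZ project_center scaler0. Qed.

Lemma project_shift v u : pr (v + u *: P) = pr v.
Proof. by rewrite projectD projectZ project_center scaler0 addr0. Qed.

Lemma equation_eval x : [/\ L.@[x 0] = 3%:R * polar_L P (W x),
  2%:R * Q.@[x 0] = 3%:R * polar_Q P (W x) & G.@[x 0] = p 3 (W x)].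
Proof.
have [_ _ _ E] := LQG.
have E' u : p 3 (W x) + 3%:R * u * polar_Q P (W x) + 3%:R * u ^+ 2 * polar_L P (W x)
    = L.@[x 0] * u ^+ 2 + Q.@[x 0] * u *+ 2 + G.@[x 0].
  rewrite -E -(power_sum3_shift P3); congr (power_sum 3 _).
  rewrite -B_base scalemxAl -mulmxDl scale_row_mx addrC add_row_mx scaler0 add0r addr0.
  by rewrite scale_scalar_mx mulr1.
(* The values at u = 0, 1 and -1 determine the three coefficients. *)
have E0 := E' 0; have E1 := E' 1; have E2 := E' (-1).
have GE : G.@[x 0] = p 3 (W x).
  transitivity (L.@[x 0] * 0 ^+ 2 + Q.@[x 0] * 0 *+ 2 + G.@[x 0]); first by ring.
  by rewrite -E0; ring.
have two : 2%:R != 0 :> K by rewrite pnatr_eq0.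
split=> //; apply: (mulfI two).
- transitivity ((L.@[x 0] * 1 ^+ 2 + Q.@[x 0] * 1 *+ 2 + G.@[x 0])
    + (L.@[x 0] * (-1) ^+ 2 + Q.@[x 0] * (-1) *+ 2 + G.@[x 0]) - 2%:R * G.@[x 0]).
    by ring.
  by rewrite -E1 -E2 GE; ring.
- transitivity ((L.@[x 0] * 1 ^+ 2 + Q.@[x 0] * 1 *+ 2 + G.@[x 0])
    - (L.@[x 0] * (-1) ^+ 2 + Q.@[x 0] * (-1) *+ 2 + G.@[x 0])).
    by ring.
  by rewrite -E1 -E2; ring.
Qed.

Lemma meval_discriminant x : D.@[x 0] = disc P (W x).
Proof.
have [LE QE GE] := equation_eval x; rewrite mevalB mevalM rmorphXn /= LE GE /disc.
have -> : Q.@[x 0] = 3%:R / 2%:R * polar_Q P (W x).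
  apply: (mulfI (_ : 2%:R != 0)); first by rewrite pnatr_eq0.
  by rewrite QE; field.
by field.
Qed.

Lemma discriminant_homog : D \is 4.-homog.
Proof.
have [hL hQ hG _] := LQG; apply: rpredB; first exact: (dhomogM hL hG).
exact: (dhomogMn 2 hQ).
Qed.

Lemma dgrad_discriminant x b : dgrad D x b = 3%:R * dot (W b) (disc_grad P (W x)).
Proof.
have [g gE <-] := disc_line P (W x) (W b); apply: dgrad_eval => t.
by rewrite meval_discriminant liftD liftZ gE.
Qed.

(** Infinitesimal form of [disc_shift]. *)
Lemma dot_center_disc_grad v : dot P (disc_grad P v) = 0.
Proof.
rewrite dot_disc_grad.
have -> : polar_L P P = 0.
  by rewrite -[RHS]P3; apply: eq_bigr => j _; rewrite -exprSr.
have -> : \sum_j v 0 j ^+ 2 * P 0 j = polar_Q P v by apply: eq_bigr => j _; rewrite mulrC.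
have -> : polar_QQ P v P = polar_L P v.
  by apply: eq_bigr => j _; rewrite expr2 mulrAC.
ring.
Qed.

Lemma grad_discriminant_eq0 x : grad D x = 0 <->
  forall w, p 1 w = 0 -> dot w (disc_grad P (W x)) = 0.
Proof.
split=> [g0 w w1|crit]; last first.
  apply: row_dot_ext => b; rewrite -dgrad_dot dgrad_discriminant crit ?lift_sum1 //.
  by rewrite mulr0 dotC dot0l.
have [u ->] := projectK w1; rewrite dotDl dotZl dot_center_disc_grad mulr0 add0r.
have := dgrad_discriminant x (pr w); rewrite dgrad_dot g0 dotC dot0l => /esym/eqP.
by rewrite mulf_eq0 pnatr_eq0 => /eqP.
Qed.

(** The line through P of direction x lies in the cubic and meets the plane of m, at the point given
    by u; s_3 = 0 follows from that point. *)
Definition line_direction m x :=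
  exists u, [/\ on_plane m (W x + u *: P), polar_L P (W x) = 0 & polar_Q P (W x) = 0].

Lemma line_direction_zero m x : m \in first_synthemes -> line_direction m x ->
  [/\ polar_L P (W x) = 0, polar_Q P (W x) = 0 & p 3 (W x) = 0].
Proof.
move=> /first_syntheme_perm m_perm [u [xm L0 Q0]]; split=> //.
rewrite -(power_sum3_on_plane m_perm xm) (power_sum3_shift P3) L0 Q0; ring.
Qed.

Lemma discriminant_crit x : grad D x = 0 <->
  (exists2 b, b \in splits & exists k, x = k *: pr (node K b)) \/
  (exists2 m, m \in first_synthemes & line_direction m x).
Proof.
rewrite grad_discriminant_eq0; split.
  move=> /(disc_crit P1 P3 offP (lift_sum1 x))[[b b_s [u [k E]]]|[L0 Q0 C0]].
    left; exists b => //; exists k.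
    by rewrite -[LHS]liftK E project_shift projectZ.
  right; have [m m_f [u xm]] := line_on_plane P1 P3 offP (lift_sum1 x) L0 Q0 C0.
  by exists m => //; exists u.
case=> [[b b_s [k ->]] w w1|[m m_f xm] w w1]; last first.
  have [L0 Q0 C0] := line_direction_zero m_f xm.
  by rewrite dot_disc_grad L0 Q0 C0; ring.
have [u nE] := projectK (node_sum K b_s).
have -> : W (k *: pr (node K b)) = k *: node K b + (- (k * u)) *: P.
  by rewrite {2}nE scalerDr scalerA scaleNr addrAC subrr add0r liftZ.
rewrite (disc_grad_shift P3).
have -> : disc_grad P (k *: node K b) = k ^+ 3 *: disc_grad P (node K b).
  by apply/rowP=> j; rewrite !mxE polar_L_scale polar_Q_scale power_sum_scale; ring.
by rewrite dotZr (disc_grad_node P1 b_s) // mulr0.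
Qed.

(** The plane of m misses P, so [pr] is injective on it and carries over the two points of
    [lines_on_plane]. They are not proportional: v = c w would give [polar_QQ] v w = c Q(w) = 0. *)
Lemma line_directions m : m \in first_synthemes ->
  exists a b, [/\ a != 0, b != 0, (forall c, a <> c *: b) &
    forall x, x != 0 -> line_direction m x <-> (exists c, x = c *: a) \/ (exists c, x = c *: b)].
Proof.
move=> m_f; have m_perm := first_syntheme_perm m_f.
have [v [w [vm wm [Lv Lw] [Qv Qw] [Bvw cov]]]] := lines_on_plane P1 P3 offP m_perm.
have sum1 z : on_plane m z -> p 1 z = 0 by exact: on_plane_sum1.
have P01 : entry P 0 + entry P 1 != 0.
  by apply: offP; rewrite -val_eqE /= !inordK.
have center k z : on_plane m z -> z = k *: P -> z = 0.
  move=> zm zE; have := first_syntheme01 m_f zm.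
  rewrite zE /entry !mxE -mulrDr => /eqP; rewrite mulf_eq0 (negPf P01) orbF => /eqP->.
  by rewrite scale0r.
have sub k z z' : on_plane m z -> on_plane m z' -> on_plane m (z + k *: z').
  move=> xm ym i i_lt; have := xm i i_lt; have := ym i i_lt; rewrite /entry !mxE => ye xe.
  by rewrite addrACA xe -mulrDr ye mulr0 addr0.
have v0 : v != 0.
  apply: contraNneq Bvw => ->; rewrite /polar_QQ big1 // => j _.
  by rewrite mxE mulr0 mul0r.
have w0 : w != 0.
  by apply: contraNneq Bvw => ->; rewrite /polar_QQ big1 // => j _; rewrite mxE mulr0.
have pr_eq0 z : on_plane m z -> pr z = 0 -> z = 0.
  move=> zm E; have [u zE] := projectK (sum1 z zm).
  apply: (center u _ zm); rewrite zE E.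
  by rewrite -[0](scale0r 0) liftZ scale0r addr0.
have dirP k z : on_plane m z -> polar_L P z = 0 -> polar_Q P z = 0 ->
    line_direction m (k *: pr z).
  move=> zm Lz Qz; have [u zE] := projectK (sum1 z zm).
  have WE : W (k *: pr z) = k *: z + (- (k * u)) *: P.
    by rewrite {2}zE scalerDr scalerA scaleNr addrAC subrr add0r liftZ.
  exists (k * u); rewrite WE (polar_L_shift P3) (polar_Q_shift P3) polar_L_scale polar_Q_scale.
  rewrite Lz Qz !mulr0 addr0; split=> //.
  rewrite -addrA -scalerDl addNr scale0r addr0 => i i_lt.
  by have := zm i i_lt; rewrite /entry !mxE -mulrDr => ->; rewrite mulr0.
exists (pr v), (pr w); split.
- by apply: contra_neq v0; exact: pr_eq0.
- by apply: contra_neq w0; exact: pr_eq0.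
- move=> c E; have vE : v = c *: w.
    apply/eqP; rewrite -subr_eq0 -scaleNr; apply/eqP; apply: pr_eq0; first exact: sub.
    by rewrite projectD projectZ E scaleNr subrr.
  move/eqP: Bvw; apply; rewrite vE.
  transitivity (c * polar_Q P w); last by rewrite Qw mulr0.
  by rewrite /polar_QQ /polar_Q mulr_sumr; apply: eq_bigr => j _; rewrite !mxE; ring.
move=> x x0; split=> [[u [xm Lx Qx]]|[] [c ->]]; try exact: dirP.
have [||k] := cov _ xm.
- by rewrite (polar_L_shift P3).
- by rewrite (polar_Q_shift P3) Lx Qx; ring.
case=> E; [left | right]; exists k.
  by rewrite -[LHS]liftK -(project_shift (W x) u) E projectZ.
by rewrite -[LHS]liftK -(project_shift (W x) u) E projectZ.
Qed.

(** The line meets x_0 + x_1 = 0 only once, so its points on the two planes coincide. *)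
Lemma line_directions_disjoint m m' x :
  m \in first_synthemes -> m' \in first_synthemes -> m != m' ->
  line_direction m x -> line_direction m' x -> x = 0.
Proof.
move=> m_f m'_f mm' [u [xm L0 Q0]] [u' [xm' _ _]].
have P01 : entry P 0 + entry P 1 != 0 by apply: offP; rewrite -val_eqE /= !inordK.
have E := first_syntheme01 m_f xm; have E' := first_syntheme01 m'_f xm'.
have shiftE t k : entry (W x + t *: P) k = entry (W x) k + t * entry P k.
  by rewrite /entry [LHS]mxE [X in _ + X]mxE.
have uu' : u = u'.
  apply: (mulIf P01); apply: (addrI (entry (W x) 0 + entry (W x) 1)).
  transitivity (entry (W x + u *: P) 0 + entry (W x + u *: P) 1).
    by rewrite !shiftE; ring.
  rewrite E -E' !shiftE; ring.
rewrite -uu' in xm'.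
have z0 : W x + u *: P = 0.
  apply: (first_synthemes_disjoint P1 P3 offP m_f m'_f mm' xm xm').
    by rewrite (polar_L_shift P3).
  by rewrite (polar_Q_shift P3) L0 Q0; ring.
by apply: (@lift_eq_center x (- u)); apply/eqP; rewrite scaleNr -addr_eq0 z0.
Qed.

Lemma project_node_proportional b v k : b \in splits -> p 1 v = 0 ->
  pr (node K b) = k *: pr v -> exists u, node K b = k *: v + u *: P.
Proof.
move=> b_s v1 E; have [u nE] := projectK (node_sum K b_s); have [u' vE] := projectK v1.
have Wv : W (pr v) = v - u' *: P by rewrite {2}vE addrAC subrr add0r.
by exists (u - k * u'); rewrite nE E liftZ Wv scalerBr scalerBl scalerA addrCA.
Qed.

Lemma project_node_neq0 b : b \in splits -> pr (node K b) != 0.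
Proof.
move=> b_s; apply/eqP => E.
have [||u nE] := @project_node_proportional b 0 0 b_s.
- by rewrite power_sum1E big1 // => j _; rewrite mxE.
- by rewrite E scale0r.
have /eqP := polar_L_node P1 P3 offP b_s; apply; rewrite nE (polar_L_shift P3).
by rewrite polar_L_scale mul0r.
Qed.

Lemma nodes_distinct b b' k : b \in splits -> b' \in splits ->
  pr (node K b) = k *: pr (node K b') -> b = b'.
Proof.
move=> b_s b'_s /(project_node_proportional b_s (node_sum K b'_s))[u E].
apply/eqP/negPn/negP => bb'.
(* Take i marked in both splittings, j in neither and l only in the first. Adding the equations at i
   and j gives u (P_i + P_j) = 0, so u = 0; then i gives k = 1 and l gives k = -1. *)
have : all (fun b => all (fun b' => (b == b') || (has (fun i => has (fun j =>
    [&& nth false b i, nth false b' i, ~~ nth false b j & ~~ nth false b' j])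
    (iota 0 6)) (iota 0 6)
    && has (fun i => nth false b i && ~~ nth false b' i) (iota 0 6))) splits) splits
  by vm_compute.
move=> /allP/(_ b b_s)/allP/(_ b' b'_s); rewrite (negPf bb') orFb.
move=> /andP[b_has b'_has].
have [i i_lt b_has'] := hasP b_has; have [j j_lt /and4P[bi b'i bj b'j]] := hasP b_has'.
have [l l_lt /andP[bl b'l]] := hasP b'_has.
rewrite !mem_iota in i_lt j_lt l_lt.
have nE t : node K b 0 t = k * node K b' 0 t + u * P 0 t by rewrite E !mxE.
have coordE t : (t < 6)%N -> (if nth false b t then 1 else -1)
    = k * (if nth false b' t then 1 else -1) + u * P 0 (inord t).
  by move=> t_lt; have := nE (inord t); rewrite !mxE inordK.
have vi := coordE i i_lt; have vj := coordE j j_lt; have vl := coordE l l_lt.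
rewrite bi b'i (negPf bj) (negPf b'j) bl (negPf b'l) in vi vj vl.
have ij : inord i != inord j :> 'I_6.
  apply: contraNneq bj => /(congr1 val); rewrite /= !inordK // => <- //.
have : u * (P 0 (inord i) + P 0 (inord j)) = 0.
  transitivity ((k * 1 + u * P 0 (inord i)) + (k * -1 + u * P 0 (inord j))); first by ring.
  by rewrite -vi -vj subrr.
move/eqP; rewrite mulf_eq0 (negPf (offP ij)) orbF => /eqP u0.
move: vi vl; rewrite u0 !mul0r !addr0 mulr1 mulrN1 => <- /eqP.
by rewrite -subr_eq0 opprK -mulr2n pnatr_eq0.
Qed.

Lemma node_not_line b m k : b \in splits -> m \in first_synthemes -> k != 0 ->
  ~ line_direction m (k *: pr (node K b)).
Proof.
move=> b_s m_f k0 /(line_direction_zero m_f)[L0 _ _].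
have [u nE] := projectK (node_sum K b_s).
have LE : polar_L P (node K b) = polar_L P (W (pr (node K b))).
  by rewrite {1}nE addrC (polar_L_shift P3).
have /eqP := polar_L_node P1 P3 offP b_s; apply; apply: (mulfI k0).
by rewrite mulr0 LE -polar_L_scale -liftZ.
Qed.

Lemma line_directions_count m : m \in first_synthemes ->
  has_exactly_points 2 (line_direction m).
Proof.
move=> /line_directions[a [b [a0 b0 ab lE]]].
apply: (@has_exactly_points_seq _ _ _ [:: true; false] (fun t => if t then a else b)) => //.
- by case.
- case=> -[] c _ _ // E; first by case: (ab c).
  have c0 : c != 0 by apply: contra_neq b0 => c0; rewrite E c0 scale0r.
  by case: (ab c^-1); rewrite E scalerA mulVf // scale1r.
move=> x x0; rewrite lE //; split=> [[]|[[] _]]; last by right.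
- by exists true.
- by exists false.
- by left.
Qed.

Lemma discriminant_critical_points :
  has_exactly_points 16 (fun x => x != 0 /\ grad D x = 0).
Proof.
pose m0 := nth [::] synthemes 0; pose m1 := nth [::] synthemes 1; pose m2 := nth [::] synthemes 2.
have m12 := has_exactly_points_union (line_directions_count (isT : m1 \in first_synthemes))
  (line_directions_count (isT : m2 \in first_synthemes))
  (Z := fun x => line_direction m1 x \/ line_direction m2 x).
have m012 := has_exactly_points_union (line_directions_count (isT : m0 \in first_synthemes))
  (m12 _ _) (Z := fun x => exists2 m, m \in first_synthemes & line_direction m x).
apply: (@has_exactly_points_union _ _ 10 (2 + (2 + 2))
  (fun x => exists2 b, b \in splits & exists k, x = k *: pr (node K b))
  (fun x => exists2 m, m \in first_synthemes & line_direction m x)).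
- apply: (@has_exactly_points_seq _ _ _ splits (fun b => pr (node K b))) => //.
    exact: project_node_neq0.
  exact: nodes_distinct.
- apply: m012.
  + by move=> x _; split.
  + by move=> x /eqP x0 d1 d2; apply: x0; apply: (line_directions_disjoint _ _ _ d1 d2).
  + move=> x _; split=> [[m]|[d|[d|d]]].
    * by rewrite !inE => /or3P[]/eqP->; [left | right; left | right; right].
    * by exists m0.
    * by exists m1.
    * by exists m2.
  + by move=> x /eqP x0 d [] d'; apply: x0; apply: (line_directions_disjoint _ _ _ d d').
- by move=> x x0; rewrite -discriminant_crit; split=> [[]|].
move=> x x0 [b b_s [k xE]] [m m_f]; rewrite xE; apply: node_not_line => //.
by apply: contra_neq x0 => k0; rewrite xE k0 scale0r.
Qed.

Lemma discriminant_crit_finite : exists cs : seq 'rV[K]_4,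
  forall x, grad D x = 0 -> exists2 c, c \in cs & exists k, x = k *: c.
Proof.
have lines (ms : seq (seq nat)) : {subset ms <= first_synthemes} ->
    exists ls : seq 'rV[K]_4, forall m x, m \in ms ->
    line_direction m x -> exists2 c, c \in ls & exists k, x = k *: c.
  elim: ms => [|m ms IH] sub; first by exists [::].
  have sub' : {subset ms <= first_synthemes}.
    by move=> t t_ms; apply: sub; rewrite inE t_ms orbT.
  have [ls lsE] := IH sub'.
  have [a [b [a0 b0 _ lE]]] := line_directions (sub m (mem_head _ _)).
  exists (a :: b :: ls) => m' x; rewrite inE => /orP[/eqP->|m'_ms] xm.
    have [->|x0] := eqVneq x 0; first by exists a; [rewrite mem_head | exists 0; rewrite scale0r].
    have [[k ->]|[k ->]] := (lE x x0).1 xm.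
      by exists a; [rewrite mem_head | exists k].
    by exists b; [rewrite !inE eqxx orbT | exists k].
  have [c c_ls xE] := lsE m' x m'_ms xm.
  by exists c => //; rewrite !inE c_ls !orbT.
have [ls lsE] := lines first_synthemes (fun m m_f => m_f).
exists ([seq pr (node K b) | b <- splits] ++ ls) => x /discriminant_crit[[b b_s xE]|[m m_f xm]].
  by exists (pr (node K b)) => //; rewrite mem_cat; apply/orP; left; apply/mapP; exists b.
by have [c c_ls xE] := lsE m x m_f xm; exists c => //; rewrite mem_cat c_ls orbT.
Qed.

Lemma radical_discriminant : radical_form D.
Proof.
have [cs csE] := discriminant_crit_finite.
exact: (radical_finite_crit _ discriminant_homog csE).
Qed.

Lemma discriminant_neq0 : D != 0.
Proof.
have [cs csE] := discriminant_crit_finite.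
exact: (finite_crit_neq0 _ csE).
Qed.

End Discriminant.

Lemma has_exactly_points_ext (K : fieldType) n N (X Y : 'rV[K]_n -> Prop) :
  (forall x, X x <-> Y x) -> has_exactly_points N X -> has_exactly_points N Y.
Proof.
move=> XY [f [f0 f_inj fX]]; exists f; split=> // x x0.
by rewrite -XY; exact: fX.
Qed.

(** * The two Kummer quartics and their duality *)

Section Duality.
Variables (K : numClosedFieldType) (P : 'rV[K]_6) (B : 'M[K]_(1 + 4, 6)).
Local Notation p := power_sum.
Hypotheses (P1 : p 1 P = 0) (P3 : p 3 P = 0).
Hypothesis offP : forall i j : 'I_6, i != j -> P 0 i + P 0 j != 0.
Hypothesis B_coord : coordinates_at P B.
Variables (L Q G : {mpoly K[4]}).
Hypothesis LQG : segre_equation B L Q G.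
Variable P' : 'rV[K]_(1 + 4).
Hypothesis P'_dual : tangent_hyperplane (segre_in B) (base_point K) P'.
Local Notation C := (dual_coord B).
Local Notation C' := (dsubmx (dual_coord B)).
Local Notation D := (L * G - Q ^+ 2).
Local Notation W := (lift_direction B).
Local Notation pr := (project_direction B).
Implicit Types (x h : 'rV[K]_4) (v w y t : 'rV[K]_6) (m : seq nat).

Lemma kummer_discriminant : kummer_quartic (discriminant L Q G).
Proof.
have hD := discriminant_homog LQG.
have XE x (_ : x != 0) : discriminant L Q G x <-> D.@[x 0] = 0 by [].
have b_s : nth [::] splits 0 \in splits by [].
have X_point : exists2 z : 'rV[K]_4, z != 0 & discriminant L Q G z.
  exists (pr (node K (nth [::] splits 0))); first exact: (project_node_neq0 P1 P3 offP B_coord b_s).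
  have : grad D (pr (node K (nth [::] splits 0))) = 0.
    apply/(discriminant_crit P1 P3 offP B_coord LQG); left.
    by exists (nth [::] splits 0) => //; exists 1; rewrite scale1r.
  move=> g0; have := euler (pr (node K (nth [::] splits 0))) hD.
  by rewrite dgrad_dot g0 dotC dot0l => /esym/eqP; rewrite mulf_eq0 pnatr_eq0 => /eqP.
split; first by exists D; split=> //; exact: (discriminant_neq0 P1 P3 offP B_coord LQG).
apply: has_exactly_points_ext (discriminant_critical_points P1 P3 offP B_coord LQG) => x.
by rewrite (singular_pointE _ hD (radical_discriminant P1 P3 offP B_coord LQG) XE X_point).
Qed.

Let sectionE h : tangent_section B P' h <-> (quartic_poly C').@[h 0] = 0.
Proof. exact: (tangent_sectionE P1 P3 offP B_coord P'_dual). Qed.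

Let section_XE h (_ : h != 0) := sectionE h.

Let section_point : exists2 z : 'rV[K]_4, z != 0 & tangent_section B P' z.
Proof.
exists (section_coord B (segre_dual P)); first exact: (section_segre_dual_neq0 P1 P3 offP B_coord).
apply/sectionE; rewrite meval_quartic.
rewrite (section_coordK B_coord) ?power_sum_segre_dual1 ?dot_segre_dual //.
exact: igusa_segre_dual.
Qed.

Lemma kummer_tangent_section : kummer_quartic (tangent_section B P').
Proof.
split.
  exists (quartic_poly C'); split=> //; last by exact: quartic_homog.
  exact: (quartic_section_neq0 P1 P3 offP B_coord).
apply: has_exactly_points_ext (section_critical_points P1 P3 offP B_coord) => x.
by rewrite (singular_pointE _ (quartic_homog C') (radical_section P1 P3 offP B_coord)
  section_XE section_point).
Qed.

Lemma section_tangentE h x : tangent_hyperplane (tangent_section B P') h x <->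
  [/\ h != 0, tangent_section B P' h, x != 0 &
      exists2 c, c != 0 & x = c *: grad (quartic_poly C') h].
Proof.
exact: (tangent_hyperplaneE (quartic_homog C') (radical_section P1 P3 offP B_coord)
  section_XE section_point).
Qed.

Lemma projectE v : pr v = v *m C'^T.
Proof.
by rewrite /pr -[in LHS](vsubmxK C) tr_col_mx mul_mx_row row_mxKr.
Qed.

Lemma disc_scale k v : disc P (k *: v) = k ^+ 4 * disc P v.
Proof. by rewrite /disc polar_L_scale polar_Q_scale power_sum_scale; field. Qed.

Lemma disc_lift_project v : p 1 v = 0 -> disc P (W (pr v)) = disc P v.
Proof.
move=> v1; have [u vE] := projectK B_coord v1.
by rewrite {2}vE addrC (disc_shift P3).
Qed.

(** The Gauss image c of y lies on the cubic, and c_j^2 = r y_j + k gives Q(c) = r times the product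
    of y with P, plus k s_1(P), which is zero. So the line from P to c is tangent at c. *)
Lemma tangent_section_dual h x :
  tangent_hyperplane (tangent_section B P') h x -> D.@[x 0] = 0.
Proof.
case/section_tangentE => h0 /sectionE hE x0 [c c0 ->].
rewrite meval_quartic in hE; set y := h *m C' in hE.
have y1 : p 1 y = 0 by exact: (section_sum1 B_coord).
have yP : dot y P = 0 by exact: (section_dot B_coord).
rewrite (meval_discriminant P3 B_coord LQG) (grad_section B_coord) scalerA.
rewrite liftZ disc_scale -projectE disc_lift_project ?power_sum_igusa_dual1 //.
suff -> : disc P (igusa_dual y) = 0 by rewrite mulr0.
rewrite /disc power_sum_igusa_dual3 //.
suff -> : polar_Q P (igusa_dual y) = 0 by ring.
have [r rE] := segre_dual_igusa_dual y1 hE.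
transitivity (r * dot y P + p 2 (igusa_dual y) / 6%:R * p 1 P); last by rewrite yP P1; ring.
rewrite power_sum1E /dot !mulr_sumr -big_split; apply: eq_bigr => j _ /=.
have := congr1 (fun u : 'rV_6 => u 0 j) rE; rewrite [LHS]mxE [RHS]mxE => /eqP.
by rewrite subr_eq => /eqP->; ring.
Qed.

(* The plane spanned by P and the plane of the Segre cubic attached to m; together
   with L = 0 these are the 16 tropes of the discriminant. *)
Definition trope m : 'rV[K]_6 :=
  duad_sum P m 1 *: (delta_mx 0 (inord (nth 0%N m 0)) + delta_mx 0 (inord (nth 0%N m 3)))
  + (- duad_sum P m 0) *: (delta_mx 0 (inord (nth 0%N m 1)) + delta_mx 0 (inord (nth 0%N m 4))).

Lemma dot_trope v m : dot v (trope m) =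
  duad_sum P m 1 * (entry v (nth 0%N m 0) + entry v (nth 0%N m 3))
  - duad_sum P m 0 * (entry v (nth 0%N m 1) + entry v (nth 0%N m 4)).
Proof.
by rewrite /trope dotDr !dotZr !dotDr !(dotC v) !dot_delta mulNr.
Qed.

Definition center_square : 'rV[K]_6 := \row_j P 0 j ^+ 2.

Lemma dot_center_square v : dot v center_square = polar_L P v.
Proof. by apply: eq_bigr => j _; rewrite mxE mulrC. Qed.

Definition tropes : seq 'rV[K]_6 := center_square :: [seq trope m | m <- synthemes].

Lemma tropesP t : t \in tropes ->
  [/\ dot P t = 0, exists2 v, p 1 v = 0 & dot v t != 0 &
      exists v, [/\ p 1 v = 0, dot v t = 0 & disc P v != 0]].
Proof.
have n94 : 9%:R / 4%:R != 0 :> K by rewrite mulf_neq0 ?invr_eq0 ?pnatr_eq0.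
rewrite inE => /orP[/eqP->|/mapP[m m_s ->]].
  split.
  - by rewrite dot_center_square -[RHS]P3; apply: eq_bigr => j _; rewrite -exprSr.
  - exists (node K (nth [::] splits 0)); first exact: node_sum.
    by rewrite dot_center_square; apply: polar_L_node.
  pose m := nth [::] synthemes 0; have m_perm : perm_eq m (iota 0 6) by [].
  have [v [vm Lv Qv]] := on_plane_L0_Q_neq0 P1 P3 offP m_perm.
  exists v; split; first exact: (on_plane_sum1 m_perm vm).
    by rewrite dot_center_square.
  by rewrite /disc Lv mulr0 mul0r sub0r oppr_eq0 mulf_neq0 ?expf_neq0.
have m_perm := syntheme_perm m_s.
have X0 := duad_sum_neq0 offP m_perm (erefl : (0 < 3)%N).
have Y0 := duad_sum_neq0 offP m_perm (erefl : (1 < 3)%N).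
split.
- by rewrite dot_trope /entry -!/(duad_sum P m _) /duad_sum /=; ring.
- pose v : 'rV[K]_6 := arrange m [:: 1; 0; -1].
  have vE k : (k < 6)%N -> entry v (nth 0%N m k) = nth 0 [:: 1; 0; -1] k.
    exact: arrangeE.
  exists v; first by rewrite power_sum1E (sum_perm _ m_perm) -!/(entry _ _) !vE //=; ring.
  by rewrite dot_trope !vE //= !addr0 mulr1 mulr0 subr0.
(* On the plane of m, s_3 = 0 and the discriminant is a multiple of Q^2; at this point Q = X. *)
pose v := syntheme_vector m 1 0 0 : 'rV[K]_6.
have vm : on_plane m v by exact: vector_on_plane.
exists v; split; first exact: (on_plane_sum1 m_perm vm).
  have := vm 0%N erefl; have := vm 1%N erefl => /= e1 e0.
  by rewrite dot_trope e0 e1 !mulr0 subrr.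
rewrite /disc (power_sum3_on_plane m_perm vm) mulr0 sub0r oppr_eq0 mulf_neq0 ?expf_neq0 //.
rewrite polar_QE polar_QQ_on_plane //.
by rewrite !(mul0r, mulr0, mul1r, addr0).
Qed.

Lemma dot_lift x t : dot x (t *m (dsubmx B)^T) = dot (W x) t.
Proof.
by rewrite /lift_direction -[in RHS](vsubmxK B) mul_row_col mul0mx add0r dot_mulmx.
Qed.

Lemma dot_lift_project v t : dot P t = 0 -> p 1 v = 0 -> dot (W (pr v)) t = dot v t.
Proof.
move=> Pt v1; have [u vE] := projectK B_coord v1.
by rewrite {2}vE dotDl dotZl Pt mulr0 add0r.
Qed.

Lemma discriminant_generic_tangent x : D.@[x 0] = 0 ->
  (forall t, t \in tropes -> dot (W x) t != 0) -> x != 0 ->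
  exists h, tangent_hyperplane (tangent_section B P') h x.
Proof.
rewrite (meval_discriminant P3 B_coord LQG) => Dx off x0.
have L0 : polar_L P (W x) != 0 by rewrite -dot_center_square off // mem_head.
pose u := - polar_Q P (W x) / (2%:R * polar_L P (W x)); pose q := W x + u *: P.
have q1 : p 1 q = 0 by exact: (power_sum1_shift P1 _ (lift_sum1 B_coord x)).
have Lq : polar_L P q = polar_L P (W x) by exact: (polar_L_shift P3).
have Qq : polar_Q P q = 0.
  by rewrite (polar_Q_shift P3) /u; field; rewrite L0.
have q3 : p 3 q = 0.
  move: Dx; rewrite -(disc_shift P3 (W x) u) -/q /disc Qq expr0n mulr0 subr0 => /eqP.
  by rewrite !mulf_eq0 pnatr_eq0 Lq (negPf L0) => /eqP.
have dot_q t : dot P t = 0 -> dot q t = dot (W x) t.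
  by move=> Pt; rewrite dotDl dotZl Pt mulr0 addr0.
(* Points of the plane of m satisfy the equation of [trope] m, so q avoids all 15 planes and s_5(q)
   <> 0. *)
have offq m : m \in synthemes -> ~ on_plane m q.
  move=> m_s qm; have t_s : trope m \in tropes by rewrite inE map_f ?orbT.
  have [Pt _ _] := tropesP t_s; have /eqP[] := off _ t_s.
  have := qm 0%N erefl; have := qm 1%N erefl => /= e1 e0.
  by rewrite -dot_q // dot_trope e0 e1 !mulr0 subrr.
have q5 : p 5 q != 0.
  apply/eqP => /(opp_coord_segre q1 q3)[i [j [ij qij]]].
  by have [m m_s] := segre_opp_coord_plane (conj q1 q3) ij qij; exact: offq.
pose y := segre_dual q; have y1 : p 1 y = 0 by exact: power_sum_segre_dual1.
have yP : dot y P = 0.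
  transitivity (polar_Q P q - p 2 q / 6%:R * p 1 P); last by rewrite Qq P1; ring.
  rewrite /polar_Q power_sum1E mulr_sumr -sumrB; apply: eq_bigr => j _.
  by rewrite mxE; ring.
pose h := section_coord B y; have hy : h *m C' = y by exact: (section_coordK B_coord).
pose e := 4%:R * (- (4%:R / 5%:R) * p 5 q).
have e0 : e != 0.
  by rewrite !mulf_neq0 ?oppr_eq0 ?mulf_neq0 ?invr_eq0 ?pnatr_eq0.
have gE : grad (quartic_poly C') h = e *: x.
  rewrite (grad_section B_coord) hy /y igusa_dual_segre_dual // -scalemxAl scalerA; congr (_ *: _).
  by rewrite -projectE (project_shift B_coord) (liftK B_coord).
exists h; apply/section_tangentE; split=> //.
- apply: contra_neq x0 => h0; apply/eqP; move/eqP: gE.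
  have -> : grad (quartic_poly C') h = 0.
    rewrite (grad_section B_coord) h0 mul0mx.
    have -> : igusa_dual (0 : 'rV[K]_6) = 0.
      rewrite -[X in igusa_dual X](scale0r (0 : 'rV[K]_6)).
      by rewrite igusa_dual_scale expr0n scale0r.
    by rewrite mul0mx scaler0.
  by rewrite eq_sym scaler_eq0 (negPf e0).
- by apply/sectionE; rewrite meval_quartic hy; exact: igusa_segre_dual.
by exists e^-1; rewrite ?invr_eq0 // gE scalerA mulVf // scale1r.
Qed.

Lemma discriminant_dual x : discriminant L Q G x <-> dual_variety (tangent_section B P') x.
Proof.
rewrite /discriminant; apply: iff_sym.
apply: (zariski_closureE (ls := [seq t *m (dsubmx B)^T | t <- tropes]) (discriminant_homog LQG)
  (radical_discriminant P1 P3 offP B_coord LQG)) => //.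
- move=> _ /mapP[t /tropesP[Pt [v v1 vt] [w [w1 wt wD]]] ->]; split.
    apply: contra_neq vt => l0.
    by rewrite -(dot_lift_project Pt v1) -dot_lift l0 dotC dot0l.
  exists (pr w); first by rewrite dot_lift dot_lift_project.
  by rewrite (meval_discriminant P3 B_coord LQG) disc_lift_project.
- by move=> h [q]; exact: tangent_section_dual.
move=> h h0 hD off; apply: discriminant_generic_tangent => // t t_s.
by rewrite -dot_lift; apply: off; apply/mapP; exists t.
Qed.

End Duality.

Local Open Scope complex_scope.

Theorem proposition26 (R : realType) (P : 'rV[R[i]]_6)
    (P_neq0 : P != 0) (P_Segre : segre_cubic P)
    (P_planes : forall s : 'S_6, ~ segre_plane s P)
    (B : 'M[R[i]]_(1 + 4, 6)) (B_coord : coordinates_at P B)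
    (P_smooth : smooth_point (segre_in B) (base_point R[i]))
    (P' : 'rV[R[i]]_(1 + 4))
    (P'_dual : tangent_hyperplane (segre_in B) (base_point R[i]) P')
    (L Q G : {mpoly R[i][4]}) (LQG : segre_equation B L Q G) :
  (* T_P' S is the space of hyperplanes of P^4 through P, hence is dual to the
     space P^3 of lines through P *)
  tangent_hyperplane (igusa_in B) P' (base_point R[i]) /\
  kummer_quartic (discriminant L Q G) /\
  kummer_quartic (tangent_section B P') /\
  (forall x : 'rV[R[i]]_4, x != 0 ->
     (discriminant L Q G x <-> dual_variety (tangent_section B P') x)).
Proof.
have [P1 P3] := P_Segre.
(* A point of the cubic with two opposite coordinates lies on one of the 15 planes. *)
have offP (i j : 'I_6) : i != j -> P 0 i + P 0 j != 0.
  move=> ij; apply/eqP => Pij.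
  have [m m_s Pm] := segre_opp_coord_plane P_Segre ij Pij.
  have [s Ps] := on_plane_segre_plane (syntheme_perm m_s) Pm.
  exact: (P_planes s).
split; first exact: (tangent_hyperplane_dual P1 P3 offP B_coord P'_dual).
split; first exact: (kummer_discriminant P1 P3 offP B_coord LQG).
split; first exact: (kummer_tangent_section P1 P3 offP B_coord P'_dual).
by move=> x _; exact: (discriminant_dual P1 P3 offP B_coord LQG P'_dual).
Qed.
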